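(* Let $f$ and $\mathcal{P}=\{\mathsf{P}^*\}$ satisfy conditions (A1)–(A4) listed in the context. Let $M>0$ and assume that the following forward-backward system admits a unique solution $L$ (an adapted process, with terminal convention $L_T=0$): $$Y^L_t=e^{-\int_0^t\beta_z dz}\Big(\eta\vee\sup_{0\le q\le t}\big\{L_q e^{\int_0^q\beta_z dz}\big\}\Big),\qquad U^L_t=\mathsf{E}_t\Big[\int_t^T f(s,Y^L_s,U^L_s)\,ds\Big],\qquad t\in[0,T],$$ $$\mathsf{E}_\tau\Big[\int_\tau^T\exp\Big(\int_0^t\partial_u f(z,Y^L_z,U^L_z)\,dz\Big)\,\partial_y f\Big(t,\sup_{\tau\le q\le t}\big\{L_q e^{-\int_q^t\beta_s ds}\big\},U^L_t\Big)\theta_{t,\tau}\,dt\Big]=M\psi_\tau$$ for all stopping times $\tau<T$. Then the consumption plan $C^L$ given by $C^L_{0-}=0$ and $$C^L_t=\int_0^t Y^L_s\,ds+\int_0^t\beta_s^{-1}\,dY^L_s,\qquad t\in[0,T],$$ is optimal for the utility maximization problem $\sup_{C\in\mathcal{A}(w)}U^C_0$ with initial capital $w=\mathsf{E}\big[\int_0^T\psi_t\,dC^L_t\big]$.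
   Context: Fix $T>0$. Let $(\Omega,\mathcal{F},\mathsf{P}_0)$ be a probability space carrying a standard Brownian motion $B=\{B_t\}_{t\in[0,T]}$ and a Poisson random measure $v(dt,dx)$ on $\mathbb{R}_*=\mathbb{R}\setminus\{0\}$ (with time in $[0,T]$) with intensity $\vartheta$, a $\sigma$-finite measure on $\mathbb{R}_*$ with $\int_{\mathbb{R}_*}(1\wedge x^2)\,\vartheta(dx)<\infty$. $(\mathcal{F}_t)_{t\in[0,T]}$ is the filtration generated by $B$, $v$ and the $\mathsf{P}_0$-negligible sets. $\mathsf{E}$ is expectation under $\mathsf{P}_0$, $\mathsf{E}^*$ expectation under $\mathsf{P}^*$, and $\mathsf{E}_\tau[\cdot]=\mathsf{E}[\cdot\mid\mathcal{F}_\tau]$. The interest rate $r=\{r_t\}$ is a bounded progressively measurable process, $\gamma_t=\exp(-\int_0^t r_s\,ds)$. The financial market is complete: the set $\mathcal{P}=\{\mathsf{P}^*\}$ is a singleton, where $\mathsf{P}^*$ is a probability measure on $(\Omega,\mathcal{F}_T)$ equivalent to $\mathsf{P}_0$. The state-price density is $\psi_t=\gamma_t\,\frac{d\mathsf{P}^*}{d\mathsf{P}_0}\big|_{\mathcal{F}_t}$. $\mathcal{X}$ is the set of consumption plans: distribution functions $C=\{C_t\}_{t\in[0,T]}$ of nonnegative optional random measures on $[0,T]$, i.e. nondecreasing, right-continuous, adapted, nonnegative processes, with $C_{0-}=0$; integrals $\int_0^t\cdots dC_s$ include the possible atoms at $0$ and $t$. For $w>0$, $\mathcal{A}(w)=\{C\in\mathcal{X}:\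 \mathsf{E}^*[\int_0^T\gamma_t\,dC_t]\le w\}$. The level of satisfaction of $C\in\mathcal{X}$ is $Y^C_t=\eta_t+\int_0^t\theta_{t,s}\,dC_s$, where $\eta_t=\eta e^{-\int_0^t\beta_s ds}$ and $\theta_{t,s}=\beta_s e^{-\int_s^t\beta_z dz}$ for $0\le s\le t\le T$, with $\beta$ a strictly positive continuous function on $[0,T]$ and $\eta\ge0$ a constant. In the definition of $C^L$ the process $Y^L$ is started from $Y^L_{0-}=\eta$, so that the $dY^L$-integral includes the possible jump $Y^L_0-\eta$ at time $0$. The recursive utility $U^C$ of $C$ is the unique adapted càdlàg process with $\mathsf{E}[\sup_{t}|U^C_t|^2]<\infty$ satisfying $U^C_t=\mathsf{E}_t[\int_t^T f(s,Y^C_s,U^C_s)\,ds]$, $t\in[0,T]$ (it exists for every $C\in\mathcal{A}(w)$, $w>0$, under the conditions below). The process $U^L$ is the recursive utility of the plan $C^L$, whose level of satisfaction is $Y^L$. Conditions on the Borel measurable aggregator $f:[0,T]\times\mathbb{R}_+\times\mathbb{R}\to\mathbb{R}$, $(s,y,u)\mapsto f(s,y,u)$, and on $\mathsf{P}^*$: (A1) for every $s\in[0,T]$, $f(s,\cdot,\cdot)$ is strictly concave and continuously differentiable, and for every $s\in[0,T]$, $u\in\mathbb{R}$, $f(s,\cdot,u)$ is strictly increasing; (A2) there is a constant $K$ with $|f(s,y,u)-f(s,y,u')|\le K|u-u'|$ for all $(s,y)\in[0,T]\times\mathbb{R}_+$, $u,u'\in\mathbb{R}$; (A3) there are constants $\alpha\in(0,\frac12)$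 and $K$ with $|f(s,y,0)|\le K(1+|y|^\alpha)$ for all $s\in[0,T]$, $y\in\mathbb{R}_+$; (A4) there exists $p>1$ with $2\alpha p<1$ such that $\frac{d\mathsf{P}_0}{d\mathsf{P}^*}\in L^q(\mathsf{P}^* )$ for $q=\frac{1}{1-2\alpha p}$. *)

(* Defs.v *)
From HB Require Import structures.
From mathcomp Require Import all_boot all_order all_algebra.
From mathcomp Require Import all_classical all_reals all_analysis.
From mathcomp Require Import measurable_realfun.

Set Implicit Arguments.
Unset Strict Implicit.
Unset Printing Implicit Defensive.

Import Order.TTheory GRing.Theory Num.Def Num.Theory.
Import numFieldNormedType.Exports.

Local Open Scope classical_set_scope.
Local Open Scope ring_scope.

(** Processes are functions [X : R -> Omega -> R], time first; only their values
    on [[0, T]] matter. *)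

Section StieltjesIntegrals.
Context {R : realType}.
Implicit Types (F g : R -> R) (T : R).

(* The path of a process with left limit [y0] at [0-], extended to the whole
   line, so that its Stieltjes measure has mass [g 0 - y0] at [0] and does not
   charge the complement of [[0, T]]. *)
Definition extend_path T (y0 : R) g (s : R) : R :=
  if s < 0 then y0 else g (Num.min s T).

Definition pack_cumulative F (H : nondecreasing F /\ right_continuous F) :
    cumulative R R :=
  HB.pack_for (cumulative R R) F
    (@isCumulative.Build R _ R F (proj1 H) (proj2 H)).

(* Lebesgue-Stieltjes measure of a bare function; it is the zero measure if the
   function is not nondecreasing and right-continuous. *)
Definition stieltjes F : {measure set (measurableTypeR R) -> \bar R} :=
  match pselect (nondecreasing F /\ right_continuous F) with
  | left H => lebesgue_stieltjes_measure (pack_cumulative H)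
  | right _ => mzero
  end.

(* Jordan decomposition of a path that is constant on ]-oo, 0[ (hence the
   arbitrary base point -1): its positive and negative variations. *)
Definition pos_variation g (s : R) : R := fine (pos_tv (-1) g (Num.max s (-1))).
Definition neg_variation g (s : R) : R := fine (neg_tv (-1) g (Num.max s (-1))).

(* Integral of [h] over [A] against the signed measure [dg], for [g] of bounded
   variation, right-continuous, and constant on ]-oo, 0[. *)
Definition bv_integral g (A : set R) (h : R -> R) : R :=
  \int[stieltjes (pos_variation g)]_(s in A) h s
  - \int[stieltjes (neg_variation g)]_(s in A) h s.

End StieltjesIntegrals.

Section Processes.
Context {R : realType} {d : measure_display} {Omega : measurableType d}.
Variables (P0 : probability Omega R) (T : R).
Implicit Types (X Y U L C B : R -> Omega -> R) (G : set (set Omega))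
  (F : R -> set (set Omega)) (tau : Omega -> R).

Definition measurable_wrt {d'} {S : measurableType d'} G (X : Omega -> S) :=
  forall D : set S, measurable D -> G (X @^-1` D).

Definition adapted F X :=
  forall t, 0 <= t <= T -> measurable_wrt (F t) (X t).

Definition progressive F X := forall t, 0 <= t <= T ->
  measurable_fun (`[0, t] `*` setT)
    (fun p : R * g_sigma_algebraType (F t) => X p.1 p.2).

Definition right_continuous_paths X := forall w t, 0 <= t < T ->
  (fun s => X s w) @ t^'+ --> X t w.

Definition cadlag X := right_continuous_paths X /\
  forall w t, 0 < t <= T -> cvg ((fun s => X s w) @ t^'-).

Definition indistinguishable X Y :=
  {ae P0, forall w, forall t, 0 <= t <= T -> X t w = Y t w}.

Definition stopping_time F tau :=
  (forall w, 0 <= tau w <= T) /\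
  forall t, 0 <= t <= T -> F t [set w | tau w <= t].

Definition stopped_algebra F tau : set (set Omega) :=
  [set A | F T A /\
     forall t, 0 <= t <= T -> F t (A `&` [set w | tau w <= t])].

(* [Y] is a version of the conditional expectation of [X] given [G]. *)
Definition is_cond_exp G (X Y : Omega -> \bar R) :=
  [/\ P0.-integrable setT X, P0.-integrable setT Y, measurable_wrt G Y &
      forall A, G A -> (\int[P0]_(w in A) X w = \int[P0]_(w in A) Y w)%E].

Definition brownian_motion B :=
  [/\ forall t, 0 <= t <= T -> measurable_fun setT (B t),
      {ae P0, forall w, B 0 w = 0 /\ {within `[0, T], continuous (B ^~ w)}},
      forall s t, 0 <= s -> s < t -> t <= T -> forall A, measurable A ->
        P0 [set w | A (B t w - B s w)] = normal_prob 0 (Num.sqrt (t - s)) A &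
      forall (n : nat) (t : nat -> R) (A : nat -> set R),
        (forall i, (i <= n)%N -> 0 <= t i <= T) ->
        (forall i, (i < n)%N -> t i <= t i.+1) ->
        (forall i, measurable (A i)) ->
        P0 (\bigcap_(i in `I_n) [set w | A i (B (t i.+1) w - B (t i) w)]) =
        (\prod_(i < n) fine (P0 [set w | A i (B (t i.+1) w - B (t i) w)]))%:E].

Definition jump_domain (t : R) : set (R * R) :=
  [set p | 0 <= p.1 <= t /\ p.2 != 0].

(* Only sets of finite intensity are constrained: the case of infinite intensity
   follows by sigma-finiteness. *)
Definition poisson_random_measure
    (theta : {sigma_finite_measure set R -> \bar R})
    (v : Omega -> {measure set (R * R) -> \bar R}) :=
  [/\ forall E, measurable E -> E `<=` jump_domain T ->
        measurable_fun setT (fun w => v w E),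
      forall E, measurable E -> E `<=` jump_domain T ->
        ((lebesgue_measure \x theta) E < +oo)%E -> forall k : nat,
        P0 [set w | v w E = k%:R%:E] =
        poisson_prob (fine ((lebesgue_measure \x theta)%E E)) k [set k] &
      forall (n : nat) (E : nat -> set (R * R)) (D : nat -> set (\bar R)),
        (forall i, measurable (E i) /\ E i `<=` jump_domain T) ->
        trivIset `I_n E -> (forall i, measurable (D i)) ->
        P0 (\bigcap_(i in `I_n) [set w | D i (v w (E i))]) =
        (\prod_(i < n) fine (P0 [set w | D i (v w (E i))]))%:E].

(* Filtration generated by [B], [v] and the null sets. The null sets are those
   of the given sigma-algebra, so that completeness of [P0] is not needed; if
   [P0] is complete they are all the negligible sets. *)
Definition generated_filtration B (v : Omega -> {measure set (R * R) -> \bar R})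
    (t : R) : set (set Omega) :=
  <<s [set A | (exists s D, [/\ 0 <= s <= t, measurable D & A = B s @^-1` D])
         \/ (exists E (D : set (\bar R)), [/\ measurable E,
              E `<=` jump_domain t, measurable D & A = [set w | D (v w E)]])
         \/ (measurable A /\ P0 A = 0%E)] >>.

End Processes.

Section Aggregator.
Context {R : realType}.
Variables (T : R) (f : R -> R -> R -> R).

(* Difference quotients are restricted to R_+, so that the derivative at [y = 0]
   is the right derivative. *)
Definition quotient_y s y u (h : R) : R := (f s (y + h) u - f s y u) / h.

Definition d_y s y u : R :=
  lim (quotient_y s y u @ within [set h | 0 <= y + h] 0^').

Definition d_u s y u : R := derive1 (f s y) u.

Definition borel_aggregator :=
  measurable_fun [set p : R * R * R | 0 <= p.1.1 <= T /\ 0 <= p.1.2]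
    (fun p : R * R * R => f p.1.1 p.1.2 p.2).

Definition strictly_concave s :=
  forall y u y' u' l, 0 <= y -> 0 <= y' -> (y, u) <> (y', u') -> 0 < l < 1 ->
    l * f s y u + (1 - l) * f s y' u' <
    f s (l * y + (1 - l) * y') (l * u + (1 - l) * u').

(* Class C^1 on the closed half-plane R_+ x R. *)
Definition continuously_differentiable s :=
  [/\ forall y u, 0 <= y ->
        cvg (quotient_y s y u @ within [set h | 0 <= y + h] 0^'),
      forall y u, 0 <= y -> derivable (f s y) u 1,
      {within [set p : R * R | 0 <= p.1], continuous (fun p => d_y s p.1 p.2)} &
      {within [set p : R * R | 0 <= p.1], continuous (fun p => d_u s p.1 p.2)}].

Definition condA1 := forall s, 0 <= s <= T ->
  [/\ strictly_concave s, continuously_differentiable s &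
      forall u y y', 0 <= y -> y < y' -> f s y u < f s y' u].

Definition condA2 := exists K : R, forall s y u u', 0 <= s <= T -> 0 <= y ->
  `|f s y u - f s y u'| <= K * `|u - u'|.

Definition condA3 (alpha : R) := 0 < alpha < 2^-1 /\
  exists K : R, forall s y, 0 <= s <= T -> 0 <= y ->
    `|f s y 0| <= K * (1 + y `^ alpha).

End Aggregator.

Section Market.
Context {R : realType} {d : measure_display} {Omega : measurableType d}.
Variables (P0 : probability Omega R) (T : R) (F : R -> set (set Omega)).
(* A probability measure on [(Omega, F T)]. *)
Variable Pstar : probability (g_sigma_algebraType (F T)) R.

Definition equivalent_measure :=
  forall A, F T A -> (Pstar A = 0%E <-> P0 A = 0%E).

(* Cadlag version of the density process [dPstar/dP0] on [F t]. *)
Definition density_process (Z : R -> Omega -> R) :=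
  [/\ adapted T F Z, cadlag T Z, forall t w, 0 <= Z t w &
      forall t A, 0 <= t <= T -> F t A ->
        (Pstar A = \int[P0]_(w in A) (Z t w)%:E)%E].

(* [D] is a version of [dP0/dPstar] on [F T]. *)
Definition condA4 (alpha : R) := exists p : R,
  [/\ 1 < p, 2 * alpha * p < 1 &
      exists D : g_sigma_algebraType (F T) -> R,
      [/\ forall w, 0 <= D w,
          forall A, F T A -> (P0 A = \int[Pstar]_(w in A) (D w)%:E)%E &
          D \in Lfun Pstar ((1 - 2 * alpha * p)^-1)%:E]].

Definition discount (r : R -> Omega -> R) (t : R) (w : Omega) : R :=
  expR (- \int[lebesgue_measure]_(s in `[0, t]) r s w).

(* Consumption plans; [C_{0-} = 0] is encoded by integrating against the
   measure of [extend_path T 0]. *)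
Definition plan (C : R -> Omega -> R) :=
  [/\ adapted T F C, right_continuous_paths T C,
      forall w s t, 0 <= s -> s <= t -> t <= T -> C s w <= C t w &
      forall w t, 0 <= t <= T -> 0 <= C t w].

Definition dC_measure (C : R -> Omega -> R) (w : Omega) :
    {measure set (measurableTypeR R) -> \bar R} :=
  stieltjes (extend_path T 0 (C ^~ w)).

(* The capital [x] is extended-real, so that finiteness of the expected cost of
   a given plan need not be assumed to use it as initial capital. *)
Definition admissible (r : R -> Omega -> R) (x : \bar R) (C : R -> Omega -> R) :=
  plan C /\
  (\int[Pstar]_w \int[dC_measure C w]_(t in `[0%R, T]) (discount r t w)%:E <= x)%E.

End Market.

Section Utility.
Context {R : realType} {d : measure_display} {Omega : measurableType d}.
Variables (P0 : probability Omega R) (T : R) (F : R -> set (set Omega)).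
Variables (f : R -> R -> R -> R) (beta : R -> R) (eta : R).
Implicit Types (Y U L C psi : R -> Omega -> R).

Definition decay (s t : R) : R :=
  expR (- \int[lebesgue_measure]_(z in `[s, t]) beta z).

Definition theta_kernel (t s : R) : R := beta s * decay s t.

Definition satisfaction C (t : R) (w : Omega) : R :=
  eta * decay 0 t + \int[dC_measure T C w]_(s in `[0, t]) theta_kernel t s.

(* [U] is the recursive utility of a plan with level of satisfaction [Y]. *)
Definition recursive_utility Y U :=
  [/\ adapted T F U, cadlag T U,
      (\int[P0]_w ereal_sup [set ((U t w) ^+ 2)%:E | t in `[0%R, T]] < +oo)%E,
      {ae P0, forall w, lebesgue_measure.-integrable `[0, T]
         (fun s => (f s (Y s w) (U s w))%:E)} &
      forall t, 0 <= t <= T ->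
        is_cond_exp P0 (F t)
          (fun w => (\int[lebesgue_measure]_(s in `[t, T])
                       f s (Y s w) (U s w))%:E)
          (fun w => (U t w)%:E)].

Definition running_sup L (a t : R) (w : Omega) : R :=
  sup [set L q w * decay q t | q in `[a, t]].

Definition level L (t : R) (w : Omega) : R :=
  decay 0 t * Num.max eta (sup [set L q w / decay 0 q | q in `[0, t]]).

(* Integral inside the conditional expectation of the first-order condition, for
   [tau] with value [a]. *)
Definition marginal_utility L U (a : R) (w : Omega) : \bar R :=
  (\int[lebesgue_measure]_(t in `[a, T])
    (expR (\int[lebesgue_measure]_(z in `[0%R, t])
             d_u f z (level L z w) (U z w))
     * d_y f t (running_sup L a t w) (U t w)
     * theta_kernel t a)%:E)%E.

Record forward_backward_solution (M : R) psi L U : Prop := {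
  fb_adapted : adapted T F L;
  (* needed for [d_y f], whose second argument ranges over R_+ *)
  fb_nonneg : forall t w, 0 <= t <= T -> 0 <= L t w;
  fb_terminal : forall w, L T w = 0;
  (* the suprema are finite *)
  fb_bounded : forall w, has_ubound [set L t w | t in `[0, T]];
  (* [level L] is the level of satisfaction of a consumption plan *)
  fb_level_adapted : adapted T F (level L);
  fb_level_right_continuous : right_continuous_paths T (level L);
  fb_utility : recursive_utility (level L) U;
  fb_first_order : forall tau : Omega -> R,
    stopping_time T F tau -> (forall w, tau w < T) ->
    is_cond_exp P0 (stopped_algebra T F tau)
      (fun w => marginal_utility L U (tau w) w)
      (fun w => (M * psi (tau w) w)%:E) }.

(* Values of [L] strictly below its running suprema do not enter the system, so
   uniqueness is that of the processes [level L] and [U] determined by [L]. *)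
Definition unique_forward_backward_solution (M : R) psi L U :=
  forward_backward_solution M psi L U /\
  forall L' U', forward_backward_solution M psi L' U' ->
    indistinguishable P0 T (level L') (level L) /\
    indistinguishable P0 T U' U.

(* The plan with [dC = Y dt + beta^-1 dY], where [Y] starts from
   [Y_{0-} = eta]. *)
Definition plan_of_level Y (t : R) (w : Omega) : R :=
  \int[lebesgue_measure]_(s in `[0, t]) Y s w
  + bv_integral (extend_path T eta (Y ^~ w)) `[0, t] (fun s => (beta s)^-1).

(* [C] attains the supremum of [U^C_0] over the plans admissible for [x]. *)
Definition optimal_plan (Pstar : probability (g_sigma_algebraType (F T)) R)
    (r : R -> Omega -> R) (x : \bar R) C :=
  admissible Pstar r x C /\
  exists U, recursive_utility (satisfaction C) U /\
    forall C' U', admissible Pstar r x C' ->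
      recursive_utility (satisfaction C') U' ->
      {ae P0, forall w, U' 0 w <= U 0 w}.

End Utility.

(* Main.v *)
(* Let A_t be the maximum of eta and of the running supremum of the values
   L_q exp(int_0^q beta), q <= t, so that Y^L_t = A_t exp(-int_0^t beta), and let
   G_t = exp(int_0^t d_u f(z, Y^L_z, U^L_z) dz).

   By concavity, a plan C' with satisfaction Y' and utility U' satisfies
   f(Y', U') - f(Y^L, U^L) <= d_y f (Y' - Y^L) + d_u f (U' - U^L), the gradient
   being taken at (Y^L, U^L).  Weighting by G and using int_0^t d_u f G ds =
   G_t - 1, the definition of the utilities and Fubini cancel the terms in
   U' - U^L, so that E U'_0 <= E U^L_0 follows from
   E int G d_y f (Y' - Y^L) dt <= 0.

   By Tonelli, E int G d_y f Y' dt is, up to the term in eta, an integral over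
   u > 0 of the marginal utilities at the hitting times tau_u of u by C'.  The
   first-order condition bounds it by M times the cost of C', because d_y f
   decreases in y and Y^L dominates the running suprema of L.  For C^L the
   hitting times of A take the place of those of C', and the bound is an equality
   for almost every u: if u is not a value of A at a rational time, A exceeds u
   right after tau_u, hence coincides there with the running supremum of L from
   tau_u on.  Optional sampling of the density process at the times tau_u
   identifies the costs under P^* and P_0.  Finally F_0 is trivial, so the
   comparison of expectations is one of utilities at time 0. *)

Require Import Defs.
From HB Require Import structures.
From mathcomp Require Import all_boot all_order all_algebra.
From mathcomp Require Import all_classical all_reals all_analysis.
From mathcomp Require Import measurable_realfun.
From mathcomp Require Import ring lra.

Set Implicit Arguments.
Unset Strict Implicit.
Unset Printing Implicit Defensive.

Import Order.TTheory GRing.Theory Num.Def Num.Theory.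
Import numFieldNormedType.Exports.

Local Open Scope classical_set_scope.
Local Open Scope ring_scope.

(** The first-order condition speaks of stopping times [tau < T] only, whereas plans are random
    measures in time. Both plans are therefore written as images, under hitting times indexed by a
    level [u], of a measure with a density in [u]. For [C'] the hitting times are its own and the
    density is 1. For [C^L] they are those of [A], with density [dec / b], where [b] is beta and
    [dec t] is exp(-int_0^t beta). This is integration by parts: Y = dec A gives dY = dec dA - b dec
    A dt, hence Y dt + dY / b = (dec / b) dA. Since theta_{t,s} = b_s dec_t / dec_s, the
    satisfaction of [C^L] is then dec_t (eta + (A_t - eta)), which is Y^L. Costs and benefits are
    compared in [0, +oo], by Tonelli, so that no integrability of a plan has to be known beforehand.
    Finiteness enters through E int G d_y f Y^L dt alone: by concavity between [Y^L] and 0, d_y f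
    Y^L is at most f(Y^L, U^L) - f(0, U^L). Hitting times equal to [T] are reached as limits of
    capped ones. *)

(** * Measures with a density, and integration on a sub-sigma-algebra *)

Section MeasureWithDensity.
Import HBNNSimple.
Context {d} {T : measurableType d} {R : realType}.
Variables (mu : {measure set T -> \bar R}) (g : T -> R).
Hypotheses (g0 : forall x, 0 <= g x) (mg : measurable_fun setT g).
Local Open Scope ereal_scope.

(** The two proofs are arguments so that the measure structure declared below can be inferred from
    the term. *)
Definition mdens of (forall x, (0 <= g x)%R) & measurable_fun setT g :=
  fun A : set T => \int[mu]_(x in A) (g x)%:E.

Local Notation nu := (mdens g0 mg).

Let mgE D : measurable_fun D (EFin \o g).
Proof. by apply/measurable_EFinP; exact: measurable_funTS. Qed.

Let mdens0 : nu set0 = 0.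
Proof. exact: integral_set0. Qed.

Let mdens_ge0 A : 0 <= nu A.
Proof. by apply: integral_ge0 => x _; rewrite lee_fin. Qed.

Let mdens_sigma_additive : semi_sigma_additive nu.
Proof.
move=> A mA tA mUA; rewrite /mdens ge0_integral_bigcup//; last first.
  by move=> x _; rewrite lee_fin.
apply: is_cvg_nneseries => n _ _.
by apply: integral_ge0 => x _; rewrite lee_fin.
Qed.

HB.instance Definition _ := isMeasure.Build _ _ _ nu
  mdens0 mdens_ge0 mdens_sigma_additive.

(** Both sides are additive and pass to increasing limits, so that simple functions reduce the claim
    to indicators, where it is the definition of [nu]. *)
Lemma ge0_integral_mdens D (h : T -> \bar R) : measurable D ->
  measurable_fun D h -> (forall x, D x -> 0 <= h x) ->
  \int[nu]_(x in D) h x = \int[mu]_(x in D) (h x * (g x)%:E).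
Proof.
move=> mD mh h0; pose h_ := nnsfun_approx mD mh.
transitivity (limn (fun n => \int[nu]_(x in D) (h_ n x)%:E)).
  rewrite -monotone_convergence//.
  - apply: eq_integral => y /[!inE] yD; apply/esym/cvg_lim => //.
    exact: cvg_nnsfun_approx.
  - by move=> n; exact/measurable_EFinP/measurable_funTS.
  - by move=> n y _; rewrite lee_fin.
  - by move=> y _ m n mn; rewrite lee_fin; exact/lefP/nd_nnsfun_approx.
transitivity (limn (fun n => \int[mu]_(x in D) ((h_ n x)%:E * (g x)%:E))).
  apply/congr_lim/funext => n.
  under [LHS]eq_integral do rewrite fimfunE -fsumEFin//.
  rewrite ge0_integral_fsum//; last 2 first.
  - by move=> y; exact/measurable_EFinP/measurable_funM.
  - by move=> y x _; rewrite nnfun_muleindic_ge0.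
  under [RHS]eq_integral => x _.
    rewrite fimfunE -fsumEFin// ge0_mule_fsuml; first over.
    by move=> y; exact: nnfun_muleindic_ge0.
  rewrite ge0_integral_fsum//; last 2 first.
  - move=> y; apply: emeasurable_funM; last exact: mgE.
    exact/measurable_EFinP/measurable_funM.
  - by move=> y x _; rewrite mule_ge0 ?nnfun_muleindic_ge0// lee_fin.
  apply: eq_fsbigr => r; rewrite inE => -[t _ <-{r}].
  under [RHS]eq_integral do rewrite EFinM -muleA.
  rewrite ge0_integralZl//; last 3 first.
  - apply: emeasurable_funM; last exact: mgE.
    exact/measurable_EFinP.
  - by move=> x _; rewrite mule_ge0 ?lee_fin.
  - by rewrite lee_fin.
  rewrite integralZl_indic_nnsfun//; congr (_ * _).
  rewrite integral_indic// [LHS]integral_mkcond [RHS]integral_mkcond.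
  apply: eq_integral => x _; rewrite /patch in_setI indicE.
  by case: ifPn => [/andP[-> ->]|/nandP[|] /negbTE ->] //;
    rewrite ?mul1e ?mul0e//; case: ifP.
rewrite -monotone_convergence//.
- apply: eq_integral => y /[!inE] yD; apply/cvg_lim => //.
  apply: cvgeZr => //; exact: cvg_nnsfun_approx.
- move=> n; apply: emeasurable_funM; last exact: mgE.
  exact/measurable_EFinP/measurable_funTS.
- by move=> n y _; rewrite mule_ge0 ?lee_fin.
- move=> y _ m n mn; apply: lee_wpmul2r; rewrite lee_fin//.
  exact/lefP/nd_nnsfun_approx.
Qed.

End MeasureWithDensity.

Section SubAlgebraIntegral.
Context {d} {Omega : measurableType d} {R : realType}.
Variables (P : {measure set Omega -> \bar R}) (G : set (set Omega)).
Hypothesis GM : G `<=` measurable.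
Local Open Scope ereal_scope.

Lemma sub_measurable_fun {d'} {S : measurableType d'}
    (X : g_sigma_algebraType G -> S) :
  measurable_fun setT X -> measurable_fun (setT : set Omega) X.
Proof.
move=> mX _ B mB; have := mX measurableT B mB.
have : <<s G >> `<=` measurable.
  by apply: smallest_sub => //; exact: sigma_algebra_measurable.
exact.
Qed.

Lemma integral_sub_density (m : {measure set (g_sigma_algebraType G) -> \bar R})
    (f : Omega -> R) (f0 : forall w, (0 <= f w)%R) (mf : measurable_fun setT f)
    (X : g_sigma_algebraType G -> \bar R) :
  (forall A, <<s G >> A -> m A = \int[P]_(w in A) (f w)%:E) ->
  measurable_fun setT X -> (forall w, 0 <= X w) ->
  \int[m]_w X w = \int[P]_w (X w * (f w)%:E).
Proof.
move=> mE mX X0.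
(* The identity, seen as a map to the coarser measurable space. The measure [m] is the push-forward
   under it of the measure with density [f]. *)
pose i : Omega -> g_sigma_algebraType G := id.
have mi : measurable_fun setT i by apply: sub_measurable_fun; exact: measurable_id.
rewrite -(ge0_integral_mdens P f0 mf)//; last exact: sub_measurable_fun.
rewrite -[RHS]/(\int[mdens P f0 mf]_(x in i @^-1` setT) (X \o i) x).
rewrite -(ge0_integral_pushforward mi)//.
by apply: (eq_measure_integral
  (pushforward _ i)) => A mA _; exact: mE.
Qed.

(** Two densities with the same integrals over the sets of [G] define the same measure on [G]. This
    is how nonnegative, possibly unbounded factors are taken out of conditional expectations. *)
Lemma eq_integral_sub (f g : Omega -> R) (X : g_sigma_algebraType G -> \bar R) :
  (forall w, 0 <= f w)%R -> (forall w, 0 <= g w)%R ->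
  measurable_fun setT f -> measurable_fun setT g ->
  (forall A, <<s G >> A -> \int[P]_(w in A) (f w)%:E = \int[P]_(w in A) (g w)%:E) ->
  measurable_fun setT X -> (forall w, 0 <= X w) ->
  \int[P]_w (X w * (f w)%:E) = \int[P]_w (X w * (g w)%:E).
Proof.
move=> f0 g0 mf mg fg mX X0.
pose i : Omega -> g_sigma_algebraType G := id.
have mi : measurable_fun setT i by apply: sub_measurable_fun; exact: measurable_id.
rewrite -(@integral_sub_density (pushforward (mdens P f0 mf) i) f)//.
by rewrite -(@integral_sub_density (pushforward (mdens P f0 mf) i) g).
Qed.

End SubAlgebraIntegral.

Lemma measurable_inv_gt0 {d} {S : measurableType d} {R : realType} (h : S -> R) :
  (forall x, 0 < h x) -> measurable_fun setT h ->
  measurable_fun setT (fun x => (h x)^-1).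
Proof.
move=> h0 mh; rewrite (_ : (fun x => _) = fun x => h x `^ (-1)).
  exact: (measurableT_comp (@measurable_powR R (-1)) mh).
by apply/funext => x; rewrite powR_inv1// ltW.
Qed.

Lemma dominated_cvg_EFin {d} {S : measurableType d} {R : realType}
    (m : {measure set S -> \bar R}) (f_ : nat -> S -> R) (f g : S -> R) :
  (forall n, measurable_fun setT (f_ n)) ->
  (forall x, (fun n => f_ n x) @ \oo --> f x) ->
  m.-integrable setT (fun x => (g x)%:E) ->
  (forall n x, `|f_ n x| <= g x) ->
  (fun n => \int[m]_x (f_ n x)%:E)%E @ \oo --> (\int[m]_x (f x)%:E)%E.
Proof.
move=> mf_ cf ig fg.
have mf : measurable_fun setT f.
  by apply: (measurable_fun_cvg mf_) => x _; exact: cf.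
have [] := @dominated_convergence _ _ _ m setT measurableT
  (fun n x => (f_ n x)%:E) (fun x => (f x)%:E) (fun x => (g x)%:E) => //.
- by move=> n; apply/measurable_EFinP.
- exact/measurable_EFinP.
- by apply: aeW => x _; apply: cvg_EFin; [exact: nearW|exact: cf].
- by apply: aeW => x n _; rewrite lee_fin.
Qed.

(** * Joint measurability of right-continuous processes *)

Section RightContinuousProcess.
Context {d} {Omega : measurableType d} {R : realType}.

Lemma measurable_set_le (x y : Omega -> R) : measurable_fun setT x ->
  measurable_fun setT y -> measurable [set w | x w <= y w].
Proof.
move=> mx my; have := measurable_fun_ler mx my.
by move=> /(_ measurableT [set true] I); rewrite setTI.
Qed.

Lemma measurable_set_lt (x y : Omega -> R) : measurable_fun setT x ->
  measurable_fun setT y -> measurable [set w | x w < y w].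
Proof.
move=> mx my; have := measurable_fun_ltr mx my.
by move=> /(_ measurableT [set true] I); rewrite setTI.
Qed.

(** The random index takes countably many values, and on each of these events the composite is one
    of the [X k]. *)
Lemma measurable_fun_truncn (x : Omega -> R) (X : nat -> Omega -> R) :
  (forall w, 0 <= x w) -> measurable_fun setT x ->
  (forall n, measurable_fun setT (X n)) ->
  measurable_fun setT (fun w => X (Num.truncn (x w)) w).
Proof.
move=> x0 mx mX _ B mB; rewrite setTI.
rewrite (_ : _ @^-1` B = \bigcup_k
   (([set w | (k%:R : R) <= x w] `&` [set w | x w < k.+1%:R]) `&` (X k @^-1` B))).
  apply: bigcupT_measurable => k; apply: measurableI; last first.
    by rewrite -[_ @^-1` _]setTI; exact: mX.
  by apply: measurableI; [exact: measurable_set_le|exact: measurable_set_lt].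
apply/seteqP; split => w /=.
  move=> Bw; exists (Num.truncn (x w)) => //; split => //.
  by have /andP[] := truncn_itv (x0 w).
case=> k _ [[kx xk]] BXk; suff -> : Num.truncn (x w) = k by [].
by apply: truncn_def; apply/andP.
Qed.

End RightContinuousProcess.

(** Processes matter on [[0, T]] only. Clamping the time turns them into functions on the whole
    product space, where joint measurability is stated. *)
Definition clamp {R : realType} (T s : R) : R := Num.max 0 (Num.min s T).

Section Clamp.
Context {R : realType}.
Implicit Types T s : R.

Lemma clamp_itv T s : 0 <= T -> 0 <= clamp T s <= T.
Proof. by move=> T0; rewrite /clamp le_max lexx/= ge_max T0 ge_min lexx orbT. Qed.

Lemma clamp_id T s : 0 <= s <= T -> clamp T s = s.
Proof. by move=> /andP[s0 sT]; rewrite /clamp min_l// max_r. Qed.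

Lemma measurable_clamp T : measurable_fun setT (clamp T).
Proof. by apply: measurable_maxr => //; apply: measurable_minr. Qed.

Lemma measurable_right_continuous {d} {Omega : measurableType d} T
    (X : R -> Omega -> R) : 0 <= T ->
  (forall s, 0 <= s <= T -> measurable_fun setT (X s)) ->
  (forall w t, 0 <= t < T -> (fun s => X s w) @ t^'+ --> X t w) ->
  measurable_fun setT (fun p : R * Omega => X (clamp T p.1) p.2).
Proof.
move=> T0 mX rX.
(* [u n s] is the first point of the grid of mesh 1 / (n + 1) strictly after the clamped time,
   capped at [T]. It approaches that time from the right, and equals [T] at time [T], where nothing
   is assumed on the right. *)
pose v n k : R := Num.min T (k.+1%:R / n.+1%:R).
pose u n s : R := v n (Num.truncn (clamp T s * n.+1%:R)).
have v_itv n k : 0 <= v n k <= T.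
  by rewrite /v le_min T0 divr_ge0//= ge_min lexx.
apply: (@measurable_fun_cvg _ _ _ _ (fun n p => X (u n p.1) p.2)).
- move=> n; apply: (@measurable_fun_truncn _ _ _
    (fun p : R * Omega => clamp T p.1 * n.+1%:R) (fun k p => X (v n k) p.2)).
  + by move=> p; rewrite mulr_ge0//; have /andP[] := clamp_itv p.1 T0.
  + apply: measurable_funM => //.
    exact: measurableT_comp (measurable_clamp T) _.
  + by move=> k; exact: measurableT_comp (mX _ (v_itv n k)) _.
- move=> -[s w] _ /=; have /andP[s0 sT] := clamp_itv s T0.
  move: s0 sT; rewrite /u; set t := clamp T s => t0 tT.
  have tn n : t < (Num.truncn (t * n.+1%:R)).+1%:R / n.+1%:R.
    by rewrite ltr_pdivlMr// truncnS_gt.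
  have nt n : (Num.truncn (t * n.+1%:R)).+1%:R / n.+1%:R <= t + n.+1%:R^-1.
    rewrite ler_pdivrMr// mulrDl mulVf// -natr1 lerD2r truncn_le mulr_ge0//.
  move: tT; rewrite le_eqVlt => /predU1P[->|tT].
    have vT n : v n (Num.truncn (T * n.+1%:R)) = T.
      by rewrite /v min_l// ler_pdivlMr// ltW// truncnS_gt.
    under eq_fun do rewrite vT.
    exact: cvg_cst.
  move/(_ w t): rX; rewrite t0 tT => /(_ isT)/cvg_at_rightP; apply; split.
    by move=> n; rewrite /v lt_min tT tn.
  apply: (@squeeze_cvgr _ _ _ _ (fun=> t) (fun n => t + n.+1%:R^-1)).
  + apply: nearW => n; rewrite /v le_min ltW// ltW//=.
    by rewrite (le_trans _ (nt n))// ge_min lexx orbT.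
  + exact: cvg_cst.
  + rewrite -[X in _ --> X]addr0; apply: cvgD; first exact: cvg_cst.
    exact: cvg_harmonic.
Qed.

End Clamp.

(** * Hitting times *)

Section HittingTime.
Context {R : realType}.
Variables (T : R).
Hypothesis T0 : 0 <= T.
Implicit Types (g : R -> R) (s t u : R).

(* The disjunct [t = T] sends to [T] the levels that [g] does not reach. *)
Definition htime g u : R := inf [set t | 0 <= t <= T /\ (t = T \/ u <= g t)].

Let htime_lb g u : has_lbound [set t | 0 <= t <= T /\ (t = T \/ u <= g t)].
Proof. by exists 0 => t [/andP[]]. Qed.

Lemma htime_ge0 g u : 0 <= htime g u.
Proof.
apply: lb_le_inf; first by exists T; split; [rewrite T0 lexx|left].
by move=> t [/andP[]].
Qed.

Lemma htime_leT g u : htime g u <= T.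
Proof.
by apply: ge_inf => //; split; [rewrite T0 lexx|left].
Qed.

Lemma htime_itv g u : 0 <= htime g u <= T.
Proof. by rewrite htime_ge0 htime_leT. Qed.

Definition rc_path g :=
  (forall s t, 0 <= s -> s <= t -> t <= T -> g s <= g t) /\
  (forall t, 0 <= t < T -> g @ t^'+ --> g t).

(** If [g t < u], right continuity keeps [g] below [u] on an interval after [t], so that the infimum
    lies strictly beyond [t]. At [t = T] the left side always holds, hence the strict bound. *)
Lemma htime_le g u t : rc_path g -> 0 <= t < T -> (htime g u <= t) = (u <= g t).
Proof.
move=> [ndg rg] /andP[t0 tT]; apply/idP/idP => [|ugt]; last first.
  by apply: ge_inf => //; split; [rewrite t0 ltW|right].
apply: contraTT; rewrite -!ltNge => gtu.
have /cvgrPdist_lt/(_ (u - g t)) : g @ t^'+ --> g t by apply: rg; rewrite t0.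
rewrite subr_gt0 => /(_ gtu) gnear.
near (t^'+)%R => s.
have ts : t < s by near: s; exact: nbhs_right_gt.
have sT : s < T by near: s; exact: nbhs_right_lt.
have gsu : g s < u.
  have : `|g t - g s| < u - g t by near: s.
  by rewrite distrC => /ltr_distlDr; rewrite addrC subrK.
rewrite (lt_le_trans ts)//; apply: lb_le_inf.
  by exists T; split; [rewrite T0 lexx|left].
move=> q [/andP[q0 qT]] [->|ugq]; first exact: ltW.
rewrite leNgt; apply/negP => qs.
have := le_lt_trans (ndg _ _ q0 (ltW qs) (ltW sT)) gsu.
by rewrite ltNge ugq.
Unshelve. all: by end_near. Qed.

Lemma htime_reached g u : rc_path g -> u <= g T -> u <= g (htime g u).
Proof.
move=> rg ugT; have := htime_leT g u; rewrite le_eqVlt => /predU1P[->//|hT].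
by rewrite -htime_le// htime_ge0.
Qed.

Lemma lt_htime g u q : rc_path g -> 0 <= q -> q < htime g u -> g q < u.
Proof.
move=> rg q0 qh; rewrite ltNge -htime_le -?ltNge// q0/=.
exact: lt_le_trans qh (htime_leT _ _).
Qed.

Lemma htime_le_level g u t : rc_path g -> 0 <= t <= T -> u <= g T ->
  (htime g u <= t) = (u <= g t).
Proof.
move=> rg /andP[t0]; rewrite le_eqVlt => /predU1P[->|tT] ugT.
  by rewrite htime_leT ugT.
by rewrite htime_le// t0.
Qed.

(** By [htime_le], for [x] in [[0, T[] the hitting time is at most [x] exactly when [u <= X x], a
    jointly measurable condition on level and sample point. *)
Lemma measurable_htime {d} {Omega : measurableType d} (X : R -> Omega -> R) :
  (forall w, rc_path (X ^~ w)) ->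
  (forall t, 0 <= t <= T -> measurable_fun setT (X t)) ->
  measurable_fun setT (fun p : R * Omega => htime (X ^~ p.2) p.1).
Proof.
move=> rX mX; apply: (measurability (@RGenOInfty.G R)).
  exact: RGenOInfty.measurableE.
move=> _ [_ [x ->] <-]; rewrite setTI.
rewrite (_ : _ @^-1` _ = ~` [set p : R * Omega | htime (X ^~ p.2) p.1 <= x]);
  last first.
  by apply/seteqP; split => p /=; rewrite in_itv/= andbT ltNge => /negP.
apply: measurableC.
have [x0|x0] := ltP x 0.
  rewrite (_ : mkset _ = set0)//; apply/seteqP; split => p //=.
  by move=> /(le_trans (htime_ge0 _ _)); rewrite leNgt x0.
have [xT|Tx] := ltP x T; last first.
  rewrite (_ : mkset _ = setT)//; apply/seteqP; split => p //= _.
  exact: le_trans (htime_leT _ _) Tx.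
rewrite (_ : mkset _ = [set p : R * Omega | p.1 <= X x p.2]); last first.
  by apply/seteqP; split => p /=; rewrite htime_le// x0.
by apply: measurable_set_le => //; apply: measurableT_comp => //;
  apply: mX; rewrite x0 ltW.
Qed.

End HittingTime.

(** * Stieltjes measures of extended paths *)

Section StieltjesMeasure.
Context {R : realType}.
Implicit Types (F g c : R -> R) (T : R).

(** Values on half-open intervals determine the measure. This serves to recognise push-forwards and
    sums as Stieltjes measures. *)
Lemma stieltjes_unique F (nu : {measure set (measurableTypeR R) -> \bar R}) :
  nondecreasing F -> right_continuous F ->
  (forall a b, a <= b -> nu `]a, b]%classic = (F b - F a)%:E) ->
  forall A, measurable A -> stieltjes F A = nu A.
Proof.
move=> ndF rF nuE A mA; rewrite /stieltjes.
case: pselect => [H|]; last by case.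
apply: lebesgue_stieltjes_measure_unique => // _ [[a b] /= _ <-].
have [ab|ba] := leP a b; last first.
  by rewrite set_itv_ge ?measure0//= bnd_simp -leNgt ltW.
rewrite nuE//=.
move: ab; rewrite le_eqVlt => /predU1P[->|ab].
  by rewrite set_itvoc0 measure0 subrr.
rewrite /lebesgue_stieltjes_measure /measure_extension measurable_mu_extE//=.
  by rewrite wlength_itv_bnd// ltW.
exact: is_ocitv.
Qed.

Lemma extend_path_cumulative T y0 g : 0 <= T -> y0 <= g 0 -> rc_path T g ->
  nondecreasing (extend_path T y0 g) /\ right_continuous (extend_path T y0 g).
Proof.
move=> T0 y0g [ndg rg].
have minT s : 0 <= s -> 0 <= Num.min s T <= T.
  by move=> s0; rewrite le_min s0 T0 ge_min lexx orbT.
split=> [s t st|x]; rewrite /extend_path.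
  have [s0|s0] := ltP s 0; have [t0|t0] := ltP t 0 => //.
  - rewrite (le_trans y0g)//; have /andP[? ?] := minT t t0.
    exact: ndg.
  - by have := lt_le_trans t0 (le_trans s0 st); rewrite ltxx.
  - have /andP[? ?] := minT s s0; have /andP[? ?] := minT t t0.
    by apply: ndg => //; rewrite le_min !ge_min st lexx orbT.
have [x0|x0] := ltP x 0.
  apply: cvg_near_cst; near=> s.
  have s0 : s < 0 by near: s; exact: nbhs_right_lt.
  by rewrite s0.
have [xT|Tx] := ltP x T; last first.
  apply: cvg_near_cst; near=> s.
  have xs : x < s by near: s; exact: nbhs_right_gt.
  by rewrite ltNge (le_trans x0 (ltW xs))/= min_r// (le_trans Tx)// ltW.
apply: cvg_trans (rg x _); last by rewrite x0.
apply: near_eq_cvg; near=> s.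
have xs : x < s by near: s; exact: nbhs_right_gt.
have sT : s < T by near: s; exact: nbhs_right_lt.
by rewrite ltNge (le_trans x0 (ltW xs))/= min_l// ltW.
Unshelve. all: by end_near. Qed.

End StieltjesMeasure.

(** * Stieltjes measures as images under hitting times *)

Section TimeChange.
Context {R : realType}.
Variables (T : R) (g : R -> R) (a0 : R) (k : R -> R) (K : R) (c : R -> R).
Hypotheses (T0 : 0 <= T) (rg : rc_path T g) (a0g : a0 <= g 0).
Hypotheses (k0 : forall x, 0 <= k x) (kK : forall x, k x <= K)
  (mk : measurable_fun setT k).
Local Notation tau := (htime T g).
Local Notation mu := (@lebesgue_measure R).

Lemma measurable_htime_path : measurable_fun setT tau.
Proof.
have m : measurable_fun setT (fun u : R => (u, u)) by exact: measurable_fun_pair.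
have := @measurable_htime _ _ T0 _ R (fun t _ => g t) (fun=> rg)
  (fun t _ => measurable_cst (g t)).
by move=> /measurableT_comp /(_ m).
Qed.

Let mktau D : measurable_fun D (fun u => (k (tau u))%:E).
Proof.
apply/measurable_EFinP; apply: measurable_funTS.
exact: measurableT_comp measurable_htime_path.
Qed.

Let ge := extend_path T a0 g.

Let a0_ge z : a0 <= ge z.
Proof.
rewrite /ge /extend_path; case: ltP => // z0; rewrite (le_trans a0g)//.
by case: rg => ndg _; apply: ndg; rewrite ?le_min ?z0 ?T0 ?ge_min ?lexx ?orbT.
Qed.

Let ge_gT z : ge z <= g T.
Proof.
case: rg => ndg _; rewrite /ge /extend_path; case: ltP => z0.
  by rewrite (le_trans a0g)// ndg.
by apply: ndg; rewrite ?le_min ?z0 ?T0 ?ge_min ?lexx ?orbT.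
Qed.

Let htime_le_ge u z : a0 < u <= g T -> (tau u <= z) = (u <= ge z).
Proof.
move=> /andP[a0u ugT]; rewrite /ge /extend_path; case: ltP => z0.
  by rewrite !leNgt a0u (lt_le_trans z0)// htime_ge0.
have [zT|Tz] := ltP z T; first by rewrite htime_le ?z0.
by rewrite ugT (le_trans (htime_leT _ _ _)).
Qed.

Hypothesis cE : forall t : R, 0 <= t <= T ->
  (c t)%:E = (\int[mu]_(u in `]a0, g t]) (k (tau u))%:E)%E.

Let cB (s t : R) : 0 <= s -> s <= t -> t <= T ->
  (c t - c s)%:E = (\int[mu]_(u in `]g s, g t]) (k (tau u))%:E)%E.
Proof.
move=> s0 st tT; have t0 := le_trans s0 st; have sT := le_trans st tT.
have [ndg _] := rg.
rewrite EFinB !cE ?t0 ?s0//.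
have a0gs : a0 <= g s by rewrite (le_trans a0g)// ndg.
rewrite (@itv_bndbnd_setU _ _ (BRight a0) (BRight (g s)) (BRight (g t))) ?bnd_simp//;
  last exact: ndg.
rewrite ge0_integral_setU//=; last 3 first.
- exact: mktau.
- by move=> x _; rewrite lee_fin.
- apply/disj_setPS => x [] /=; rewrite !in_itv/= => /andP[_ xs] /andP[sx _].
  by move: (lt_le_trans sx xs); rewrite ltxx.
by rewrite addeAC subee ?add0e// -cE ?s0.
Qed.

(** The increments of [c] are nonnegative and at most [K] times those of [g], so that right
    continuity passes from [g] to [c]. *)
Lemma time_change_rc_path : rc_path T c.
Proof.
have [ndg rcg] := rg.
have cBge0 (s t : R) : 0 <= s -> s <= t -> t <= T -> 0 <= c t - c s.
  move=> s0 st tT; rewrite -lee_fin cB//; apply: integral_ge0 => x _.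
  by rewrite lee_fin.
have cBle (s t : R) : 0 <= s -> s <= t -> t <= T -> c t - c s <= K * (g t - g s).
  move=> s0 st tT; rewrite -lee_fin cB//.
  apply: (@le_trans _ _ (\int[mu]_(u in `]g s, g t]) (cst K%:E u))%E).
    apply: ge0_le_integral => //=.
    - by move=> x _; rewrite lee_fin.
    - exact: mktau.
    - by move=> x _; rewrite lee_fin.
  rewrite integral_cst//= lebesgue_measure_itv/= lte_fin.
  case: ifPn => // _; rewrite mule0 lee_fin mulr_ge0 ?subr_ge0 ?ndg//.
  exact: le_trans (k0 0) (kK 0).
split=> [s t s0 st tT|t /andP[t0 tT]]; first by rewrite -subr_ge0 cBge0.
apply/cvgrPdist_le => e e0.
(* [K] may be 0, so the tolerance is divided by [K + 1]. *)
have KS : 0 < K + 1 by rewrite (le_lt_trans (le_trans (k0 0) (kK 0)))// ltrDl.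
have /cvgrPdist_le/(_ (e / (K + 1))) : g @ t^'+ --> g t by apply: rcg; rewrite t0.
rewrite divr_gt0// => /(_ isT) gnear.
near=> s.
have ts : t <= s by apply: ltW; near: s; exact: nbhs_right_gt.
have sT : s <= T by apply: ltW; near: s; exact: nbhs_right_lt.
rewrite distrC ger0_norm ?cBge0// (le_trans (cBle _ _ _ _ _))//.
have : `|g t - g s| <= e / (K + 1) by near: s.
rewrite distrC ger0_norm ?subr_ge0 ?ndg// ler_pdivlMr// mulrC.
by apply: le_trans; rewrite ler_wpM2r ?lerDl// subr_ge0 ndg.
Unshelve. all: by end_near. Qed.

Lemma time_change_ge0 t : 0 <= t <= T -> 0 <= c t.
Proof.
move=> tT; rewrite -lee_fin cE//; apply: integral_ge0 => x _.
by rewrite lee_fin.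
Qed.

Let FB (x y : R) : x <= y -> (extend_path T 0 c y - extend_path T 0 c x)%:E =
  (\int[mu]_(u in `]ge x, ge y]) (k (tau u))%:E)%E.
Proof.
move=> xy; rewrite /ge /extend_path.
have minT s : 0 <= s -> 0 <= Num.min s T <= T.
  by move=> s0; rewrite le_min s0 T0 ge_min lexx orbT.
have [x0|x0] := ltP x 0; have [y0|y0] := ltP y 0.
- by rewrite subrr set_itvoc0 integral_set0.
- by rewrite subr0 cE ?minT.
- by have := lt_le_trans y0 (le_trans x0 xy); rewrite ltxx.
- have /andP[? ?] := minT x x0; have /andP[? ?] := minT y y0.
  by rewrite cB// le_min !ge_min xy lexx orbT.
Qed.

(** For levels in []a0, g T]], [x < tau u <= y] amounts to [ge x < u <= ge y]. Hence the
    push-forward of [k (tau u) du] gives []x, y]] the increment of [c], and by uniqueness it is the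
    Stieltjes measure of [c]. *)
Lemma integral_stieltjes_htime (D : set R) (h : R -> \bar R) : measurable D ->
  measurable_fun D h -> (forall s, D s -> 0 <= h s)%E ->
  (\int[stieltjes (extend_path T 0 c)]_(s in D) h s =
   \int[mu]_(u in `]a0, g T] `&` tau @^-1` D) (h (tau u) * (k (tau u))%:E))%E.
Proof.
move=> mD mh h0.
(* The indicator discards the levels at most [a0] and those never reached, which [tau] sends to
   [T]. *)
pose r u := k (tau u) * \1_(`]a0, g T]%classic : set R) u.
have r0 u : 0 <= r u by rewrite mulr_ge0.
have mr : measurable_fun setT r.
  apply: measurable_funM; last exact: measurable_indic.
  exact: measurableT_comp measurable_htime_path.
have mtau := measurable_htime_path.
have crc := time_change_rc_path.
have c00 : 0 <= c 0 by apply: time_change_ge0; rewrite lexx.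
have [ndF rF] := extend_path_cumulative T0 c00 crc.
pose nu0 : {measure set (measurableTypeR R) -> \bar R} :=
  pushforward (mdens mu r0 mr) (tau : R -> measurableTypeR R).
pose nu := nu0 mtau.
rewrite (@eq_measure_integral _ _ _ _ nu); last first.
  move=> A mA _; apply: stieltjes_unique => // x y xy.
  rewrite /nu /nu0 /= /pushforward /mdens.
  rewrite FB// integral_mkcond [RHS]integral_mkcond.
  apply: eq_integral => u _; rewrite /patch /r indicE.
  have [uJ|uJ] := boolP (u \in `]a0, g T]%classic); last first.
    rewrite mulr0 if_same; case: ifPn => // /[!inE]/=; rewrite in_itv/= => uxy.
    exfalso; move: uJ; rewrite notin_setE/= in_itv/=; apply.
    case/andP: uxy => xu uy; rewrite (le_lt_trans _ xu) ?a0_ge//=.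
    exact: le_trans uy (ge_gT _).
  move: uJ; rewrite inE/= in_itv/= => uJ.
  rewrite mulr1; congr (if _ then _ else _).
  have E : (x < tau u <= y) = (ge x < u <= ge y).
    by rewrite !ltNge !(htime_le_ge _ uJ).
  by apply/idP/idP; rewrite !inE/= !in_itv/= E.
rewrite ge0_integral_pushforward//; last first.
  by move=> y /[!inE]; exact: h0.
have mtauD : measurable (tau @^-1` D) by rewrite -[_ @^-1` _]setTI; exact: measurable_htime_path.
rewrite ge0_integral_mdens//; last first.
- by move=> u /=; exact: h0.
- apply: (measurable_comp mD) => //; first by move=> _ [u ? <-].
  exact: measurable_funTS measurable_htime_path.
rewrite integral_mkcond [RHS]integral_mkcond; apply: eq_integral => u _.
rewrite /patch/= in_setI /r indicE; case: (u \in `]a0, g T]%classic) => /=.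
  by rewrite mulr1.
by rewrite mulr0 mule0 if_same.
Qed.

End TimeChange.

Section SequenceLimits.
Context {R : realType}.
Implicit Types (v : nat -> R) (l b : R).

Lemma cvg_seq_ge v l b : v @ \oo --> l -> (forall n, b <= v n) -> b <= l.
Proof. by move=> vl bv; apply: (cvgr_to_ge vl); exact: nearW. Qed.

Lemma cvg_seq_le v l b : v @ \oo --> l -> (forall n, v n <= b) -> l <= b.
Proof. by move=> vl bv; apply: (cvgr_to_le vl); exact: nearW. Qed.

Lemma cvg_seqMr v l b : v @ \oo --> l -> (fun n => v n * b) @ \oo --> l * b.
Proof. by move=> vl; apply: cvgM => //; exact: cvg_cst. Qed.

End SequenceLimits.

(** * Gradient of the aggregator *)

Section ConcaveAggregator.
Context {R : realType}.
Variables (T : R) (f : R -> R -> R -> R).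
Hypotheses (A1 : condA1 T f).
Implicit Types (s y u : R).

(** The shift by 2 keeps the steps strictly between 0 and 1, as the weights in strict concavity
    require. *)
Let step (n : nat) : R := n.+2%:R^-1.

Let step_itv n : 0 < step n < 1.
Proof. by rewrite invr_gt0 ltr0n/= invf_lt1// ltr1n. Qed.

Let step_cvg c : (fun n => step n * c) @ \oo --> (0 : R).
Proof.
rewrite -[X in _ --> X](mul0r c); apply: cvg_seqMr.
by rewrite (cvg_shiftS (@harmonic R)); exact: cvg_harmonic.
Qed.

Lemma quotient_y_seq s y u (h : nat -> R) : 0 <= s <= T -> 0 <= y ->
  h @ \oo --> (0 : R) -> (forall n, h n != 0) -> (forall n, 0 <= y + h n) ->
  (fun n => quotient_y f s y u (h n)) @ \oo --> d_y f s y u.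
Proof.
move=> sT y0 h0 hn0 yh.
have [_ [/(_ y u y0) cq _ _ _] _] := A1 sT.
apply: (cvg_trans _ cq) => B /= wB.
change (\forall n \near \oo, B (quotient_y f s y u (h n))).
have H : \forall n \near \oo, h n != 0 -> 0 <= y + h n ->
  B (quotient_y f s y u (h n)) := h0 _ wB.
by apply: filterS H => n; apply; [exact: hn0|exact: yh].
Qed.

Lemma quotient_u_seq s y u (h : nat -> R) : 0 <= s <= T -> 0 <= y ->
  h @ \oo --> (0 : R) -> (forall n, h n != 0) ->
  (fun n => (f s y (u + h n) - f s y u) / h n) @ \oo --> d_u f s y u.
Proof.
move=> sT y0 h0 hn0.
have [_ [_ /(_ y u y0) du _ _] _] := A1 sT.
rewrite /d_u derive1E.
apply: (cvg_trans _ (du : _ --> 'D_1 (f s y) u)).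
have E : (fun n => (f s y (u + h n) - f s y u) / h n) =
   (fun n => (h n)^-1 *: ((f s y \o shift u) (h n *: 1) - f s y u)).
  apply/funext => n /=; have -> : (h n)%:A = h n by exact: mulr1.
  by rewrite [RHS]mulrC (addrC u).
rewrite E => B /= wB.
change (\forall n \near \oo,
  B ((h n)^-1 *: ((f s y \o shift u) (h n *: 1) - f s y u))).
 have H : \forall n \near \oo, h n != 0 ->
  B ((h n)^-1 *: ((f s y \o shift u) (h n *: 1) - f s y u)) := h0 _ wB.
by apply: filterS H => n; apply; exact: hn0.
Qed.

Let d_u_seq s y u (v : nat -> R) : 0 <= s <= T -> 0 <= y ->
  v @ \oo --> y -> (forall n, 0 <= v n) ->
  (fun n => d_u f s (v n) u) @ \oo --> d_u f s y u.
Proof.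
move=> sT y0 vy v0.
have [_ [_ _ _ /subspace_continuousP cd] _] := A1 sT.
apply: (cvg_trans _ (cd (y, u) y0)).
have cvu : (fun n => (v n, u)) @ \oo --> (y, u).
  by apply: (@cvg_pair _ _ _ _ (nbhs y) (nbhs u)) => //; exact: cvg_cst.
move=> B /= wB; change (\forall n \near \oo, B (d_u f s (v n) u)).
have H : \forall n \near \oo, 0 <= v n -> B (d_u f s (v n) u) := cvu _ wB.
by apply: filterS H => n; apply; exact: v0.
Qed.

Let concave_u s y u u' : 0 <= s <= T -> 0 <= y ->
  f s y u' - f s y u <= d_u f s y u * (u' - u).
Proof.
move=> sT y0; have [->|uu'] := eqVneq u' u; first by rewrite !subrr mulr0.
have [sc _ _] := A1 sT.
have h0 : u' - u != 0 by rewrite subr_eq0.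
have := @quotient_u_seq s y u (fun n => step n * (u' - u)) sT y0 (step_cvg _).
have hn n : step n * (u' - u) != 0.
  by rewrite mulf_neq0// gt_eqF//; have /andP[] := step_itv n.
move=> /(_ hn) /(@cvg_seqMr _ _ _ (u' - u)); move/cvg_seq_ge; apply => n /=.
have /andP[s0 s1] := step_itv n.
have yu : (y, u') <> (y, u) by move=> [/eqP]; rewrite (negbTE uu').
have := sc y u' y u (step n) y0 y0 yu; rewrite s0 s1 => /(_ isT).
have -> : step n * y + (1 - step n) * y = y by ring.
have -> : step n * u' + (1 - step n) * u = u + step n * (u' - u) by ring.
move=> /ltW le; rewrite -mulrA invfM mulrAC -mulrA mulfV// mulr1 mulrC -ler_pdivrMl ?invrK//.
  lra.
Qed.

(** Only partial derivatives are given, one-sided at [y = 0]. The increment along the segment is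
    therefore split: [y] moves at fixed [u], then [u] moves at the displaced point [v n], where the
    tangent inequality in [u] applies. Continuity of [d_u f] in [y] gives the limit. *)
Lemma gradient_ineq s y u y' u' : 0 <= s <= T -> 0 <= y -> 0 <= y' ->
  f s y' u' - f s y u <= d_y f s y u * (y' - y) + d_u f s y u * (u' - u).
Proof.
move=> sT y0 y'0.
have [E|yu] := eqVneq (y', u') (y, u).
  by case: E => -> ->; rewrite !subrr !mulr0 addr0.
have [sc _ _] := A1 sT.
pose v n := y + step n * (y' - y).
have vE n : v n = step n * y' + (1 - step n) * y by rewrite /v; ring.
have v0 n : 0 <= v n.
  have /andP[s0 s1] := step_itv n.
  by rewrite vE addr_ge0// mulr_ge0// ?subr_ge0 ltW.
have vy : v @ \oo --> y.
  by rewrite -[X in _ --> X]addr0; apply: cvgD => //; exact: cvg_cst.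
have cy : (fun n => (f s (v n) u - f s y u) / step n) @ \oo -->
    d_y f s y u * (y' - y).
  have [E|yy'] := eqVneq y' y.
    have vn n : v n = y by rewrite /v E subrr mulr0 addr0.
    rewrite E subrr mulr0; under eq_fun do rewrite vn subrr mul0r.
    exact: cvg_cst.
  have h0 : y' - y != 0 by rewrite subr_eq0.
  have hn n : step n * (y' - y) != 0.
    by rewrite mulf_neq0// gt_eqF//; have /andP[] := step_itv n.
  have := @quotient_y_seq s y u (fun n => step n * (y' - y)) sT y0 (step_cvg _) hn v0.
  move=> /(@cvg_seqMr _ _ _ (y' - y)); rewrite /quotient_y.
  under eq_fun do rewrite invfM mulrA mulfVK//.
  exact.
have cu := @cvg_seqMr _ _ _ (u' - u) (@d_u_seq s y u v sT y0 vy v0).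
have cyu : (fun n => (f s (v n) u - f s y u) / step n + d_u f s (v n) u * (u' - u))
    @ \oo --> d_y f s y u * (y' - y) + d_u f s y u * (u' - u) by exact: cvgD.
apply: (cvg_seq_ge cyu) => n /=.
have /andP[s0 s1] := step_itv n.
have yu' : (y', u') <> (y, u) by move/eqP; rewrite (negbTE yu).
have := sc y' u' y u (step n) y'0 y0 yu'; rewrite s0 s1 => /(_ isT).
rewrite -vE.
have -> : step n * u' + (1 - step n) * u = u + step n * (u' - u) by ring.
move=> /ltW le.
have := @concave_u s (v n) u (u + step n * (u' - u)) sT (v0 n).
rewrite (addrC u) addrK -addrC => le2.
rewrite -(ler_pM2l s0) [leRHS]mulrDr [X in _ <= X + _]mulrC divfK ?gt_eqF//.
lra.
Qed.

Lemma d_y_ge0 s y u : 0 <= s <= T -> 0 <= y -> 0 <= d_y f s y u.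
Proof.
move=> sT y0; have [_ _ inc] := A1 sT.
have hn n : step n * 1 != 0 :> R by rewrite mulr1 gt_eqF//; have /andP[] := step_itv n.
have h0 n : 0 < step n * 1 by rewrite mulr1; have /andP[] := step_itv n.
have := @quotient_y_seq s y u (fun n => step n * 1) sT y0 (step_cvg _) hn.
have H (n : nat) : 0 <= y + step n * 1 by rewrite addr_ge0// ltW.
move=> /(_ H); move/cvg_seq_ge; apply => n.
by rewrite /quotient_y divr_ge0 ?(ltW (h0 n))// subr_ge0 ltW// inc// ltrDl h0.
Qed.

(** The gradient inequalities from [y] to [y'] and back add up to a sign for (d_y f(y) - d_y f(y'))
    (y' - y). *)
Lemma d_y_decr s y y' u : 0 <= s <= T -> 0 <= y -> y <= y' ->
  d_y f s y' u <= d_y f s y u.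
Proof.
move=> sT y0; rewrite le_eqVlt => /predU1P[->//|yy'].
have y'0 : 0 <= y' by rewrite (le_trans y0)// ltW.
have := @gradient_ineq s y u y' u sT y0 y'0; have := @gradient_ineq s y' u y u sT y'0 y0.
rewrite !subrr !mulr0 !addr0 => h1 h2.
rewrite -(ler_pM2r (_ : 0 < y' - y)) ?subr_gt0//; lra.
Qed.

Lemma d_u_bound s y u K : 0 <= s <= T -> 0 <= y ->
  (forall u u', `|f s y u - f s y u'| <= K * `|u - u'|) -> `|d_u f s y u| <= K.
Proof.
move=> sT y0 lip.
have hn n : step n * 1 != 0 :> R by rewrite mulr1 gt_eqF//; have /andP[] := step_itv n.
have h0 n : 0 < step n * 1 by rewrite mulr1; have /andP[] := step_itv n.
have := @quotient_u_seq s y u (fun n => step n * 1) sT y0 (step_cvg _) hn.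
move/cvg_norm; move/cvg_seq_le; apply => n /=.
rewrite normrM normfV (gtr0_norm (h0 n)) ler_pdivrMr//.
by rewrite (le_trans (lip _ _))// addrC addKr gtr0_norm.
Qed.

Section Measurability.
Context {d} {Omega : measurableType d}.
Variables (S Y U : Omega -> R).
Hypotheses (mS : measurable_fun setT S) (mY : measurable_fun setT Y)
  (mU : measurable_fun setT U) (ST : forall w, 0 <= S w <= T)
  (Y0 : forall w, 0 <= Y w) (fB : borel_aggregator T f).

Lemma measurable_aggregator : measurable_fun setT (fun w => f (S w) (Y w) (U w)).
Proof.
pose D : set (R * R * R) := [set p | 0 <= p.1.1 <= T /\ 0 <= p.1.2].
have mD : measurable D.
  rewrite (_ : D = ([set p | 0 <= p.1.1] `&` [set p | p.1.1 <= T]) `&`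
     [set p | 0 <= p.1.2]).
    have m1 : measurable_fun setT (fun p : R * R * R => p.1.1) by exact: measurableT_comp.
    have m2 : measurable_fun setT (fun p : R * R * R => p.1.2) by exact: measurableT_comp.
    by apply: measurableI; [apply: measurableI|]; exact: measurable_set_le.
  apply/seteqP; split => p /=; first by move=> [/andP[]].
  by move=> [[? ?] ?]; split => //; apply/andP.
have mp : measurable_fun setT (fun w => ((S w, Y w), U w)).
  by apply: measurable_fun_pair => //; exact: measurable_fun_pair.
have := @measurable_comp _ _ _ _ _ _ D _ setT _ mD _ fB mp.
by apply; move=> _ [w _ <-]; split => /=.
Qed.

End Measurability.

Section MeasurabilityDerivatives.
Context {d} {Omega : measurableType d}.
Variables (S Y U : Omega -> R).
Hypotheses (mS : measurable_fun setT S) (mY : measurable_fun setT Y)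
  (mU : measurable_fun setT U) (ST : forall w, 0 <= S w <= T)
  (Y0 : forall w, 0 <= Y w) (fB : borel_aggregator T f).

(** The derivative is a limit of difference quotients along one fixed sequence of positive steps,
    and each quotient is Borel. *)
Lemma measurable_d_y : measurable_fun setT (fun w => d_y f (S w) (Y w) (U w)).
Proof.
have hn n : step n * 1 != 0 :> R by rewrite mulr1 gt_eqF//; have /andP[] := step_itv n.
have h0 n : 0 < step n * 1 by rewrite mulr1; have /andP[] := step_itv n.
have H w n : 0 <= Y w + step n * 1 by rewrite addr_ge0// ltW.
apply: (@measurable_fun_cvg _ _ _ _
  (fun n w => quotient_y f (S w) (Y w) (U w) (step n * 1))).
- move=> n; apply: measurable_funM => //; apply: measurable_funB.
    apply: measurable_aggregator => //; exact: measurable_funD.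
  exact: measurable_aggregator.
- by move=> w _; apply: quotient_y_seq => //; exact: step_cvg.
Qed.

Lemma measurable_d_u : measurable_fun setT (fun w => d_u f (S w) (Y w) (U w)).
Proof.
have hn n : step n * 1 != 0 :> R by rewrite mulr1 gt_eqF//; have /andP[] := step_itv n.
apply: (@measurable_fun_cvg _ _ _ _
  (fun n w => (f (S w) (Y w) (U w + step n * 1) - f (S w) (Y w) (U w)) / (step n * 1))).
- move=> n; apply: measurable_funM => //; apply: measurable_funB.
    apply: measurable_aggregator => //; exact: measurable_funD.
  exact: measurable_aggregator.
- by move=> w _; apply: quotient_u_seq => //; exact: step_cvg.
Qed.

End MeasurabilityDerivatives.

End ConcaveAggregator.

(** * Primitives of bounded measurable functions and their exponentials *)

Section BoundedIntegrand.
Local Notation mu := lebesgue_measure.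

Lemma bounded_integrable {d} {S : measurableType d} {R : realType}
    (m : {measure set S -> \bar R}) D (g : S -> R) (K : R) :
  measurable D -> (m D < +oo)%E -> measurable_fun D g ->
  (forall x, D x -> `|g x| <= K) -> m.-integrable D (EFin \o g).
Proof.
move=> mD mDoo mg gK; apply: measurable_bounded_integrable => //.
exists K; split; first exact: num_real.
by move=> M KM x Dx; rewrite /= (le_trans (gK _ Dx))// ltW.
Qed.

Context {R : realType}.
Variables (a : R -> R) (K : R).
Hypotheses (ma : measurable_fun setT a) (aK : forall x, `|a x| <= K).

Let K0 : 0 <= K. Proof. exact: le_trans (aK 0). Qed.

Lemma lebesgue_itv_fin (x y : R) b1 b2 :
  (mu [set` Interval (BSide b1 x) (BSide b2 y)] < +oo)%E.
Proof. by rewrite lebesgue_measure_itv/=; case: ifP => //; rewrite -EFinB ltry. Qed.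

Lemma bounded_integrable_itv (x y : R) b1 b2 :
  mu.-integrable [set` Interval (BSide b1 x) (BSide b2 y)] (EFin \o a).
Proof.
apply: (@bounded_integrable _ _ _ _ _ _ K) => //.
- exact: lebesgue_itv_fin.
- exact: measurable_funTS.
Qed.

Lemma Rintegral_sub_itv s t : 0 <= s -> s <= t ->
  \int[mu]_(x in `[0, t]) a x - \int[mu]_(x in `[0, s]) a x =
  \int[mu]_(x in `]s, t]) a x.
Proof.
move=> s0 st; apply: Rintegral_itvB; rewrite ?bnd_simp//.
exact: bounded_integrable_itv.
Qed.

Lemma Rintegral_itv_bound s t : s <= t ->
  `|\int[mu]_(x in `]s, t]) a x| <= K * (t - s).
Proof.
move=> st; rewrite (le_trans (le_normr_Rintegral _ (bounded_integrable_itv _ _ _ _)))//.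
have -> : K * (t - s) = \int[mu]_(x in `]s, t]) K.
  rewrite Rintegral_cst//= lebesgue_measure_itv/= lte_fin.
  move: st; rewrite le_eqVlt => /predU1P[->|st]; first by rewrite ltxx/= subrr.
  by rewrite st -EFinB.
apply: le_Rintegral => //=.
- apply: (@bounded_integrable _ _ _ _ _ _ K) => //.
  + exact: lebesgue_itv_fin.
  + by apply: measurable_funTS; exact: measurableT_comp.
  + by move=> x _; rewrite normr_id.
- apply: (@bounded_integrable _ _ _ _ _ _ K) => //.
  + exact: lebesgue_itv_fin.
  + by move=> x _; rewrite ger0_norm.
Qed.

Local Notation A t := (\int[mu]_(x in `[0, t]) a x).

Lemma Rintegral_lipschitz s t : 0 <= s -> s <= t -> `|A t - A s| <= K * (t - s).
Proof. by move=> s0 st; rewrite Rintegral_sub_itv// Rintegral_itv_bound. Qed.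

Lemma Rintegral_bound T t : 0 <= t <= T -> `|A t| <= K * T.
Proof.
move=> /andP[t0 tT]; have := Rintegral_lipschitz (lexx 0) t0.
rewrite set_itv1 Rintegral_set1 !subr0 => /le_trans; apply.
by rewrite ler_wpM2l.
Qed.

Lemma continuous_primitive T : 0 <= T -> continuous (fun t => A (clamp T t)).
Proof.
move=> T0 x.
apply/cvgrPdist_le => e e0.
have KS : 0 < K + 1 by rewrite ltr_wpDl.
near=> t.
have lip s r : `|A (clamp T s) - A (clamp T r)| <= K * `|s - r|.
  wlog sr : s r / s <= r.
    move=> H; have [/H//|/ltW/H] := leP s r.
    by rewrite distrC (distrC r).
  have /andP[s0 sT] := clamp_itv s T0; have /andP[r0 rT] := clamp_itv r T0.
  have csr : clamp T s <= clamp T r.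
    by rewrite /clamp ge_max le_max lexx/= le_max le_min !ge_min lexx sr orbT !orbT.
  rewrite distrC (le_trans (Rintegral_lipschitz s0 csr))// ler_wpM2l//.
  rewrite distrC ger0_norm ?subr_ge0//.
  move: csr s0 sT r0 rT; rewrite /clamp /Num.max /Num.min.
  by do ![case: ifPn]; rewrite -?leNgt => *; lra.
rewrite (le_trans (lip _ _))//.
have : `|x - t| <= e / (K + 1).
  near: t; apply: cvgr_dist_le; first exact: cvg_id.
  by rewrite divr_gt0.
rewrite ler_pdivlMr// mulrC; apply: le_trans.
by rewrite ler_wpM2r// lerDl.
Unshelve. all: by end_near. Qed.

Lemma measurable_primitive T : 0 <= T -> measurable_fun setT (fun t => A (clamp T t)).
Proof. by move=> T0; apply: continuous_measurable_fun; exact: continuous_primitive. Qed.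

End BoundedIntegrand.

Lemma clamp_continuous_rc {R : realType} (T : R) (h : R -> R) :
  continuous (fun t => h (clamp T t)) ->
  forall t, 0 <= t < T -> h @ t^'+ --> h t.
Proof.
move=> ch t /andP[t0 tT].
have tE : clamp T t = t by rewrite clamp_id// t0 ltW.
rewrite -[in X in _ --> X]tE.
apply: (cvg_trans _ (cvg_at_right_filter (ch t))).
apply: near_eq_cvg; near=> s.
have ts : t < s by near: s; exact: nbhs_right_gt.
have sT : s < T by near: s; exact: nbhs_right_lt.
by rewrite clamp_id// (le_trans t0 (ltW ts)) ltW.
Unshelve. all: by end_near. Qed.

Section ExpPrimitive.
Context {R : realType}.
Local Notation mu := lebesgue_measure.
Variables (a : R -> R) (K T : R).
Hypotheses (T0 : 0 <= T) (ma : measurable_fun setT a)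
  (aK : forall x, `|a x| <= K).
Local Notation A t := (\int[mu]_(x in `[0, t]) a x).

Lemma expR_sub_bounds (x y : R) :
  expR x * (y - x) <= expR y - expR x <= expR y * (y - x).
Proof.
have H (u v : R) : expR u * (v - u) <= expR v - expR u.
  have -> : expR v = expR u * expR (v - u) by rewrite -expRD addrC subrK.
  have := expR_ge1Dx (v - u).
  rewrite -{3}(mulr1 (expR u)) -mulrBr ler_pM2l ?expR_gt0// lerBrDl.
  by [].
rewrite H/=; have := H y x; rewrite -lerN2 -mulrN !opprB.
by [].
Qed.

(** Over a partition of [[0, t]] into [n + 1] equal pieces, the quadratic bounds add up to a
    multiple of 1 / (n + 1). This stands in for differentiation. *)
Lemma constant_of_quadratic (h : R -> R) (c : R) :
  (forall s t, 0 <= s -> s <= t -> t <= T -> `|h t - h s| <= c * (t - s) ^+ 2) ->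
  forall t, 0 <= t <= T -> h t = h 0.
Proof.
move=> hc t /andP[t0 tT]; apply/eqP; rewrite -subr_eq0 -normr_eq0.
have c0 : 0 <= c * t ^+ 2 by rewrite -[t]subr0 (le_trans _ (hc 0 t _ _ _)).
have bound (n : nat) : `|h t - h 0| <= c * t ^+ 2 / n.+1%:R.
  pose u i : R := t * i%:R / n.+1%:R.
  have -> : h t - h 0 = \sum_(0 <= i < n.+1) (h (u i.+1) - h (u i)).
    by rewrite telescope_sumr// /u mulfK// mulr0 mul0r.
  rewrite (le_trans (ler_norm_sum _ _ _))//.
  have -> : c * t ^+ 2 / n.+1%:R = \sum_(0 <= i < n.+1) c * (t / n.+1%:R) ^+ 2.
    rewrite sumr_const_nat subn0 -mulr_natr; field.
    by rewrite nat1r pnatr_eq0.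
  rewrite !big_nat; apply: ler_sum => i /andP[_ i1].
  have -> : t / n.+1%:R = u i.+1 - u i.
    by rewrite /u -mulrBl -mulrBr -natrB// subSnn mulr1.
  apply: hc.
  - by rewrite /u divr_ge0// mulr_ge0.
  - by rewrite /u ler_wpM2r// ler_wpM2l// ler_nat.
  - by rewrite (le_trans _ tT)// /u ler_pdivrMr// ler_wpM2l// ler_nat.
rewrite eq_le normr_ge0 andbT; apply/ler_addgt0Pr => e e0; rewrite add0r.
pose n := Num.truncn (c * t ^+ 2 / e).
rewrite (le_trans (bound n))// ler_pdivrMr// [leRHS]mulrC -ler_pdivrMr// ltW//.
exact: truncnS_gt.
Qed.

(** Since [a] is merely bounded and measurable, [expR (A s)] need not be differentiable everywhere.
    The difference [h] of the two sides nevertheless has increments of second order, hence is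
    constant. *)
Lemma integral_exp_primitive t : 0 <= t <= T ->
  \int[mu]_(s in `[0, t]) (a s * expR (A s)) = expR (A t) - 1.
Proof.
move=> tT.
have K0 : 0 <= K := le_trans (normr_ge0 _) (aK 0).
pose E := expR (K * T).
have E0 : 0 <= E by exact: expR_ge0.
pose g s := a s * expR (A (clamp T s)).
have AK s : 0 <= s <= T -> A s <= K * T.
  by move=> sT; rewrite (le_trans (ler_norm _))// (Rintegral_bound ma aK sT).
have mg : measurable_fun setT g.
  apply: measurable_funM => //.
  exact: measurableT_comp (measurable_primitive ma aK T0).
have gK s : `|g s| <= K * E.
  rewrite normrM ler_pM// ger0_norm ?expR_ge0// ler_expR AK//.
  exact: clamp_itv.
have -> : \int[mu]_(s in `[0, t]) (a s * expR (A s)) = \int[mu]_(s in `[0, t]) g s.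
  apply: eq_Rintegral => s; rewrite inE/= in_itv/= => /andP[s0 st].
  by rewrite /g clamp_id// s0 (le_trans st)//; case/andP: tT.
pose h s := expR (A s) - \int[mu]_(r in `[0, s]) g r.
suff : h t = h 0.
  rewrite /h set_itv1 !Rintegral_set1 expR0 subr0 => /eqP.
  by rewrite subr_eq addrC -subr_eq => /eqP.
apply: (@constant_of_quadratic h (2 * (E * K ^+ 2))) => // {t tT} s t s0 st tT.
have As r : s <= r -> r <= t -> `|A r - A s| <= K * (t - s).
  move=> sr rt; rewrite (le_trans (Rintegral_lipschitz ma aK s0 sr))//.
  by rewrite ler_wpM2l// lerD2r.
have AKr r : s <= r -> r <= t -> expR (A r) <= E.
  by move=> sr rt; rewrite ler_expR AK// (le_trans s0 sr) (le_trans rt).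
have eAs r : s <= r -> r <= t -> `|expR (A r) - expR (A s)| <= E * (K * (t - s)).
  move=> sr rt; have Kts : 0 <= K * (t - s) by rewrite mulr_ge0// subr_ge0.
  have /andP[lo hi] := expR_sub_bounds (A s) (A r).
  have := As r sr rt; rewrite !ler_norml => /andP[l1 l2]; apply/andP; split.
    apply: le_trans lo; rewrite -mulrN.
    apply: (@le_trans _ _ (expR (A s) * - (K * (t - s)))).
      by rewrite !mulrN lerN2 ler_wpM2r// AKr.
    by rewrite ler_wpM2l ?expR_ge0.
  apply: (le_trans hi); apply: (@le_trans _ _ (expR (A r) * (K * (t - s)))).
    by rewrite ler_wpM2l ?expR_ge0.
  by rewrite ler_wpM2r// AKr.
pose D := A t - A s.
(* Both errors are of second order in [t - s]: in the first, the exponential is compared with its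
   tangent at [A s]; in the second, the factor [expR (A r)] is frozen at [r = s]. *)
have hE : h t - h s = (expR (A t) - expR (A s) - expR (A s) * D) -
    \int[mu]_(r in `]s, t]) (g r - expR (A s) * a r).
  rewrite RintegralB//; last 2 first.
  - exact: bounded_integrable_itv mg gK _ _ _ _.
  - apply: (@bounded_integrable _ _ _ _ _ _ (E * K)) => //.
    + exact: lebesgue_itv_fin.
    + by apply: measurable_funTS; exact: measurable_funM.
    + by move=> x _; rewrite normrM ler_pM// ger0_norm ?expR_ge0// AKr.
  rewrite RintegralZl//; last exact: bounded_integrable_itv ma aK _ _ _ _.
  have <- := Rintegral_sub_itv mg gK s0 st.
  have <- := Rintegral_sub_itv ma aK s0 st.
  rewrite /h /D; move: (expR (A t)) (expR (A s)) (A t) (A s) => x y z z'.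
  move: (\int[mu]_(r in `[0, t]) g r) (\int[mu]_(r in `[0, s]) g r) => p q; ring.
rewrite hE (le_trans (ler_normB _ _))//.
have -> : 2 * (E * K ^+ 2) * (t - s) ^+ 2 =
  E * (K * (t - s)) * (K * (t - s)) + E * (K * (t - s)) * K * (t - s) by ring.
have Kts : 0 <= K * (t - s) by rewrite mulr_ge0// subr_ge0.
apply: lerD.
  have /andP[lo hi] := expR_sub_bounds (A s) (A t).
  have D0 := As t st (lexx t); rewrite -/D in D0 lo hi.
  rewrite ger0_norm ?subr_ge0//.
  apply: (@le_trans _ _ ((expR (A t) - expR (A s)) * D)); first by rewrite mulrBl lerD2r.
  rewrite (le_trans (ler_norm _))// normrM ler_pM//.
  exact: eAs.
(* [Rintegral_itv_bound] asks for a bound on the whole line, hence the indicator. *)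
have mi : measurable_fun setT (fun r => (g r - expR (A s) * a r) * \1_(`]s, t]%classic) r).
  apply: measurable_funM; last exact: measurable_indic.
  by apply: measurable_funB => //; exact: measurable_funM.
have -> : \int[mu]_(r in `]s, t]) (g r - expR (A s) * a r) =
   \int[mu]_(r in `]s, t]) ((g r - expR (A s) * a r) * \1_(`]s, t]%classic) r).
  by apply: eq_Rintegral => r rst; rewrite indicE rst mulr1.
apply: (Rintegral_itv_bound mi) => // r.
rewrite indicE; have [|_] := boolP (r \in _); last first.
  by rewrite mulr0 normr0 !mulr_ge0// subr_ge0.
rewrite inE/= in_itv/= => /andP[sr rt]; rewrite mulr1.
have -> : g r - expR (A s) * a r = (expR (A r) - expR (A s)) * a r.
  have rT : 0 <= r <= T by rewrite (le_trans s0 (ltW sr)) (le_trans rt).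
  by rewrite /g (clamp_id rT) mulrBl mulrC.
by rewrite normrM ler_pM// eAs// ltW.
Qed.

End ExpPrimitive.

(** * Integrals against paths of bounded variation *)

Section IntegralMeasureSub.
Context {R : realType}.
Local Open Scope ereal_scope.

(** Moving the subtracted measures to the other side leaves an identity between sums of positive
    measures; integrating it and subtracting is licit since all four integrals are finite. *)
Lemma Rintegral_measure_sub
    (mp mn m1 m2 : {measure set (measurableTypeR R) -> \bar R})
    (D : set R) (h : R -> R) :
  measurable D -> measurable_fun D h -> (forall s, D s -> (0 <= h s)%R) ->
  \int[mp]_(s in D) (h s)%:E < +oo -> \int[mn]_(s in D) (h s)%:E < +oo ->
  \int[m1]_(s in D) (h s)%:E < +oo -> \int[m2]_(s in D) (h s)%:E < +oo ->
  (forall A, measurable A -> measure_add mp m2 A = measure_add mn m1 A) ->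
  (\int[mp]_(s in D) h s - \int[mn]_(s in D) h s =
   \int[m1]_(s in D) h s - \int[m2]_(s in D) h s)%R.
Proof.
move=> mD mh h0 Pfin Nfin fin1 fin2 mE.
have hE0 (x : R) : D x -> 0 <= (h x)%:E by move=> Dx; rewrite lee_fin h0.
have mhE : measurable_fun D (EFin \o h) by exact/measurable_EFinP.
have E : \int[mp]_(s in D) (h s)%:E + \int[m2]_(s in D) (h s)%:E =
         \int[mn]_(s in D) (h s)%:E + \int[m1]_(s in D) (h s)%:E.
  rewrite -!ge0_integral_measure_add//.
  by apply: eq_measure_integral => A mA _; exact: mE.
have fin (m : {measure set (measurableTypeR R) -> \bar R}) :
    \int[m]_(s in D) (h s)%:E < +oo -> \int[m]_(s in D) (h s)%:E \is a fin_num.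
  by move=> ?; rewrite ge0_fin_numE// integral_ge0.
move: E (fin _ Pfin) (fin _ Nfin) (fin _ fin1) (fin _ fin2); rewrite /Rintegral.
move: (\int[mp]_(s in D) (h s)%:E) (\int[mn]_(s in D) (h s)%:E).
move: (\int[m1]_(s in D) (h s)%:E) (\int[m2]_(s in D) (h s)%:E).
move=> [p| |] [q| |] [r| |] [t| |]//= [E] _ _ _ _; lra.
Qed.

End IntegralMeasureSub.

Section BVIntegral.
Context {R : realType}.
Implicit Types (F g h : R -> R).

Definition cumulative_fun F := nondecreasing F /\ right_continuous F.

Lemma stieltjes_itvoc F a b : cumulative_fun F -> a <= b ->
  stieltjes F `]a, b]%classic = (F b - F a)%:E.
Proof.
move=> [ndF rF]; rewrite /stieltjes.
case: pselect => [H|]; last by case.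
rewrite le_eqVlt => /predU1P[->|ab].
  by rewrite set_itvoc0 measure0 subrr.
rewrite /= /lebesgue_stieltjes_measure /measure_extension measurable_mu_extE//=.
  by rewrite wlength_itv_bnd// ltW.
exact: is_ocitv.
Qed.

Lemma neg_variation_cumulative g : right_continuous g ->
  (forall b, -1 < b -> bounded_variation (-1) b g) ->
  cumulative_fun (neg_variation g).
Proof.
move=> rg bvg; split=> [s t st|x]; rewrite /neg_variation.
  set m := Num.max t (-1).
  have mb : -1 < m + 1 by rewrite ltr_pwDr// le_max lexx orbT.
  have msm : Num.max s (-1) <= m by rewrite ge_max !le_max st lexx orbT.
  apply: (fine_neg_tv_nondecreasing (bvg _ mb)) => //;
    rewrite in_itv/= le_max lexx orbT/=.
    by rewrite (le_trans msm)// lerDl.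
  by rewrite lerDl.
have [x1|x1] := ltP x (-1).
  apply: cvg_near_cst; near=> s.
  have s1 : s < -1 by near: s; exact: nbhs_right_lt.
  by rewrite max_r// ltW.
have xb : x < x + 1 by rewrite ltrDl.
apply: (cvg_trans _ (neg_tv_right_continuous x1 xb (bvg _ (le_lt_trans x1 xb)) (rg x))).
apply: near_eq_cvg; near=> s.
have xs : x < s by near: s; exact: nbhs_right_gt.
by rewrite /= max_l// (le_trans x1)// ltW.
Unshelve. all: by end_near. Qed.

Lemma right_continuousN g : right_continuous g -> right_continuous (\- g).
Proof. by move=> rg x; apply: cvgN; exact: rg. Qed.

(** The Jordan decomposition of [g] need not be the pair [F1], [F2]. But positive variation plus
    [F2] and negative variation plus [F1] have the same increments, hence the same Stieltjes
    measure. *)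
Lemma bv_integral_cumulative g y0 F1 F2 (D : set R) h :
  cumulative_fun F1 -> cumulative_fun F2 ->
  (forall s, g s = y0 + F1 s - F2 s) ->
  (forall s, s < 0 -> g s = y0) ->
  measurable D -> measurable_fun D h -> (forall s, D s -> 0 <= h s) ->
  (\int[stieltjes (pos_variation g)]_(s in D) (h s)%:E < +oo)%E ->
  (\int[stieltjes (neg_variation g)]_(s in D) (h s)%:E < +oo)%E ->
  (\int[stieltjes F1]_(s in D) (h s)%:E < +oo)%E ->
  (\int[stieltjes F2]_(s in D) (h s)%:E < +oo)%E ->
  bv_integral g D h =
  \int[stieltjes F1]_(s in D) h s - \int[stieltjes F2]_(s in D) h s.
Proof.
move=> cF1 cF2 gE g0 mD mh h0 Pfin Nfin fin1 fin2.
have [ndF1 rF1] := cF1; have [ndF2 rF2] := cF2.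
have rg : right_continuous g.
  move=> x; rewrite (_ : g = fun s => y0 + F1 s - F2 s); last exact/funext.
  by apply: cvgB => //; apply: cvgD => //; exact: cvg_cst.
have bvg b : -1 < b -> bounded_variation (-1) b g.
  move=> b1; rewrite (_ : g = ((fun s => y0 + F1 s) \+ (\- F2))); last exact/funext.
  apply: bounded_variationD => //.
    by apply: nondecreasing_bounded_variation => x y _ _ xy; rewrite lerD2l ndF1.
  by apply: bounded_variationN; apply: nondecreasing_bounded_variation => x y _ _; exact: ndF2.
have cN := neg_variation_cumulative rg bvg.
have cP : cumulative_fun (pos_variation g).
  (* The positive variation of [g] is the negative variation of its opposite. *)
  apply: (@neg_variation_cumulative (\- g)); first exact: right_continuousN.
  by move=> b b1; apply: bounded_variationN; exact: bvg.
have PN s : pos_variation g s = neg_variation g s + g s.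
  rewrite /pos_variation /neg_variation.
  set m := Num.max s (-1).
  have m1 : -1 <= m by rewrite le_max lexx orbT.
  have mb : -1 < m + 1 by rewrite ltr_pwDr.
  have gm : g s = g m.
    rewrite /m; have [//|s1] := leP (-1) s.
    by rewrite !g0// (lt_trans s1).
  have := bounded_variation_pos_neg_tvE (bvg _ mb).
  move=> /(_ m); rewrite in_itv/= m1 lerDl ler01 => /(_ isT).
  by rewrite gm => ->; rewrite addrC subrK.
have alg2 (x y z t : R) : y - x + (t - z) = y + t - (x + z) by ring.
have alg3 (x y z t u v : R) : y - x + (t - z) =
  y + (y0 + t - v) + v - (x + (y0 + z - u) + u) by ring.
have cD F F' : cumulative_fun F -> cumulative_fun F' ->
    nondecreasing (F \+ F') /\ right_continuous (F \+ F').
  move=> [ndF rF] [ndF' rF']; split=> [x y xy|x]; first by rewrite lerD ?ndF ?ndF'.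
  by apply: cvgD; [exact: rF|exact: rF'].
have [nd1 r1] := cD _ _ cP cF2.
have mE A : measurable A -> measure_add (stieltjes (pos_variation g)) (stieltjes F2) A =
    measure_add (stieltjes (neg_variation g)) (stieltjes F1) A.
  move=> mA; transitivity (stieltjes (pos_variation g \+ F2) A).
    apply/esym; apply: stieltjes_unique => // a b ab.
    rewrite [LHS]measure_addE !stieltjes_itvoc// -EFinD; congr EFin.
    exact: alg2.
  apply: stieltjes_unique => // a b ab; rewrite [LHS]measure_addE !stieltjes_itvoc// -EFinD.
  by congr EFin; rewrite /= !PN !gE; exact: alg3.
apply: (Rintegral_measure_sub mD mh h0 Pfin Nfin fin1 fin2).
exact: mE.
Qed.

Lemma stieltjes_bounded_fin F (a b : R) h K (D : set R) : cumulative_fun F ->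
  a <= b -> D `<=` `]a, b] -> measurable D -> measurable_fun D h ->
  (forall s, D s -> 0 <= h s <= K) ->
  (\int[stieltjes F]_(s in D) (h s)%:E < +oo)%E.
Proof.
move=> cF ab Dab mD mh hK.
have K0 : 0 <= Num.max K 0 by rewrite le_max lexx orbT.
apply: (@le_lt_trans _ _ (\int[stieltjes F]_(s in D) (cst (Num.max K 0)%:E s))%E).
  apply: ge0_le_integral => //.
  - by move=> x Dx; rewrite lee_fin; have /andP[] := hK _ Dx.
  - exact/measurable_EFinP.
  - by move=> x Dx; rewrite lee_fin le_max; have /andP[_ ->] := hK _ Dx.
rewrite integral_cst// lte_mul_pinfty//.
apply: (@le_lt_trans _ _ (stieltjes F `]a, b]%classic)).
  by apply: le_measure => //; rewrite inE.
by rewrite stieltjes_itvoc// ltry.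
Qed.

End BVIntegral.

(** * Plans as time changes *)

Section Decay.
Context {R : realType}.
Variables (T : R) (beta : R -> R).
Hypotheses (T0 : 0 <= T) (bc : {within `[0, T], continuous beta})
  (bpos : forall s, 0 <= s <= T -> 0 < beta s).
Local Notation mu := (@lebesgue_measure R).

(** [beta] is controlled on [[0, T]] only; the clamped versions are measurable on the whole line,
    with global bounds. *)
Definition cbeta s := beta (clamp T s).
Definition cdecay s := decay beta 0 (clamp T s).

Lemma cbeta_gt0 s : 0 < cbeta s.
Proof. by apply: bpos; exact: clamp_itv. Qed.

Lemma cbeta_bounds : exists m K : R, [/\ 0 < m, 0 < K &
  forall s, m <= cbeta s <= K].
Proof.
have [x xT xmin] := EVT_min T0 bc; have [y yT ymax] := EVT_max T0 bc.
exists (beta x), (beta y); split.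
- by apply: bpos; move: xT; rewrite in_itv.
- by apply: bpos; move: yT; rewrite in_itv.
- move=> s; have sT : clamp T s \in `[0, T] by rewrite in_itv/= clamp_itv.
  by rewrite xmin// ymax.
Qed.

Lemma measurable_cbeta : measurable_fun setT cbeta.
Proof.
have mb : measurable_fun `[0, T] beta by exact: subspace_continuous_measurable_fun.
apply: (@measurable_comp _ _ _ _ _ _ `[0, T]%classic) => //.
- by move=> _ [s _ <-] /=; rewrite in_itv/= clamp_itv.
- exact: measurable_clamp.
Qed.

Lemma decay_cbeta t : 0 <= t <= T ->
  decay beta 0 t = expR (\int[mu]_(s in `[0, t]) (- cbeta s)).
Proof.
move=> /andP[t0 tT]; rewrite /decay; congr expR.
have [m [K [m0 K0 mK]]] := cbeta_bounds.
have ib : mu.-integrable `[0, t] (EFin \o cbeta).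
  apply: (@bounded_integrable_itv _ _ K); first exact: measurable_cbeta.
  by move=> x; rewrite gtr0_norm ?cbeta_gt0//; case/andP: (mK x).
transitivity (- \int[mu]_(s in `[0, t]) cbeta s).
  congr (- _); apply: eq_Rintegral => s; rewrite inE/= in_itv/= => /andP[s0 st].
  by rewrite /cbeta clamp_id// s0 (le_trans st).
rewrite -mulN1r -RintegralZl//.
by apply: eq_Rintegral => s _; rewrite mulN1r.
Qed.

Lemma decay_gt0 s t : 0 < decay beta s t. Proof. exact: expR_gt0. Qed.

Lemma decay0 : decay beta 0 0 = 1.
Proof. by rewrite /decay set_itv1 Rintegral_set1 oppr0 expR0. Qed.

Lemma decayE s t : 0 <= s -> s <= t -> t <= T ->
  decay beta s t = decay beta 0 t / decay beta 0 s.
Proof.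
move=> s0 st tT; have sT := le_trans st tT.
rewrite !decay_cbeta ?s0 ?(le_trans s0 st)//.
have [m [K [m0 K0 mK]]] := cbeta_bounds.
have mb : measurable_fun setT (fun s => - cbeta s).
  by apply: measurable_funN; exact: measurable_cbeta.
have bK x : `|- cbeta x| <= K.
  by rewrite normrN gtr0_norm ?cbeta_gt0//; case/andP: (mK x).
rewrite -expRN -expRD (Rintegral_sub_itv mb bK s0 st) /decay; congr expR.
have ib : mu.-integrable `]s, t] (EFin \o cbeta).
  apply: (@bounded_integrable_itv _ _ K); first exact: measurable_cbeta.
  by move=> x; rewrite -normrN.
rewrite -Rintegral_itv_obnd_cbnd; last first.
  apply: eq_integrable ib => // x; rewrite inE/= in_itv/= => /andP[sx xt].
  by rewrite /= /cbeta clamp_id// (le_trans s0 (ltW sx)) (le_trans xt).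
transitivity (- \int[mu]_(s in `]s, t]) cbeta s).
  congr (- _); apply: eq_Rintegral => x; rewrite inE/= in_itv/= => /andP[sx xt].
  by rewrite /cbeta clamp_id// (le_trans s0 (ltW sx)) (le_trans xt).
rewrite -mulN1r -RintegralZl//.
by apply: eq_Rintegral => x _; rewrite mulN1r.
Qed.

Lemma measurable_cdecay : measurable_fun setT cdecay.
Proof.
have [m [K [m0 K0 mK]]] := cbeta_bounds.
have mb : measurable_fun setT (fun s => - cbeta s).
  by apply: measurable_funN; exact: measurable_cbeta.
have bK x : `|- cbeta x| <= K.
  by rewrite normrN gtr0_norm ?cbeta_gt0//; case/andP: (mK x).
rewrite (_ : cdecay = fun s => expR (\int[mu]_(x in `[0, clamp T s]) (- cbeta x))).
  apply: measurableT_comp => //.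
  exact: (measurable_primitive mb bK).
by apply/funext => s; rewrite /cdecay decay_cbeta// clamp_itv.
Qed.

Lemma cdecay_gt0 s : 0 < cdecay s. Proof. exact: decay_gt0. Qed.

Lemma cdecay_le1 s : cdecay s <= 1.
Proof.
have /andP[s0 sT] := clamp_itv s T0.
rewrite /cdecay /decay -expR0 ler_expR oppr_le0; apply: Rintegral_ge0 => x /=.
by rewrite in_itv/= => /andP[x0 xs]; rewrite ltW// bpos// x0 (le_trans xs).
Qed.

(** [integral_exp_primitive] for [a = - cbeta], whose exponential primitive is the decay. *)
Lemma integral_beta_decay s t : 0 <= s -> s <= t -> t <= T ->
  \int[mu]_(x in `]s, t]) (cbeta x * cdecay x) = cdecay s - cdecay t.
Proof.
move=> s0 st tT; have sT := le_trans st tT.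
have [m [K [m0 K0 mK]]] := cbeta_bounds.
have mb : measurable_fun setT (fun s => - cbeta s).
  by apply: measurable_funN; exact: measurable_cbeta.
have bK x : `|- cbeta x| <= K.
  by rewrite normrN gtr0_norm ?cbeta_gt0//; case/andP: (mK x).
have mg : measurable_fun setT (fun x => cbeta x * cdecay x).
  by apply: measurable_funM; [exact: measurable_cbeta|exact: measurable_cdecay].
have gK x : `|cbeta x * cdecay x| <= K.
  rewrite normrM -(mulr1 K) ler_pM// ?(gtr0_norm (cdecay_gt0 x)) ?cdecay_le1//.
  by rewrite -normrN.
have I0 r : 0 <= r <= T -> \int[mu]_(x in `[0, r]) (cbeta x * cdecay x) = 1 - cdecay r.
  move=> rT; have := integral_exp_primitive T0 mb bK rT.
  rewrite -decay_cbeta// => H.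
  have E : \int[mu]_(x in `[0, r]) (- cbeta x * expR (\int[mu]_(y in `[0, x]) - cbeta y)) =
      - \int[mu]_(x in `[0, r]) (cbeta x * cdecay x).
    rewrite -mulN1r -RintegralZl//; last exact: bounded_integrable_itv mg gK _ _ _ _.
    apply: eq_Rintegral => x; rewrite inE/= in_itv/= => /andP[x0 xr].
    have xT : 0 <= x <= T by rewrite x0 (le_trans xr)//; case/andP: rT.
    by rewrite -decay_cbeta// mulN1r mulNr /cdecay clamp_id.
  move: H; rewrite E /cdecay (clamp_id rT) => /eqP; rewrite eqr_oppLR opprB => /eqP.
  by [].
rewrite -(Rintegral_sub_itv mg gK s0 st) !I0 ?s0 ?(le_trans s0 st)//.
by rewrite opprB addrC addrA subrK.
Qed.

(** The dependence on [t] factors out of the kernel, so that satisfaction becomes [cdecay t] times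
    an integral whose integrand does not involve [t]. *)
Lemma theta_kernelE t s : 0 <= s -> s <= t -> t <= T ->
  theta_kernel beta t s = cbeta s * (cdecay t / cdecay s).
Proof.
move=> s0 st tT; rewrite /theta_kernel (decayE s0 st tT) /cbeta /cdecay.
have sE : clamp T s = s by rewrite clamp_id// s0 (le_trans st).
have tE : clamp T t = t by rewrite clamp_id// (le_trans s0 st).
by rewrite sE tE.
Qed.

End Decay.

Section TimeChanged.
Context {R : realType}.
Variables (T : R) (beta : R -> R).
Hypotheses (T0 : 0 <= T) (bc : {within `[0, T], continuous beta})
  (bpos : forall s, 0 <= s <= T -> 0 < beta s).
Local Notation mu := (@lebesgue_measure R).
Local Notation b := (cbeta T beta).
Local Notation dec := (cdecay T beta).

(* [dc] is the image of the measure [k (htime T g u) du] on [`]a0, g T]] under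
   [htime T g]; when [k = 1] and [a0 = 0] this is the classical time change
   for [c = g]. *)
Record time_changed (g : R -> R) (a0 : R) (k : R -> R) (K : R) (c : R -> R) := {
  tc_rc : rc_path T g;
  tc_base : a0 <= g 0;
  tc_ge0 : forall x, 0 <= k x;
  tc_le : forall x, k x <= K;
  tc_meas : measurable_fun setT k;
  tc_eq : forall t, 0 <= t <= T ->
    (c t)%:E = (\int[mu]_(u in `]a0, g t]) (k (htime T g u))%:E)%E }.

Lemma time_changed_integral g a0 k K c (t : R) (h : R -> \bar R) :
  time_changed g a0 k K c -> 0 <= t <= T ->
  measurable_fun `[0, t] h -> (forall s, (0 <= s <= t)%R -> 0 <= h s)%E ->
  (\int[stieltjes (extend_path T 0 c)]_(s in `[0%R, t]) h s =
   \int[mu]_(u in `]a0, g t]) (h (htime T g u) * (k (htime T g u))%:E))%E.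
Proof.
move=> [rg a0g k0 kK mk cE] /andP[t0 tT] mh h0.
rewrite (integral_stieltjes_htime T0 rg a0g k0 kK mk cE)//.
congr (integral _ _ _).
have [ndg _] := rg.
apply/seteqP; split => u /=; rewrite !in_itv/= htime_ge0//=.
  by move=> [/andP[a0u ugT]]; rewrite htime_le_level ?t0// a0u.
move=> /andP[a0u ugt]; have ugT : u <= g T by rewrite (le_trans ugt)// ndg.
by rewrite a0u ugT htime_le_level// t0.
Qed.

Lemma time_changed_rc_path g a0 k K c : time_changed g a0 k K c -> rc_path T c.
Proof.
by move=> [rg a0g k0 kK mk cE]; exact: (time_change_rc_path T0 rg a0g k0 kK mk cE).
Qed.

Lemma time_changed_ge0 g a0 k K c t : time_changed g a0 k K c ->
  0 <= t <= T -> 0 <= c t.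
Proof.
by move=> [rg a0g k0 kK mk cE]; exact: (time_change_ge0 k0 cE).
Qed.

Lemma time_changed_self g : rc_path T g -> 0 <= g 0 ->
  time_changed g 0 (fun=> 1) 1 g.
Proof.
move=> rg g0; split=> // t /andP[t0 tT].
rewrite integral_cst//= mul1e lebesgue_measure_itv/= lte_fin.
have [ndg _] := rg.
have : 0 <= g t by rewrite (le_trans g0) ?ndg.
by rewrite le_eqVlt => /predU1P[<-|->]; rewrite ?ltxx// -EFinB subr0.
Qed.

(** What remains of the density [k] times the kernel [b s * dec t / dec s] once [dec t] is taken
    out. *)
Definition satisfaction_density (k : R -> R) s := k s * (b s / dec s).

Lemma satisfaction_density_ge0 k : (forall x, 0 <= k x) ->
  forall s, 0 <= satisfaction_density k s.
Proof. by move=> k0 s; rewrite mulr_ge0// divr_ge0// ltW// ?cbeta_gt0// cdecay_gt0. Qed.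

Lemma measurable_satisfaction_density k : measurable_fun setT k ->
  measurable_fun setT (satisfaction_density k).
Proof.
move=> mk; apply: measurable_funM => //; apply: measurable_funM.
  exact: measurable_cbeta.
apply: measurable_inv_gt0; last exact: measurable_cdecay.
exact: cdecay_gt0.
Qed.

Lemma time_changed_satisfaction g a0 k K c (t : R) : time_changed g a0 k K c ->
  0 <= t <= T ->
  \int[stieltjes (extend_path T 0 c)]_(s in `[0, t]) theta_kernel beta t s =
  dec t * fine (\int[mu]_(u in `]a0, g t])
                  (satisfaction_density k (htime T g u))%:E)%E.
Proof.
move=> tc tT; have [rg a0g k0 kK mk cE] := tc; have /andP[t0 tleT] := tT.
pose th s := b s * (dec t / dec s).
have mth : measurable_fun setT th.
  apply: measurable_funM; first exact: measurable_cbeta.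
  apply: measurable_funM => //.
  apply: measurable_inv_gt0; last exact: measurable_cdecay.
  exact: cdecay_gt0.
have th0 s : 0 <= th s.
  by rewrite mulr_ge0 ?divr_ge0// ltW// ?cbeta_gt0// cdecay_gt0.
have thE s : 0 <= s <= t -> theta_kernel beta t s = th s.
  by move=> /andP[s0 st]; rewrite (theta_kernelE T0 bc bpos s0 st tleT).
rewrite /Rintegral; transitivity (fine (\int[stieltjes (extend_path T 0 c)]_(s in `[0%R, t]) (th s)%:E)%E).
  by congr fine; apply: eq_integral => s; rewrite inE/= in_itv/= => /thE ->.
rewrite (time_changed_integral tc tT); last 2 first.
- by apply/measurable_EFinP; exact: measurable_funTS.
- by move=> s _; rewrite lee_fin.
have -> : (\int[mu]_(u in `]a0, g t]) ((th (htime T g u))%:E * (k (htime T g u))%:E))%E =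
  ((dec t)%:E * \int[mu]_(u in `]a0, g t]) (satisfaction_density k (htime T g u))%:E)%E.
  rewrite -ge0_integralZl_EFin//; last 3 first.
  - by move=> u _; rewrite lee_fin satisfaction_density_ge0.
  - apply/measurable_EFinP; apply: measurable_funTS.
    apply: measurableT_comp (measurable_htime_path T0 rg).
    exact: measurable_satisfaction_density.
  - by rewrite ltW// cdecay_gt0.
  apply: eq_integral => u _; rewrite -!EFinM; congr EFin.
  by rewrite /th /satisfaction_density mulrCA (mulrC _ (k _)) mulrA (mulrCA _ (k _)) -!mulrA.
(* A positive finite factor commutes with [fine]: infinite values give 0 on both sides. *)
have dt0 : dec t != 0 by rewrite gt_eqF// cdecay_gt0.
case: (\int[mu]_(u in _) _)%E => [x| |]//=.
- by rewrite mulry gtr0_sg ?cdecay_gt0// mul1e/= mulr0.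
- by rewrite mulrNy gtr0_sg ?cdecay_gt0// mul1e/= mulr0.
Qed.

End TimeChanged.

(** * Tonelli's theorem on subsets *)

Section TonelliOn.
Context {d1 d2} {S1 : measurableType d1} {S2 : measurableType d2} {R : realType}.
Variables (m1 : {sigma_finite_measure set S1 -> \bar R})
  (m2 : {sigma_finite_measure set S2 -> \bar R}).
Local Open Scope ereal_scope.

Lemma tonelli_on (D1 : set S1) (D2 : set S2) (F : S1 * S2 -> \bar R) :
  measurable D1 -> measurable D2 -> measurable_fun setT F ->
  (forall p, 0 <= F p) ->
  \int[m1]_(x in D1) \int[m2]_(y in D2) F (x, y) =
  \int[m2]_(y in D2) \int[m1]_(x in D1) F (x, y).
Proof.
move=> mD1 mD2 mF F0.
pose G (p : S1 * S2) := F p * (\1_D1 p.1)%:E * (\1_D2 p.2)%:E.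
have mG : measurable_fun setT G.
  apply: emeasurable_funM; first apply: emeasurable_funM => //.
    by apply/measurable_EFinP; apply: measurableT_comp => //; exact: measurable_indic.
  by apply/measurable_EFinP; apply: measurableT_comp => //; exact: measurable_indic.
have G0 p : 0 <= G p by rewrite /G !mule_ge0// lee_fin.
have := @fubini_tonelli _ _ _ _ _ m1 m2 G mG G0; rewrite /fubini_F /fubini_G => E.
transitivity (\int[m1]_x \int[m2]_y G (x, y)).
  rewrite integral_mkcond; apply: eq_integral => x _; rewrite /patch.
  case: ifPn => xD1; last first.
    rewrite integral0_eq// => y _; rewrite /G/= indicE (negbTE xD1).
    by rewrite mule0 mul0e.
  rewrite integral_mkcond; apply: eq_integral => y _; rewrite /patch /G/= !indicE xD1.
  by rewrite mule1; case: ifPn => yD2; rewrite ?mule1 ?mule0.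
rewrite E [RHS]integral_mkcond; apply: eq_integral => y _; rewrite /patch.
case: ifPn => yD2; last first.
  rewrite integral0_eq// => x _; rewrite /G/= [\1_D2 _]indicE (negbTE yD2).
  by rewrite mule0.
rewrite [RHS]integral_mkcond; apply: eq_integral => x _; rewrite /patch /G/= !indicE yD2.
by rewrite mule1; case: ifPn => xD1; rewrite ?mule1 ?mule0.
Qed.

Lemma measurable_integral_on (D2 : set S2) (F : S1 * S2 -> \bar R) :
  measurable D2 -> measurable_fun setT F -> (forall p, 0 <= F p) ->
  measurable_fun setT (fun x => \int[m2]_(y in D2) F (x, y)).
Proof.
move=> mD2 mF F0.
rewrite (_ : (fun x => _) = fubini_F m2 (fun p => F p * (\1_D2 p.2)%:E)).
  apply: measurable_fun_fubini_tonelli_F.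
  + apply: emeasurable_funM => //; apply/measurable_EFinP.
    by apply: measurableT_comp => //; exact: measurable_indic.
  + by move=> p; rewrite mule_ge0// lee_fin.
apply/funext => x; rewrite /fubini_F [LHS]integral_mkcond.
apply: eq_integral => y _.
by rewrite /patch indicE; case: ifPn; rewrite ?mule1 ?mule0.
Qed.

End TonelliOn.

Lemma measurable_le_indic {d} {S : measurableType d} {R : realType} (x y : S -> R) :
  measurable_fun setT x -> measurable_fun setT y ->
  measurable_fun setT (fun w => ((x w <= y w)%R%:R : R)).
Proof.
move=> mx my; rewrite (_ : (fun w => _) = \1_[set w | x w <= y w]).
  by apply: measurable_indic; exact: measurable_set_le.
apply/funext => w; rewrite indicE; congr (_%:R).
by congr nat_of_bool; apply/idP/idP; rewrite inE.
Qed.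

(** * The candidate plan as a time change *)

Section LevelPlan.
Context {R : realType}.
Variables (T : R) (beta : R -> R).
Hypotheses (T0 : 0 <= T) (bc : {within `[0, T], continuous beta})
  (bpos : forall s, 0 <= s <= T -> 0 < beta s).
Local Notation mu := (@lebesgue_measure R).
Local Notation b := (cbeta T beta).
Local Notation dec := (cdecay T beta).

Lemma rc_path_id : rc_path T (@idfun R).
Proof.
by split=> // t _; apply: cvg_at_right_filter; exact: cvg_id.
Qed.

Lemma htime_id u : 0 < u <= T -> htime T idfun u = u.
Proof.
move=> /andP[u0 uT]; apply/eqP; rewrite eq_le (htime_reached T0 rc_path_id)//.
by rewrite andbT htime_le_level ?(ltW u0)//; exact: rc_path_id.
Qed.

Variables (A : R -> R) (eta : R).
Hypotheses (rA : rc_path T A) (eta0 : 0 <= eta) (etaA : eta <= A 0).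
Local Notation sig := (htime T A).
Local Notation A' := (fun s => A (clamp T s)).

Let mA' : measurable_fun setT A'.
Proof.
apply: nondecreasing_measurable => // x y xy; have [ndA _] := rA.
have /andP[? ?] := clamp_itv x T0; have /andP[? ?] := clamp_itv y T0.
by apply: ndA => //; rewrite /clamp ge_max le_max lexx/= le_max le_min !ge_min lexx xy orbT !orbT.
Qed.

Let A'ge s : eta <= A' s.
Proof.
have [ndA _] := rA; have /andP[? ?] := clamp_itv s T0.
by rewrite (le_trans etaA)// ndA.
Qed.

Let A'le s : A' s <= A T.
Proof. by have [ndA _] := rA; have /andP[? ?] := clamp_itv s T0; rewrite ndA. Qed.

Let mdec := measurable_cdecay T0 bc bpos.
Let mb := @measurable_cbeta _ T beta T0 bc.

(** Integration by parts of [dec] against [dA]: write [dec (sig u)] as [dec t] plus the integral of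
    [b * dec] over []sig u, t]], and exchange the integrals using that [sig u <= s] amounts to
    [u <= A s]. *)
Lemma integral_decay_hit t : 0 <= t <= T ->
  (\int[mu]_(u in `]eta, A t]) (dec (sig u))%:E =
   (dec t * (A t - eta))%:E +
   \int[mu]_(s in `[0%R, t]) (b s * dec s * (A' s - eta))%:E)%E.
Proof.
move=> tT; have /andP[t0 tleT] := tT.
have [K1 [K [K10 K0 bK]]] := cbeta_bounds T0 bc bpos.
pose q s := b s * dec s.
have q0 s : 0 <= q s by rewrite mulr_ge0// ltW// ?cbeta_gt0// cdecay_gt0.
have mq : measurable_fun setT q by exact: measurable_funM.
have qK x : `|q x| <= K.
  rewrite normrM -(mulr1 K) ler_pM// ?(gtr0_norm (cdecay_gt0 _ _ x)) ?cdecay_le1//.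
  by rewrite gtr0_norm ?cbeta_gt0//; case/andP: (bK x).
pose F (p : R * R) := (q p.2 * (p.1 <= A' p.2)%R%:R)%:E.
have mF : measurable_fun setT F.
  apply/measurable_EFinP; apply: measurable_funM; first exact: measurableT_comp.
  apply: measurable_le_indic; first exact: measurable_fst.
  exact: (measurableT_comp mA' measurable_snd).
have F0 p : (0 <= F p)%E by rewrite lee_fin mulr_ge0.
have inner1 u : u \in `]eta, A t]%classic ->
    (dec (sig u))%:E = ((dec t)%:E + \int[mu]_(s in `[0%R, t]) F (u, s))%E.
  rewrite inE/= in_itv/= => /andP[eu uA].
  have uAT : u <= A T by have [ndA _] := rA; rewrite (le_trans uA)// ndA.
  have st : sig u <= t by rewrite htime_le_level.
  have s0 := htime_ge0 T0 A u.
  have -> : (\int[mu]_(s in `[0%R, t]) F (u, s) = \int[mu]_(s in `[sig u, t]) (q s)%:E)%E.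
    rewrite integral_mkcond [RHS]integral_mkcond; apply: eq_integral => s _.
    rewrite /patch /F/= !mem_setE !in_itv/=.
    have [s0t|s0t] := boolP (0 <= s <= t); last first.
      case: ifPn => // /andP[ss st']; move: s0t; rewrite st' andbT => /negP[].
      exact: le_trans ss.
    have sT : 0 <= s <= T by case/andP: s0t => -> /le_trans; apply.
    rewrite -(@htime_le_level _ _ T0 A u (clamp T s))// ?clamp_id//.
    by case/andP: s0t => _ ->; rewrite andbT; case: ifP => _; rewrite ?mulr1 ?mulr0.
  rewrite -integral_itv_obnd_cbnd; last first.
    by apply/measurable_EFinP; exact: measurable_funTS.
  have fin : (\int[mu]_(s in `]sig u, t]) (q s)%:E)%E \is a fin_num.
    apply: integrable_fin_num => //; exact: bounded_integrable_itv mq qK _ _ _ _.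
  have := integral_beta_decay T0 bc bpos s0 st tleT.
  rewrite /Rintegral => H; rewrite -(fineK fin) H -EFinD; congr EFin.
  by rewrite addrC subrK.
have inner2 s : s \in `[0, t]%classic ->
    (\int[mu]_(u in `]eta, A t]) F (u, s) = (q s * (A' s - eta))%:E)%E.
  rewrite inE/= in_itv/= => /andP[s0 st].
  have sE : clamp T s = s by rewrite clamp_id// s0 (le_trans st).
  have Ast : A s <= A t by have [ndA _] := rA; rewrite ndA.
  have -> : (\int[mu]_(u in `]eta, A t]) F (u, s) = \int[mu]_(u in `]eta, A s]) (cst (q s)%:E u))%E.
    rewrite integral_mkcond [RHS]integral_mkcond; apply: eq_integral => u _.
    rewrite /patch /F/= !mem_setE !in_itv/= sE; have [eu|] := boolP (eta < u) => //=.
    have [uA|] := boolP (u <= A s); last by rewrite mulr0 if_same.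
    by rewrite (le_trans uA Ast) mulr1.
  rewrite integral_cst//= lebesgue_measure_itv/= lte_fin sE.
  have : eta <= A s by rewrite -sE A'ge.
  rewrite le_eqVlt => /predU1P[<-|->]; last by rewrite -EFinB -EFinM.
  by rewrite ltxx mule0 subrr mulr0.
transitivity (\int[mu]_(u in `]eta, A t]) ((dec t)%:E + \int[mu]_(s in `[0%R, t]) F (u, s)))%E.
  by apply: eq_integral => u; exact: inner1.
have d0 : (0 <= (dec t)%:E)%E by rewrite lee_fin ltW// cdecay_gt0.
rewrite ge0_integralD//; last 2 first.
- by move=> u _; apply: integral_ge0.
- apply: measurable_funTS.
  exact: measurable_integral_on.
rewrite integral_cst//= lebesgue_measure_itv/= lte_fin.
congr (_ + _)%E.
  have : eta <= A t by rewrite -(clamp_id tT) A'ge.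
  rewrite le_eqVlt => /predU1P[<-|->]; last by rewrite -EFinB -EFinM.
  by rewrite ltxx mule0 subrr mulr0.
rewrite tonelli_on//.
by apply: eq_integral => s; exact: inner2.
Qed.

End LevelPlan.

Section LevelPlanTimeChange.
Context {R : realType}.
Variables (T : R) (beta : R -> R).
Hypotheses (T0 : 0 <= T) (bc : {within `[0, T], continuous beta})
  (bpos : forall s, 0 <= s <= T -> 0 < beta s).
Local Notation mu := (@lebesgue_measure R).
Local Notation b := (cbeta T beta).
Local Notation dec := (cdecay T beta).
Variables (A : R -> R) (eta : R).
Hypotheses (rA : rc_path T A) (eta0 : 0 <= eta) (etaA : eta <= A 0).
Local Notation sig := (htime T A).
Local Notation A' := (fun s => A (clamp T s)).

Let mA' : measurable_fun setT A'.
Proof.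
apply: nondecreasing_measurable => // x y xy; have [ndA _] := rA.
have /andP[? ?] := clamp_itv x T0; have /andP[? ?] := clamp_itv y T0.
by apply: ndA => //; rewrite /clamp ge_max le_max lexx/= le_max le_min !ge_min lexx xy orbT !orbT.
Qed.

Let A'ge s : eta <= A' s.
Proof.
have [ndA _] := rA; have /andP[? ?] := clamp_itv s T0.
by rewrite (le_trans etaA)// ndA.
Qed.

Let A'le s : A' s <= A T.
Proof. by have [ndA _] := rA; have /andP[? ?] := clamp_itv s T0; rewrite ndA. Qed.

Let mdec := measurable_cdecay T0 bc bpos.
Let mb := @measurable_cbeta _ T beta T0 bc.

Let dec0 s : 0 < dec s. Proof. exact: cdecay_gt0. Qed.
Let b0 s : 0 < b s. Proof. exact: cbeta_gt0. Qed.

(** The increasing part of [Y = dec A], namely the integral of [dec] against [dA]. *)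
Let c1 t := fine (\int[mu]_(u in `]eta, A t]) (dec (sig u))%:E)%E.

Let tc1 : time_changed T A eta dec 1 c1.
Proof.
split => //; [by move=> x; exact: ltW|by move=> x; exact: cdecay_le1|].
move=> t tT; rewrite /c1 fineK//.
have ib : mu.-integrable `]eta, A t] (EFin \o (fun u => dec (sig u))).
  apply: (@bounded_integrable_itv _ _ 1).
    exact: measurableT_comp mdec (measurable_htime_path T0 rA).
  by move=> x; rewrite gtr0_norm// cdecay_le1.
exact: integrable_fin_num ib.
Qed.

Let k2 s := b s * dec s * A' s.

Let mk2 : measurable_fun setT k2.
Proof. by apply: measurable_funM => //; exact: measurable_funM. Qed.

Let k20 s : 0 <= k2 s.
Proof. by rewrite !mulr_ge0 ?(ltW (b0 s)) ?(ltW (dec0 s))// (le_trans eta0). Qed.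

(** The decreasing part of [Y], with density [b dec A] in time. It is written as a time change along
    the identity, so that one integration formula serves for both parts. *)
Let c2 t := fine (\int[mu]_(u in `]0%R, t]) (k2 (htime T idfun u))%:E)%E.

Let htime_id_eq t h : 0 <= t <= T ->
  (\int[mu]_(u in `]0%R, t]) (h (htime T idfun u)) = \int[mu]_(u in `]0%R, t]) h u)%E.
Proof.
move=> /andP[t0 tT]; apply: eq_integral => u; rewrite inE/= in_itv/= => /andP[u0 ut].
by rewrite htime_id// u0 (le_trans ut).
Qed.

Let k2_bound : exists K2, forall s, k2 s <= K2.
Proof.
have [K1 [K [K10 K0 bK]]] := cbeta_bounds T0 bc bpos.
exists (K * 1 * A T) => s; rewrite !ler_pM ?mulr_ge0 ?(ltW (b0 s)) ?(ltW (dec0 s))//.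
- exact: le_trans (A'ge s).
- by case/andP: (bK s).
- exact: cdecay_le1.
Qed.

Let c2E t : 0 <= t <= T -> (c2 t)%:E = (\int[mu]_(u in `]0%R, t]) (k2 u)%:E)%E.
Proof.
move=> tT; rewrite /c2 (htime_id_eq (fun u => (k2 u)%:E) tT) fineK//.
have [K2 kK2] := k2_bound.
have ib : mu.-integrable `]0, t] (EFin \o k2).
  by apply: (@bounded_integrable_itv _ _ K2) => // x; rewrite ger0_norm.
exact: integrable_fin_num ib.
Qed.

Let tc2 K2 : (forall s, k2 s <= K2) -> time_changed T idfun 0 k2 K2 c2.
Proof.
move=> kK2; split => //; first exact: rc_path_id.
by move=> t tT; rewrite c2E// (htime_id_eq (fun u => (k2 u)%:E) tT).
Qed.

Let by_parts t : 0 <= t <= T -> dec t * A t = eta + c1 t - c2 t.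
Proof.
move=> tT; have /andP[t0 tleT] := tT.
have E1 := tc_eq tc1 tT.
have := integral_decay_hit T0 bc bpos rA etaA tT; rewrite -E1 => {}E1.
have bd0 s : 0 <= b s * dec s by rewrite mulr_ge0 ?(ltW (b0 s)) ?(ltW (dec0 s)).
have mbd : measurable_fun setT (fun s => b s * dec s) by exact: measurable_funM.
have E2 : (c2 t)%:E = (\int[mu]_(s in `[0%R, t]) (b s * dec s * (A' s - eta))%:E +
   (eta * (1 - dec t))%:E)%E.
  rewrite c2E// integral_itv_obnd_cbnd; last first.
    by apply/measurable_EFinP; exact: measurable_funTS.
  have -> : (eta * (1 - dec t))%:E = (\int[mu]_(s in `[0%R, t]) (b s * dec s * eta)%:E)%E.
    have := integral_beta_decay T0 bc bpos (lexx 0) t0 tleT.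
    rewrite [dec 0]/cdecay clamp_id ?lexx// decay0 => <-.
    have [K1 [K [K10 K0 bK]]] := cbeta_bounds T0 bc bpos.
    have ibd : mu.-integrable `]0, t] (EFin \o (fun s => b s * dec s)).
      apply: (@bounded_integrable_itv _ _ K) => // x.
      rewrite normrM -(mulr1 K) ler_pM// ?(gtr0_norm (dec0 x)) ?cdecay_le1//.
      by rewrite gtr0_norm//; case/andP: (bK x).
    rewrite -integral_itv_obnd_cbnd; last first.
      apply/measurable_EFinP; apply: measurable_funTS; exact: measurable_funM.
    rewrite EFinM /Rintegral fineK; last exact: integrable_fin_num ibd.
    rewrite -ge0_integralZl_EFin//; last 2 first.
    + by move=> s _; rewrite lee_fin.
    + by apply/measurable_EFinP; exact: measurable_funTS.
    by apply: eq_integral => s _; rewrite -EFinM mulrC.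
  rewrite -ge0_integralD//; last 4 first.
  - by move=> s _; rewrite lee_fin mulr_ge0// subr_ge0.
  - apply/measurable_EFinP; apply: measurable_funTS; apply: measurable_funM => //.
    exact: measurable_funB.
  - by move=> s _; rewrite lee_fin mulr_ge0.
  - by apply/measurable_EFinP; apply: measurable_funTS; exact: measurable_funM.
  by apply: eq_integral => s _; rewrite -EFinD -mulrDr subrK.
move: E1 E2; case: (\int[mu]_(s in `[0%R, t]) _)%E => [x| |]//=.
move: (c1 t) (c2 t) (dec t) (A t) => p q r a.
by rewrite -!EFinD => -[->] [->]; ring.
Qed.

Let k s := dec s / b s.

Let mk : measurable_fun setT k.
Proof. by apply: measurable_funM => //; exact: measurable_inv_gt0. Qed.

(** By [by_parts], dY = dc1 - dc2. Divided by [b], dc2 becomes Y dt and cancels the absolutely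
    continuous term of the plan; what remains is dc1 / b, that is (dec / b) dA. *)
Lemma level_plan_time_changed (Y c : R -> R) :
  (forall t, 0 <= t <= T -> Y t = decay beta 0 t * A t) ->
  (forall t, 0 <= t <= T -> c t = \int[mu]_(s in `[0, t]) Y s
     + bv_integral (extend_path T eta Y) `[0, t] (fun s => (beta s)^-1)) ->
  exists K, time_changed T A eta k K c.
Proof.
move=> YE cE.
have [K1 [K [K10 K0 bK]]] := cbeta_bounds T0 bc bpos.
have bV s : (b s)^-1 <= K1^-1.
  by rewrite lef_pV2 ?posrE//; case/andP: (bK s).
exists K1^-1; split => //.
- by move=> s; rewrite divr_ge0 ?(ltW (dec0 s)) ?(ltW (b0 s)).
- move=> s; rewrite -[leRHS]mul1r ler_pM ?invr_ge0 ?(ltW (dec0 s)) ?(ltW (b0 s))//.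
  exact: cdecay_le1.
move=> t tT; have /andP[t0 tleT] := tT; rewrite cE//.
have [K2 kK2] := k2_bound; have tc2' := tc2 kK2.
have c10 : 0 <= c1 0.
  by rewrite (time_changed_ge0 tc1)// lexx.
have c20 : 0 <= c2 0.
  by rewrite (time_changed_ge0 tc2')// lexx.
have rc1 := time_changed_rc_path T0 tc1.
have rc2 := time_changed_rc_path T0 tc2'.
have cF1 : cumulative_fun (extend_path T 0 c1) by exact: extend_path_cumulative.
have cF2 : cumulative_fun (extend_path T 0 c2) by exact: extend_path_cumulative.
pose g := extend_path T eta Y.
have gE s : g s = eta + extend_path T 0 c1 s - extend_path T 0 c2 s.
  rewrite /g /extend_path; case: ltP => s0; first by rewrite addr0 subr0.
  have sT : 0 <= Num.min s T <= T by rewrite le_min s0 T0 ge_min lexx orbT.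
  by rewrite (YE _ sT) -(by_parts sT) /cdecay (clamp_id sT).
have g0 s : s < 0 -> g s = eta by rewrite /g /extend_path => ->.
pose h s := (b s)^-1.
have mh : measurable_fun setT h by exact: measurable_inv_gt0.
have h0 s : 0 <= h s by rewrite invr_ge0 ltW.
have hE s : s \in `[0, t]%classic -> (beta s)^-1 = h s.
  rewrite inE/= in_itv/= => /andP[s0 st].
  by rewrite /h /cbeta clamp_id// s0 (le_trans st).
have -> : bv_integral (extend_path T eta Y) `[0, t] (fun s => (beta s)^-1) =
   bv_integral g `[0, t] h.
  by rewrite /bv_integral; congr (_ - _); apply: eq_Rintegral => s; exact: hE.
(* A half-open interval reaching below 0 contains the atom at 0, and its measure is an increment. *)
have sub : `[0, t] `<=` `]-1, t].
  move=> s /=; rewrite !in_itv/= => /andP[s0 ->]; rewrite andbT.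
  by rewrite (lt_le_trans _ s0).
have m1t : -1 <= t by rewrite (le_trans _ t0).
have fin F : cumulative_fun F -> (\int[stieltjes F]_(s in `[0%R, t]) (h s)%:E < +oo)%E.
  move=> cF; apply: (@stieltjes_bounded_fin _ F (-1) t h K1^-1 _ cF m1t sub) => //.
    exact: measurable_funTS.
  by move=> s _; rewrite h0 bV.
have rg : right_continuous g.
  move=> x; rewrite (_ : g = fun s => eta + extend_path T 0 c1 s - extend_path T 0 c2 s);
    last exact/funext.
  by apply: cvgB; [apply: cvgD; [exact: cvg_cst|exact: cF1.2]|exact: cF2.2].
have bvg x : -1 < x -> bounded_variation (-1) x g.
  move=> x1; rewrite (_ : g = (fun s => eta + extend_path T 0 c1 s) \+ (\- extend_path T 0 c2));
    last exact/funext.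
  apply: bounded_variationD => //.
    by apply: nondecreasing_bounded_variation => y z _ _ yz; rewrite lerD2l cF1.1.
  apply: bounded_variationN; apply: nondecreasing_bounded_variation => y z _ _.
  exact: cF2.1.
have cN := neg_variation_cumulative rg bvg.
have cP : cumulative_fun (pos_variation g).
  apply: (@neg_variation_cumulative _ (\- g)); first exact: right_continuousN.
  by move=> x x1; apply: bounded_variationN; exact: bvg.
have mht : measurable_fun `[0, t]%classic h by exact: measurable_funTS.
rewrite (bv_integral_cumulative cF1 cF2 gE g0 _ mht (fun s _ => h0 s)
  (fin _ cP) (fin _ cN) (fin _ cF1) (fin _ cF2))//.
have mhE : measurable_fun `[0, t]%classic (EFin \o h) by exact/measurable_EFinP.
have hE0 s : 0 <= s <= t -> (0 <= (h s)%:E)%E by rewrite lee_fin.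
have I1 : (\int[stieltjes (extend_path T 0 c1)]_(s in `[0%R, t]) (h s)%:E =
    \int[mu]_(u in `]eta, A t]) (k (sig u))%:E)%E.
  rewrite (time_changed_integral T0 tc1 tT mhE hE0).
  by apply: eq_integral => u _; rewrite -EFinM mulrC.
have I2 : (\int[stieltjes (extend_path T 0 c2)]_(s in `[0%R, t]) (h s)%:E =
    \int[mu]_(s in `[0%R, t]) (Y s)%:E)%E.
  rewrite (time_changed_integral T0 tc2' tT mhE hE0).
  rewrite (htime_id_eq (fun u => (h u)%:E * (k2 u)%:E)%E tT).
  rewrite integral_itv_obnd_cbnd; last first.
    by apply: emeasurable_funM; apply/measurable_EFinP; exact: measurable_funTS.
  apply: eq_integral => s; rewrite inE/= in_itv/= => /andP[s0 st].
  have sT : 0 <= s <= T by rewrite s0 (le_trans st).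
  rewrite -EFinM /h /k2 (YE _ sT) -mulrA mulKf ?gt_eqF ?b0//.
  by rewrite /cdecay (clamp_id sT).
have f1 := fin _ cF1; have f2 := fin _ cF2.
rewrite /Rintegral I1 I2; rewrite I1 in f1.
have : (0 <= \int[mu]_(u in `]eta, A t]) (k (sig u))%:E)%E.
  by apply: integral_ge0 => u _; rewrite lee_fin divr_ge0 ?(ltW (dec0 _)) ?(ltW (b0 _)).
move: f1; case: (\int[mu]_(u in `]eta, A t]) (k (sig u))%:E)%E => [x| |]//= _ _.
by rewrite addrC subrK.
Qed.

End LevelPlanTimeChange.

(** The sequence may take the value [x], which right neighbourhoods exclude; at such terms [f (s n)]
    is already the limit. *)
Lemma cvg_right_seq {R : realType} (f : R -> R) (x : R) (s : nat -> R) :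
  f @ x^'+ --> f x -> (forall n, x <= s n) -> s @ \oo --> x ->
  (fun n => f (s n)) @ \oo --> f x.
Proof.
move=> rf xs sx; apply/cvgrPdist_lt => e e0.
have /cvgrPdist_lt/(_ e e0) H := rf.
have [d /= d0 dH] := H.
have /cvgrPdist_lt/(_ d d0) := sx; apply: filterS => n xsn.
move: (xs n); rewrite le_eqVlt => /predU1P[<-|xltsn]; first by rewrite subrr normr0.
exact: dH.
Qed.

(** * Optional sampling *)

Section Filtration.
Context {d} {Omega : measurableType d} {R : realType}.
Variables (P : probability Omega R) (T : R) (F : R -> set (set Omega)).
Hypotheses (T0 : 0 < T)
  (Fs : forall t, 0 <= t <= T -> sigma_algebra setT (F t))
  (FM : forall t, 0 <= t <= T -> F t `<=` measurable)
  (Fmono : forall s t, 0 <= s -> s <= t -> t <= T -> F s `<=` F t).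

Lemma measurable_wrtP (G : set (set Omega)) {d'} {S : measurableType d'}
    (X : Omega -> S) : sigma_algebra setT G ->
  measurable_wrt G X <-> measurable_fun setT (X : g_sigma_algebraType G -> S).
Proof.
move=> Gs; split => [mX _ B mB|mX B mB].
  rewrite setTI; apply: sub_sigma_algebra; exact: mX.
by have := mX measurableT B mB; rewrite setTI /measurable/= sigma_algebra_id.
Qed.

Lemma adapted_measurable (X : R -> Omega -> R) t : adapted T F X ->
  0 <= t <= T -> measurable_fun setT (X t).
Proof.
move=> aX tT _ B mB; rewrite setTI; apply: (FM tT); exact: aX.
Qed.

Lemma adapted_measurable_at (X : R -> Omega -> R) s t : adapted T F X ->
  0 <= s -> s <= t -> t <= T ->
  measurable_fun setT (X s : g_sigma_algebraType (F t) -> R).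
Proof.
move=> aX s0 st tT _ B mB; rewrite setTI; apply: sub_sigma_algebra.
by apply: (Fmono s0 st tT); apply: aX => //; rewrite s0 (le_trans st).
Qed.

Variable Z : R -> Omega -> R.
Hypotheses (aZ : adapted T F Z) (Z0 : forall t w, 0 <= Z t w)
  (Zmart : forall t A, 0 <= t <= T -> F t A ->
    (\int[P]_(w in A) (Z T w)%:E = \int[P]_(w in A) (Z t w)%:E)%E).

Let TT : 0 <= T <= T. Proof. by rewrite lexx ltW. Qed.

Lemma integral_martingale t (X : g_sigma_algebraType (F t) -> \bar R) :
  0 <= t <= T -> measurable_fun setT X -> (forall w, 0 <= X w)%E ->
  (\int[P]_w (X w * (Z T w)%:E) = \int[P]_w (X w * (Z t w)%:E))%E.
Proof.
move=> tT mX X0; apply: eq_integral_sub => //.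
- exact: FM.
- exact: adapted_measurable.
- exact: adapted_measurable.
- by move=> A; rewrite sigma_algebra_id; [exact: Zmart|exact: Fs].
Qed.

Variable g : R -> Omega -> R.
Hypotheses (ag : adapted T F g) (rg : forall w, rc_path T (g ^~ w)).
Variable u : R.
Local Notation tau w := (htime T (g ^~ w) u).

Let grid (n i : nat) : R := T * i%:R / n.+1%:R.

Let grid_itv n i : (i <= n.+1)%N -> 0 <= grid n i <= T.
Proof.
move=> i_n; rewrite /grid divr_ge0 ?mulr_ge0 ?(ltW T0)//=.
by rewrite ler_pdivrMr// ler_wpM2l ?(ltW T0)// ler_nat.
Qed.

Let gridS n i : grid n i.+1 = grid n i + T / n.+1%:R.
Proof. by rewrite /grid -mulrDl -natr1 mulrDr mulr1. Qed.

Let grid0 n : grid n 0 = 0. Proof. by rewrite /grid mulr0 mul0r. Qed.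
Let gridT n : grid n n.+1 = T. Proof. by rewrite /grid mulfK. Qed.

(* [hit n i] is the event that [grid n i] is the first grid point at or after
   the time at which [g] reaches [u]. *)
Let hit n i : set Omega :=
  [set w | u <= g (grid n i) w] `&`
  ~` [set w | (0 < i)%N /\ u <= g (grid n i.-1) w].

Let ndg w s t : 0 <= s -> s <= t -> t <= T -> g s w <= g t w.
Proof. by have [ndg _] := rg w; exact: ndg. Qed.

Let grid_le n i j : (i <= j)%N -> grid n i <= grid n j.
Proof. by move=> ij; rewrite /grid ler_wpM2r// ler_wpM2l ?(ltW T0)// ler_nat. Qed.

Let hit_uniq n i j w : (i <= n.+1)%N -> (j <= n.+1)%N -> hit n i w -> hit n j w -> i = j.
Proof.
have H p q : (p <= n.+1)%N -> (q <= n.+1)%N -> hit n p w -> hit n q w -> (q <= p)%N.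
  move=> pn qn [/= up _] [/= _ nq]; rewrite leqNgt; apply/negP => pq.
  apply: nq; split; first exact: leq_ltn_trans pq.
  apply: (le_trans up); have /andP[? _] := grid_itv pn.
  have qn' : (q.-1 <= n.+1)%N by rewrite (leq_trans (leq_pred _)).
  have /andP[_ ?] := grid_itv qn'.
  by apply: ndg => //; apply: grid_le; rewrite -ltnS prednK// (leq_ltn_trans _ pq).
move=> i_n j_n hi hj; apply/eqP.
by rewrite eqn_leq (H j i j_n i_n hj hi) (H i j i_n j_n hi hj).
Qed.

(** The least grid index at which [g] is at least [u]: by minimality the preceding grid point is not
    after the hitting time, whence the upper bound. *)
Let hit_exists n w : u <= g T w -> exists i, [/\ (i <= n.+1)%N, hit n i w &
  tau w <= grid n i <= tau w + T / n.+1%:R].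
Proof.
move=> uT.
have ex : exists i, u <= g (grid n i) w by exists n.+1; rewrite gridT.
have [i ui imin] := ex_minnP ex.
have i_n : (i <= n.+1)%N by apply: imin; rewrite gridT.
exists i; split=> //.
  split => //=; move=> [i0 /imin]; rewrite -ltnS prednK// ltnn//.
have gT := grid_itv i_n.
rewrite (htime_le_level (ltW T0) (rg w) gT uT) ui/=.
case: i ui imin i_n gT => [|i] ui imin i_n gT.
  by rewrite grid0 addr_ge0 ?htime_ge0 ?divr_ge0// ltW.
rewrite gridS lerD2r leNgt; apply/negP => tg.
have gi : 0 <= grid n i < T.
  rewrite /grid divr_ge0 ?mulr_ge0 ?(ltW T0)//=.
  by rewrite ltr_pdivrMr// ltr_pM2l// ltr_nat.
have := ltW tg; rewrite (htime_le (ltW T0) _ (rg w) gi) => /imin.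
by rewrite ltnn.
Qed.

(** The value of [phi] at the discretised hitting time, and 0 if [g] never reaches [u]. The
    discretised time has finitely many values, [grid n 0] to [grid n n.+1]. *)
Definition sampled (phi : R -> Omega -> R) n w : R :=
  \sum_(i < n.+2) \1_(hit n i) w * phi (grid n i) w.

Let sampledE phi n w i : (i <= n.+1)%N -> hit n i w -> sampled phi n w = phi (grid n i) w.
Proof.
move=> i_n hi; rewrite /sampled (bigD1 (Ordinal (i_n : (i < n.+2)%N)))//=.
rewrite indicE mem_set// mul1r big1 ?addr0// => j ji.
rewrite indicE memNset ?mul0r// => hj; move/negP: ji; apply; apply/eqP/val_inj => /=.
by apply: (hit_uniq _ _ hj hi) => //; rewrite -ltnS.
Qed.

Let sampledN phi n w : ~~ (u <= g T w) -> sampled phi n w = 0.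
Proof.
move=> uT; rewrite /sampled big1// => i _; rewrite indicE memNset ?mul0r//.
move=> [/= ui _]; move/negP: uT; apply; rewrite (le_trans ui)//.
have /andP[? ?] : 0 <= grid n i <= T by apply: grid_itv; rewrite -ltnS.
exact: ndg.
Qed.

Lemma sampled_cvg (phi : R -> Omega -> R) w : right_continuous_paths T phi ->
  (fun n => sampled phi n w) @ \oo --> (u <= g T w)%R%:R * phi (tau w) w.
Proof.
move=> rphi; have [uT|uT] := boolP (u <= g T w); last first.
  rewrite mul0r (_ : (fun n => _) = (fun=> 0)); first exact: cvg_cst.
  by apply/funext => n; exact: sampledN.
rewrite mul1r.
have /choice[s sH] n : exists s : R, sampled phi n w = phi s w /\
    (s <= T /\ tau w <= s <= tau w + T / n.+1%:R).
  have [i [i_n hi ti]] := hit_exists n uT.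
  exists (grid n i); split; first exact: sampledE.
  by split => //; have /andP[] := grid_itv i_n.
rewrite (_ : (fun n => _) = fun n => phi (s n) w); last first.
  by apply/funext => n; have [->] := sH n.
have := htime_leT (ltW T0) (g ^~ w) u; rewrite le_eqVlt => /predU1P[tT|tT].
  rewrite (_ : (fun n => _) = fun=> phi (tau w) w); first exact: cvg_cst.
  apply/funext => n; congr (phi _ w); apply/eqP; rewrite eq_le.
  by have [_ [sT /andP[ts _]]] := sH n; rewrite ts {1}tT sT.
apply: (@cvg_right_seq _ (phi ^~ w) (tau w) s).
- by apply: rphi; rewrite htime_ge0// ltW.
- by move=> n; have [_ [_ /andP[]]] := sH n.
apply: (@squeeze_cvgr _ _ _ _ (fun=> tau w) (fun n => tau w + T / n.+1%:R)).
- by apply: nearW => n; have [_ []] := sH n.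
- exact: cvg_cst.
- rewrite -[X in _ --> X]addr0; apply: cvgD; first exact: cvg_cst.
  rewrite -(mulr0 T); apply: cvgM; first exact: cvg_cst.
  exact: cvg_harmonic.
Qed.

Let hit_F n i : (i <= n.+1)%N -> F (grid n i) (hit n i).
Proof.
move=> i_n; have gT := grid_itv i_n.
have G : @measurable _ (g_sigma_algebraType (F (grid n i))) (hit n i).
  have /andP[g0 gle] := gT.
  apply: measurableI.
    by apply: measurable_set_le => //; exact: adapted_measurable_at.
  apply: measurableC; case: i i_n gT g0 gle => [|i] i_n gT g0 gle /=.
    rewrite (_ : mkset _ = set0)//; apply/seteqP; split => // w /=; by case.
  rewrite (_ : mkset _ = [set w | u <= g (grid n i) w]); last first.
    by apply/seteqP; split => w /=; [case|].
  have /andP[? ?] := grid_itv (ltnW i_n).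
  apply: measurable_set_le => //; apply: adapted_measurable_at => //.
  exact: grid_le.
by move: G; rewrite /measurable/= sigma_algebra_id//; exact: Fs.
Qed.

Lemma measurable_sampled phi n : adapted T F phi ->
  measurable_fun setT (sampled phi n).
Proof.
move=> aphi; apply: measurable_sum => i; have i_n : (i <= n.+1)%N by rewrite -ltnS.
apply: measurable_funM.
  by apply: measurable_indic; apply: (FM (grid_itv i_n)); exact: hit_F.
exact: adapted_measurable aphi (grid_itv i_n).
Qed.

(** Each event [hit n i] belongs to [F (grid n i)], so the martingale property replaces [Z T] by
    [Z (grid n i)] in every term of a finite sum. *)
Lemma integral_sampled phi n : adapted T F phi -> (forall t w, 0 <= phi t w) ->
  (\int[P]_w (sampled phi n w * Z T w)%:E =
   \int[P]_w (sampled (fun t w => phi t w * Z t w) n w)%:E)%E.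
Proof.
move=> aphi phi0.
transitivity (\sum_(i < n.+2) \int[P]_w (\1_(hit n i) w * phi (grid n i) w * Z T w)%:E)%E.
  rewrite -ge0_integral_sum//; last 2 first.
  - move=> i; apply/measurable_EFinP; have i_n : (i <= n.+1)%N by rewrite -ltnS.
    apply: measurable_funM; last exact: adapted_measurable aZ TT.
    apply: measurable_funM; last exact: adapted_measurable aphi (grid_itv i_n).
    by apply: measurable_indic; apply: (FM (grid_itv i_n)); exact: hit_F.
  - by move=> i w _; rewrite lee_fin !mulr_ge0.
  by apply: eq_integral => w _; rewrite sumEFin /sampled mulr_suml.
transitivity (\sum_(i < n.+2) \int[P]_w (\1_(hit n i) w * phi (grid n i) w * Z (grid n i) w)%:E)%E.
  apply: eq_bigr => i _; have i_n : (i <= n.+1)%N by rewrite -ltnS.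
  have gT := grid_itv i_n.
  apply: (@integral_martingale (grid n i)
    (fun w => (\1_(hit n i) w * phi (grid n i) w)%:E) gT).
    apply/measurable_EFinP; apply: measurable_funM.
      apply: measurable_indic; apply: sub_sigma_algebra; exact: hit_F.
    by have /andP[? ?] := gT; exact: adapted_measurable_at.
  by move=> w; rewrite lee_fin mulr_ge0.
rewrite -ge0_integral_sum//; last 2 first.
- move=> i; apply/measurable_EFinP; have i_n : (i <= n.+1)%N by rewrite -ltnS.
  apply: measurable_funM; last exact: adapted_measurable aZ (grid_itv i_n).
  apply: measurable_funM; last exact: adapted_measurable aphi (grid_itv i_n).
  by apply: measurable_indic; apply: (FM (grid_itv i_n)); exact: hit_F.
- by move=> i w _; rewrite lee_fin !mulr_ge0.
apply: eq_integral => w _; rewrite sumEFin /sampled; congr EFin.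
by apply: eq_bigr => i _; rewrite mulrA.
Qed.

Let sampled_bound phi n w C : 0 <= C -> (forall t w, 0 <= phi t w <= C) ->
  0 <= sampled phi n w <= C.
Proof.
move=> C0 phiC; have [uT|uT] := boolP (u <= g T w); last first.
  by rewrite sampledN// lexx.
by have [i [i_n hi _]] := hit_exists n uT; rewrite (sampledE _ i_n hi).
Qed.

Definition stopped (phi : R -> Omega -> R) w := (u <= g T w)%R%:R * phi (tau w) w.

Lemma measurable_stopped phi : adapted T F phi -> right_continuous_paths T phi ->
  measurable_fun setT (stopped phi).
Proof.
move=> aphi rphi; apply: (@measurable_fun_cvg _ _ _ _ (sampled phi)).
  by move=> n; exact: measurable_sampled.
by move=> w _; exact: sampled_cvg.
Qed.

Hypotheses (rZ : right_continuous_paths T Z)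
  (iZ : P.-integrable setT (fun w => (Z T w)%:E)).

(** Right continuity gives pointwise limits along the grids. The dominating function is [C * Z T] on
    the left and the constant [C'] on the right. *)
Let optional_sampling_bounded phi C C' : adapted T F phi ->
  right_continuous_paths T phi -> 0 <= C -> 0 <= C' ->
  (forall t w, 0 <= phi t w <= C) -> (forall t w, phi t w * Z t w <= C') ->
  (\int[P]_w (stopped phi w * Z T w)%:E =
   \int[P]_w (stopped (fun t w => phi t w * Z t w) w)%:E)%E.
Proof.
move=> aphi rphi C0 C'0 phiC phiZC'.
have phi0 t w : 0 <= phi t w by have /andP[] := phiC t w.
have aphiZ : adapted T F (fun t w => phi t w * Z t w).
  move=> t tT; apply/measurable_wrtP; first exact: Fs.
  by apply: measurable_funM; apply/measurable_wrtP; (try exact: Fs);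
    [exact: aphi|exact: aZ].
have rphiZ : right_continuous_paths T (fun t w => phi t w * Z t w).
  by move=> w t tT; apply: cvgM; [exact: rphi|exact: rZ].
have mZT : measurable_fun setT (Z T) by exact: adapted_measurable aZ TT.
have L : ((fun n => \int[P]_w (sampled phi n w * Z T w)%:E)%E @ \oo -->
      (\int[P]_w (stopped phi w * Z T w)%:E)%E).
  apply: (@dominated_cvg_EFin _ _ _ _ _ _ (fun w => C * Z T w)) => //.
  - move=> n; apply: measurable_funM => //.
    exact: measurable_sampled.
  - by move=> w; apply: cvgM; [exact: sampled_cvg|exact: cvg_cst].
  - by under eq_fun do rewrite EFinM; exact: integrableZl.
  - move=> n w; have /andP[s0 sC] := sampled_bound n w C0 phiC.
    by rewrite ger0_norm ?mulr_ge0// ler_wpM2r.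
have phiZ0 t w : 0 <= phi t w * Z t w <= C' by rewrite mulr_ge0//=.
have L' : ((fun n => \int[P]_w (sampled (fun t w => phi t w * Z t w) n w)%:E)%E @ \oo -->
      (\int[P]_w (stopped (fun t w => phi t w * Z t w) w)%:E)%E).
  apply: (@dominated_cvg_EFin _ _ _ _ _ _ (fun w => C')) => //.
  - by move=> n; exact: measurable_sampled.
  - by move=> w; exact: sampled_cvg.
  - exact: finite_measure_integrable_cst.
  - move=> n w; have /andP[s0 sC] := sampled_bound n w C'0 phiZ0.
    by rewrite ger0_norm.
move: L; under eq_fun do rewrite integral_sampled//.
by move/cvg_unique; apply.
Qed.

Lemma optional_sampling (h : R -> Omega -> R) Kh : adapted T F h ->
  right_continuous_paths T h -> (forall t w, 0 <= h t w <= Kh) ->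
  (\int[P]_w (stopped h w * Z T w)%:E =
   \int[P]_w (stopped (fun t w => h t w * Z t w) w)%:E)%E.
Proof.
move=> ah rh hK.
have Kh0 : 0 <= Kh by have /andP[h0 hk] := hK 0 point; exact: le_trans hk.
have h0 t w : 0 <= h t w by have /andP[] := hK t w.
(* damping by [1 + Z / m.+1] makes both [phi] and [phi * Z] bounded *)
pose den m t w : R := 1 + Z t w / m.+1%:R.
have den1 m t w : 1 <= den m t w by rewrite /den lerDl divr_ge0.
have den0 m t w : 0 < den m t w by rewrite (lt_le_trans _ (den1 _ _ _)).
pose phi m t w := h t w / den m t w.
have aphi m : adapted T F (phi m).
  move=> t tT; apply/measurable_wrtP; first exact: Fs.
  apply: measurable_funM; first by apply/measurable_wrtP; [exact: Fs|exact: ah].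
  apply: measurable_inv_gt0 => //; apply: measurable_funD => //.
  by apply: measurable_funM => //; apply/measurable_wrtP; [exact: Fs|exact: aZ].
have rphi m : right_continuous_paths T (phi m).
  move=> w t tT; apply: cvgM; first exact: rh.
  apply: cvgV; first by rewrite gt_eqF.
  apply: cvgD; first exact: cvg_cst.
  by apply: cvgM; [exact: rZ|exact: cvg_cst].
have phi_bd m t w : 0 <= phi m t w <= Kh.
  rewrite divr_ge0 ?(ltW (den0 _ _ _))//= ler_pdivrMr//.
  by have /andP[_ hk] := hK t w; rewrite (le_trans hk)// ler_peMr.
have phiZ_bd m t w : phi m t w * Z t w <= Kh * m.+1%:R.
  rewrite /phi mulrAC ler_pdivrMr// -mulrA ler_pM//.
    by have /andP[] := hK t w.
  by rewrite /den mulrDr mulr1 mulrCA mulfV// mulr1 lerDr.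
have eqm m := optional_sampling_bounded (aphi m) (rphi m) Kh0
  (mulr_ge0 Kh0 (ler0n R m.+1)) (phi_bd m) (phiZ_bd m).
(* As [m] grows the damping fades and [phi m] increases to [h], so that monotone convergence applies
   to both sides. *)
have nd m n t w : (m <= n)%N -> phi m t w <= phi n t w.
  move=> mn; rewrite ler_wpM2l// lef_pV2 ?posrE// lerD2l ler_wpM2l//.
  by rewrite lef_pV2 ?posrE ?ltr0n// ler_nat.
have phi_cvg t w : (fun m => phi m t w) @ \oo --> h t w.
  rewrite -[X in _ --> X]mulr1; apply: cvgM; first exact: cvg_cst.
  rewrite -[X in _ --> X]invr1; apply: cvgV => //.
  rewrite -[X in _ --> X]addr0; apply: cvgD; first exact: cvg_cst.
  rewrite -(mulr0 (Z t w)); apply: cvgM; first exact: cvg_cst.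
  exact: cvg_harmonic.
have ind0 w : 0 <= (u <= g T w)%R%:R :> R by rewrite ler0n.
have mZT : measurable_fun setT (Z T) by exact: adapted_measurable aZ TT.
have mphiZ m : measurable_fun setT (stopped (fun t w => phi m t w * Z t w)).
  apply: measurable_stopped.
    move=> t tT; apply/measurable_wrtP; first exact: Fs.
    by apply: measurable_funM; apply/measurable_wrtP; (try exact: Fs);
      [exact: aphi|exact: aZ].
  by move=> w t tT; apply: cvgM; [exact: rphi|exact: rZ].
have L1 : (fun m => \int[P]_w (stopped (phi m) w * Z T w)%:E)%E @ \oo -->
    (\int[P]_w (stopped h w * Z T w)%:E)%E.
  rewrite (_ : (\int[P]_w (stopped h w * Z T w)%:E)%E =
    (\int[P]_w limn (fun m => (stopped (phi m) w * Z T w)%:E))%E); last first.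
    apply: eq_integral => w _; apply/esym/cvg_lim => //.
    apply: cvg_EFin; first exact: nearW.
    apply: cvgM; last exact: cvg_cst.
    by apply: cvgM; [exact: cvg_cst|exact: phi_cvg].
  apply: cvg_monotone_convergence => //.
  - move=> m; apply/measurable_EFinP; apply: measurable_funM => //.
    exact: measurable_stopped.
  - move=> m w _; have /andP[p0 _] := phi_bd m (tau w) w; rewrite lee_fin.
    exact: mulr_ge0 (mulr_ge0 (ind0 w) p0) (Z0 T w).
  - move=> w _ m n mn; rewrite lee_fin ler_wpM2r// ler_wpM2l//; exact: nd.
have L2 : (fun m => \int[P]_w (stopped (fun t w => phi m t w * Z t w) w)%:E)%E @ \oo -->
    (\int[P]_w (stopped (fun t w => h t w * Z t w) w)%:E)%E.
  rewrite (_ : (\int[P]_w (stopped (fun t w => h t w * Z t w) w)%:E)%E =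
    (\int[P]_w limn (fun m => (stopped (fun t w => phi m t w * Z t w) w)%:E))%E); last first.
    apply: eq_integral => w _; apply/esym/cvg_lim => //.
    apply: cvg_EFin; first exact: nearW.
    apply: cvgM; first exact: cvg_cst.
    by apply: cvgM; [exact: phi_cvg|exact: cvg_cst].
  apply: cvg_monotone_convergence => //.
  - by move=> m; apply/measurable_EFinP.
  - move=> m w _; have /andP[p0 _] := phi_bd m (tau w) w; rewrite lee_fin.
    exact: mulr_ge0 (ind0 w) (mulr_ge0 p0 (Z0 _ _)).
  - by move=> w _ m n mn; rewrite lee_fin ler_wpM2l// ler_wpM2r//; exact: nd.
by move: L1; under eq_fun do rewrite eqm; move/cvg_unique; apply.
Qed.

End Filtration.

(** * The filtration generated by the Brownian motion and the jumps *)

Section GeneratedFiltration.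
Context {d} {Omega : measurableType d} {R : realType}.
Variables (P0 : probability Omega R) (T : R) (B : R -> Omega -> R)
  (theta : {sigma_finite_measure set R -> \bar R})
  (v : Omega -> {measure set (R * R) -> \bar R}).
Hypotheses (T0 : 0 <= T) (hB : brownian_motion P0 T B)
  (hv : poisson_random_measure P0 T theta v).
Local Notation F := (generated_filtration P0 B v).

Lemma generated_filtration_sigma t : sigma_algebra setT (F t).
Proof. exact: smallest_sigma_algebra. Qed.

Let jump_domainS (s t : R) : s <= t -> jump_domain s `<=` jump_domain t.
Proof. move=> st p [/andP[p0 ps] pn]; split => //=.
by rewrite p0 (le_trans ps). Qed.

Lemma generated_filtration_measurable t : 0 <= t <= T -> F t `<=` measurable.
Proof.
move=> /andP[t0 tT]; apply: smallest_sub; first exact: sigma_algebra_measurable.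
have [mB _ _ _] := hB; have [mv _ _] := hv.
move=> A [[s [D [/andP[s0 st] mD ->]]]|[[E [D [mE Et mD ->]]]|[//]]].
  rewrite -[_ @^-1` _]setTI; apply: mB => //; rewrite s0 (le_trans st)//.
have := mv E mE (subset_trans Et (jump_domainS tT)) measurableT D mD.
by rewrite setTI.
Qed.

Lemma generated_filtration_mono s t : 0 <= s -> s <= t -> t <= T -> F s `<=` F t.
Proof.
move=> s0 st tT; apply: sub_sigma_algebra2 => A.
case=> [[q [D [/andP[q0 qs] mD ->]]]|[[E [D [mE Et mD ->]]]|A0]].
- by left; exists q, D; split => //; rewrite q0 (le_trans qs).
- right; left; exists E, D; split => //.
  exact: subset_trans Et (jump_domainS st).
- by right; right.
Qed.

Let trivial_event : set (set Omega) :=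
  [set A | measurable A /\ (P0 A = 0 \/ P0 (~` A) = 0)]%E.

Let null_sub (A N : set Omega) : measurable A -> measurable N -> P0 N = 0%E ->
  A `<=` N -> P0 A = 0%E.
Proof.
move=> mA mN N0 AN; apply/eqP; rewrite eq_le measure_ge0 andbT -N0.
by apply: le_measure; rewrite ?inE.
Qed.

(** For a countable union: if one of the sets has a null complement, so has the union; otherwise all
    of them are null, and so is the union. *)
Let trivial_sigma : sigma_algebra setT trivial_event.
Proof.
split.
- by split => //; left; rewrite measure0.
- move=> A [mA H]; rewrite setTD; split; first exact: measurableC.
  by rewrite setCK; case: H; [right|left].
- move=> A HA.
  have mA i : measurable (A i) by have [] := HA i.
  split; first exact: bigcupT_measurable.
  have [[i Hi]|H] := pselect (exists i, P0 (~` A i) = 0%E).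
    right; apply: (@null_sub _ (~` A i)) => //.
    + by apply: measurableC; exact: bigcupT_measurable.
    + exact: measurableC.
    + by apply: subsetC => w Aw; exists i.
  left; apply: measure_negligible; first exact: bigcupT_measurable.
  apply: negligible_bigcup => i; apply/negligibleP => //.
  by have [_ []] := HA i => // Hi; exfalso; apply: H; exists i.
Qed.

(** [B 0] is almost surely 0, and the jump measure almost surely does not charge time 0, whose
    intensity vanishes. All generators of [F 0] thus belong to the sigma-algebra of trivial
    events. *)
Lemma generated_filtration0_trivial A : F 0 A -> P0 A = 0%E \/ P0 (~` A) = 0%E.
Proof.
suff : F 0 `<=` trivial_event by move=> H /H [].
apply: smallest_sub; first exact: trivial_sigma.
have [mB aeB _ _] := hB; have [mv pv _] := hv.
have T00 : (0 : R) <= 0 <= T by rewrite lexx T0.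
move=> {}A [[s [D [/andP[s0 s0'] mD ->]]]|[[E [D [mE Et mD ->]]]|[mA A0]]].
- have -> : s = 0 by apply/eqP; rewrite eq_le s0 s0'.
  have mBD D' : measurable D' -> measurable (B 0 @^-1` D').
    by move=> mD'; rewrite -[_ @^-1` _]setTI; exact: mB.
  have H (D' : set R) : measurable D' -> ~ D' 0 -> P0 (B 0 @^-1` D') = 0%E.
    move=> mD' D'0; apply: measure_negligible; first exact: mBD.
    apply: negligibleS aeB => w BD [B0 _]; apply: D'0.
    by rewrite -B0.
  split; first exact: mBD.
  have [D0|D0] := pselect (D 0); last by left; exact: H.
  right; rewrite preimage_setC; apply: H; first exact: measurableC.
  by move=> /(_ D0).
- have ET : E `<=` jump_domain T by exact: subset_trans Et (jump_domainS T0).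
  have E0 : (lebesgue_measure \x theta)%E E = 0%E.
    apply/eqP; rewrite eq_le measure_ge0 andbT.
    apply: (@le_trans _ _ ((lebesgue_measure \x theta)%E ([set (0 : R)] `*` setT))).
      apply: le_measure; rewrite ?inE//; first exact: measurableX.
      move=> p /Et [/andP[p0 p0'] _]; split => //=.
      by apply/eqP; rewrite eq_le p0 p0'.
    by rewrite product_measure1E//= lebesgue_measure_set1 mul0e.
  (* At rate 0 the Poisson law is the point mass at 0. *)
  have := pv E mE ET; rewrite E0 => /(_ (ltry _) 0%N).
  rewrite /poisson_prob/= ltxx diracE mem_set// => P1.
  have mvE D' : measurable D' -> measurable [set w | D' (v w E)].
    by move=> mD'; have := mv E mE ET measurableT D' mD'; rewrite setTI.
  have N0 : P0 (~` [set w | v w E = 0%:R%:E]) = 0%E.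
    rewrite probability_setC; last by apply: (mvE [set 0%:R%:E]).
    by rewrite P1 subee.
  have mN : measurable (~` [set w | v w E = 0%:R%:E]).
    by apply: measurableC; apply: (mvE [set 0%:R%:E]).
  split; first exact: mvE.
  have [D0|D0] := pselect (D 0%:R%:E).
    right; apply: null_sub mN N0 _; first by apply: measurableC; exact: mvE.
    by apply: subsetC => w /= ->.
  left; apply: null_sub mN N0 _; first exact: mvE.
  by move=> w /= Dw vw; apply: D0; rewrite -vw.
- by split => //; left.
Qed.

End GeneratedFiltration.

(** * Time as a finite measure space, and integrals with parameters *)

Section RestrictedLebesgue.
Context {R : realType}.
Variable T : R.
Local Notation mu := (@lebesgue_measure R).

(** A finite measure on the whole line, so that product integrals with [P] carry no restriction to
    [[0, T]]. *)
Definition lebesgue_upto : set (measurableTypeR R) -> \bar R :=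
  @mfrestr _ (measurableTypeR R) R `[0, T] mu (measurable_itv `[0, T])
    (lebesgue_itv_fin 0 T true false).

HB.instance Definition _ := Measure.on lebesgue_upto.

Let lebesgue_upto_fin : fin_num_fun lebesgue_upto.
Proof. exact: fin_num_measure. Qed.

HB.instance Definition _ := Measure_isFinite.Build _ _ _ lebesgue_upto lebesgue_upto_fin.

Lemma integral_lebesgue_upto (f : R -> \bar R) : measurable_fun setT f ->
  (\int[lebesgue_upto]_s f s = \int[mu]_(s in `[0%R, T]) f s)%E.
Proof.
have H (g : R -> \bar R) : measurable_fun setT g -> (forall s, 0 <= g s)%E ->
    (\int[lebesgue_upto]_s g s = \int[mu]_(s in `[0%R, T]) g s)%E.
  move=> mg g0.
  have mN : measurable (~` `[0, T]%classic) by exact: measurableC.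
  rewrite (@ge0_negligible_integral _ _ _ lebesgue_upto setT (~` `[0, T]%classic))//; last first.
    change (mu (~` `[0, T]%classic `&` `[0, T]%classic) = 0%E).
    by rewrite setICl measure0.
  rewrite setTD setCK; apply: eq_measure_integral => A mA AT.
  by change (mu (A `&` `[0, T]%classic) = mu A); rewrite setIidl.
move=> mf; rewrite integralE [RHS]integralE !H//.
  exact: measurable_funeneg.
exact: measurable_funepos.
Qed.

Lemma integrable_lebesgue_upto (f : R -> \bar R) : measurable_fun setT f ->
  lebesgue_upto.-integrable setT f <-> mu.-integrable `[0, T] f.
Proof.
move=> mf; split=> /integrableP[_ foo]; apply/integrableP; split => //.
- exact: measurable_funTS.
- by move: foo; rewrite integral_lebesgue_upto//; exact: measurableT_comp.
- by rewrite integral_lebesgue_upto//; exact: measurableT_comp.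
Qed.

End RestrictedLebesgue.

Section PrimitiveParameter.
Context {d} {Omega : measurableType d} {R : realType}.
Local Notation mu := (@lebesgue_measure R).

(** Adding [K] makes the integrand nonnegative, and Tonelli yields measurability in the parameters;
    the contribution [K * clamp T p.1] is then subtracted. *)
Lemma measurable_primitive_param T (a : R -> Omega -> R) (K : R) : 0 <= T ->
  measurable_fun setT (fun p : R * Omega => a (clamp T p.1) p.2) ->
  (forall s w, 0 <= s <= T -> `|a s w| <= K) ->
  measurable_fun setT
    (fun p : R * Omega => \int[mu]_(s in `[0, clamp T p.1]) a s p.2).
Proof.
move=> T0 ma aK.
pose a' s w := a (clamp T s) w.
have a'K s w : `|a' s w| <= K by apply: aK; exact: clamp_itv.
pose G (q : (R * Omega) * R) := (a' q.2 q.1.2 + K) * (q.2 <= clamp T q.1.1)%R%:R.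
have mG : measurable_fun setT G.
  apply: measurable_funM; last first.
    apply: measurable_le_indic; first exact: measurable_snd.
    apply: measurableT_comp; first exact: measurable_clamp.
    exact: measurableT_comp measurable_fst measurable_fst.
  apply: measurable_funD => //.
  have mq : measurable_fun setT (fun q : (R * Omega) * R => (q.2, q.1.2)).
    apply: measurable_fun_pair; first exact: measurable_snd.
    exact: measurableT_comp measurable_snd measurable_fst.
  exact: measurableT_comp ma mq.
have a'K0 s w : 0 <= a' s w + K.
  by rewrite -lerBlDr sub0r; have := a'K s w; rewrite ler_norml => /andP[].
have G0 q : 0 <= G q by rewrite mulr_ge0.
have mGE : measurable_fun setT (EFin \o G) by exact/measurable_EFinP.
have := @measurable_integral_on _ _ _ _ R mu `[0, T]%classic (EFin \o G)
  (measurable_itv _) mGE (fun q => _).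
have GE0 q : (0 <= (EFin \o G) q)%E by rewrite lee_fin.
move=> /(_ GE0) mI.
rewrite (_ : (fun p => _) = (fun p : R * Omega =>
   fine (\int[mu]_(s in `[0%R, T]) (G (p, s))%:E)%E - K * clamp T p.1)).
  apply: measurable_funB; last first.
    by apply: measurable_funM => //; exact: measurableT_comp (measurable_clamp T) _.
  exact: measurableT_comp (fine_measurable measurableT) mI.
apply/funext => -[t w] /=.
have /andP[t0 tT] := clamp_itv t T0.
have mas : measurable_fun setT (a' ^~ w).
  exact: measurableT_comp ma (pair2_measurable w).
have K0 : 0 <= K := le_trans (normr_ge0 _) (a'K 0 w).
have -> : \int[mu]_(s in `[0, clamp T t]) a s w = \int[mu]_(s in `[0, clamp T t]) a' s w.
  apply: eq_Rintegral => s; rewrite inE/= in_itv/= => /andP[s0 st].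
  by rewrite /a' clamp_id// s0 (le_trans st).
have -> : (\int[mu]_(s in `[0%R, T]) (G (t, w, s))%:E =
    \int[mu]_(s in `[0%R, clamp T t]) (a' s w + K)%:E)%E.
  rewrite integral_mkcond [RHS]integral_mkcond; apply: eq_integral => s _.
  rewrite /patch /G/= !mem_setE !in_itv/=.
  have [s0|_] := boolP (0 <= s) => //=.
  have [st|_] := boolP (s <= clamp T t); last by rewrite mulr0 if_same.
  by rewrite (le_trans st tT) mulr1.
transitivity (\int[mu]_(s in `[0, clamp T t]) (a' s w + K) - K * clamp T t); last by [].
rewrite RintegralD//; last 2 first.
- exact: (bounded_integrable_itv mas (a'K ^~ w)).
- apply: (@bounded_integrable_itv _ (fun=> K) K) => // x.
  by rewrite ger0_norm.
rewrite Rintegral_cst//= lebesgue_measure_itv/= lte_fin.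
move: t0; rewrite le_eqVlt => /predU1P[<-|->]; last by rewrite -EFinB subr0 addrK.
by rewrite ltxx/= mulr0 addrK.
Qed.

End PrimitiveParameter.

(** * Bounded factors in conditional expectations *)

Section BoundedFactor.
Context {d} {Omega : measurableType d} {R : realType}.
Variables (P : {measure set Omega -> \bar R}) (G : set (set Omega)).
Hypotheses (GM : G `<=` measurable) (Gs : sigma_algebra setT G).

(** Reduction to the nonnegative case: [X] is shifted by [C], and exchanging negative parts turns
    [xi], [eta] into nonnegative [p], [q] with the same difference, hence with equal integrals over
    the sets of [G]. *)
Lemma integral_bounded_factor (xi eta : Omega -> R) (X : Omega -> R) (C : R) :
  P.-integrable setT (EFin \o xi) -> P.-integrable setT (EFin \o eta) ->
  (forall A, G A -> (\int[P]_(w in A) (xi w)%:E = \int[P]_(w in A) (eta w)%:E)%E) ->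
  measurable_fun setT (X : g_sigma_algebraType G -> R) -> (forall w, `|X w| <= C) ->
  (\int[P]_w (X w * xi w)%:E = \int[P]_w (X w * eta w)%:E)%E.
Proof.
move=> ixi ieta H mX XC.
have mxi : measurable_fun setT xi by exact/measurable_EFinP/(measurable_int P).
have meta : measurable_fun setT eta by exact/measurable_EFinP/(measurable_int P).
have XC0 w : 0 <= X w + C.
  by rewrite -lerBlDr sub0r; have := XC w; rewrite ler_norml => /andP[].
have mX' : measurable_fun setT (X : Omega -> R) by exact: sub_measurable_fun mX.
pose p w := xi^\+ w + eta^\- w; pose q w := eta^\+ w + xi^\- w.
have ip : P.-integrable setT (EFin \o p).
  by rewrite /comp/p; under eq_fun do rewrite EFinD; apply: integrableD => //;
    [exact: integrable_funrpos|exact: integrable_funrneg].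
have iq : P.-integrable setT (EFin \o q).
  by rewrite /comp/q; under eq_fun do rewrite EFinD; apply: integrableD => //;
    [exact: integrable_funrpos|exact: integrable_funrneg].
have pq w : p w - q w = xi w - eta w.
  have -> : xi w = xi^\+ w - xi^\- w by rewrite -[in LHS](funrposBneg xi).
  have -> : eta w = eta^\+ w - eta^\- w by rewrite -[in LHS](funrposBneg eta).
  rewrite /p /q; move: (xi^\+ w) (xi^\- w) (eta^\+ w) (eta^\- w) => x y z t; ring.
have p0 w : 0 <= p w by rewrite addr_ge0// ?funrpos_ge0// funrneg_ge0.
have q0 w : 0 <= q w by rewrite addr_ge0// ?funrpos_ge0// funrneg_ge0.
have mp : measurable_fun setT p by exact/measurable_EFinP/(measurable_int P).
have mq : measurable_fun setT q by exact/measurable_EFinP/(measurable_int P).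
have iS (h : Omega -> R) A : measurable A -> P.-integrable setT (EFin \o h) ->
    P.-integrable A (EFin \o h) by move=> mA; exact: integrableS.
have pqA A : <<s G >> A -> (\int[P]_(w in A) (p w)%:E = \int[P]_(w in A) (q w)%:E)%E.
  rewrite sigma_algebra_id// => GA; have mA := GM GA.
  have fq := integrable_fin_num mA (iS _ _ mA iq).
  rewrite -[LHS](subeK _ fq) -integralB_EFin//; [|exact: iS..].
  rewrite (_ : \int[P]_(x in A) _ = \int[P]_(x in A) ((xi x)%:E - (eta x)%:E))%E; last first.
    by apply: eq_integral => w _; rewrite -!EFinB pq.
  rewrite integralB_EFin//; [|exact: iS..].
  rewrite H// subee ?add0e//.
  exact: (integrable_fin_num mA (iS _ _ mA ieta)).
have E : (\int[P]_w ((X w + C) * p w)%:E = \int[P]_w ((X w + C) * q w)%:E)%E.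
  apply: (@eq_integral_sub _ _ _ P G GM p q (fun w => (X w + C)%:E)) => //.
  by apply/measurable_EFinP; exact: measurable_funD.
have bX (h : Omega -> R) : P.-integrable setT (EFin \o h) ->
    P.-integrable setT (EFin \o (fun w => (X w + C) * h w)).
  move=> ih; apply: (le_integrable measurableT _ _ (integrableZl measurableT (C + C) ih)).
    apply/measurable_EFinP; apply: measurable_funM; first exact: measurable_funD.
    exact/measurable_EFinP/(measurable_int P).
  move=> w _ /=; rewrite lee_fin !normrM ler_wpM2r// ger0_norm//.
  by rewrite (le_trans _ (ler_norm _))// lerD2r (le_trans (ler_norm _)).
have ibX (h : Omega -> R) : P.-integrable setT (EFin \o h) ->
    P.-integrable setT (EFin \o (fun w => X w * h w)).
  move=> ih; apply: (le_integrable measurableT _ _ (integrableZl measurableT C ih)).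
    apply/measurable_EFinP; apply: measurable_funM => //.
    exact/measurable_EFinP/(measurable_int P).
  move=> w _ /=; rewrite lee_fin !normrM ler_wpM2r// (le_trans (XC w))//.
  exact: ler_norm.
have D0 : (\int[P]_w ((X w + C) * (xi w - eta w))%:E = 0)%E.
  under eq_integral do rewrite -pq mulrBr EFinB.
  rewrite integralB_EFin//; [|exact: bX..].
  by rewrite E subee//; exact: integrable_fin_num (bX _ iq).
have CE : (\int[P]_w (C * (xi w - eta w))%:E = 0)%E.
  under eq_integral do rewrite mulrBr EFinB.
  rewrite integralB_EFin//; [|by rewrite /comp; under eq_fun do rewrite EFinM; exact: integrableZl..].
  under eq_integral do rewrite EFinM.
  under [X in (_ - X)%E]eq_integral do rewrite EFinM.
  rewrite !integralZl//.
  have GT : G setT by have [G0 GC _] := Gs; rewrite -[setT]setD0; exact: GC.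
  rewrite H// subee// fin_numM//.
  exact: integrable_fin_num.
have : (\int[P]_w (X w * xi w - X w * eta w)%:E = 0)%E.
  transitivity (\int[P]_w ((X w + C) * (xi w - eta w) - C * (xi w - eta w))%:E)%E.
    by apply: eq_integral => w _; congr EFin; ring.
  under eq_integral do rewrite EFinB.
  rewrite integralB_EFin//; last 2 first.
  - apply: (bX (fun w => xi w - eta w)); rewrite /comp.
    by under eq_fun do rewrite EFinB; exact: integrableB.
  - rewrite /comp; under eq_fun do rewrite EFinM EFinB.
    by apply: integrableZl => //; exact: integrableB.
  by rewrite D0 CE subee.
under eq_integral do rewrite EFinB.
rewrite integralB_EFin//; [|exact: ibX..].
move=> E0; rewrite -[LHS](subeK _ (integrable_fin_num measurableT (ibX _ ieta))).
by rewrite [X in (X + _)%E]E0 add0e.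
Qed.

End BoundedFactor.

(** * The first-order condition at hitting times *)

Section StoppedAlgebra.
Context {d} {Omega : measurableType d} {R : realType}.
Variables (P : probability Omega R) (T : R) (F : R -> set (set Omega)).
Hypotheses (T0 : 0 < T)
  (Fs : forall t, 0 <= t <= T -> sigma_algebra setT (F t))
  (FM : forall t, 0 <= t <= T -> F t `<=` measurable)
  (Fmono : forall s t, 0 <= s -> s <= t -> t <= T -> F s `<=` F t).

Let TT : 0 <= T <= T. Proof. by rewrite ltW/=. Qed.

Let F_full t : 0 <= t <= T -> F t setT.
Proof. by move=> /Fs [F0 FC _]; rewrite -[setT]setD0; exact: FC. Qed.

Let F_setC t A : 0 <= t <= T -> F t A -> F t (~` A).
Proof. by move=> /Fs [_ FC _]; rewrite -setTD; exact: FC. Qed.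

Let F_setI t A B : 0 <= t <= T -> F t A -> F t B -> F t (A `&` B).
Proof.
move=> tT FA FB; rewrite -[A `&` B]setCK setCI.
apply: F_setC => //; rewrite -bigcup2E; have [_ _ FU] := Fs tT; apply: FU.
move=> [|[|i]] /=; [exact: F_setC|exact: F_setC|].
by have [] := Fs tT.
Qed.

Lemma stopped_algebra_sigma tau : stopping_time T F tau ->
  sigma_algebra setT (stopped_algebra T F tau).
Proof.
move=> [tauT Ftau]; split.
- split; first by have [] := Fs TT.
  by move=> t tT; rewrite set0I; have [] := Fs tT.
- move=> A [FA At]; split; first by rewrite setTD; exact: F_setC.
  move=> t tT; rewrite (_ : _ `&` _ = [set w | tau w <= t] `&` ~` (A `&` [set w | tau w <= t])).
    by apply: F_setI => //; [exact: Ftau|apply: F_setC => //; exact: At].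
  rewrite setTD; apply/seteqP; split=> w /=; first by move=> [nA wt]; split => // -[].
  by move=> [wt nA]; split => // Aw; exact: nA.
- move=> A HA; split; first by have [_ _ FU] := Fs TT; apply: FU => i; have [] := HA i.
  move=> t tT; rewrite setI_bigcupl; have [_ _ FU] := Fs tT; apply: FU => i.
  by have [_] := HA i; exact.
Qed.

Lemma stopped_algebra_measurable tau : stopped_algebra T F tau `<=` measurable.
Proof. by move=> A [FA _]; exact: (FM TT). Qed.

Lemma measurable_stopping_time tau : stopping_time T F tau ->
  measurable_fun setT (tau : g_sigma_algebraType (stopped_algebra T F tau) -> R).
Proof.
move=> st; have [tauT Ftau] := st; have Ss := stopped_algebra_sigma st.
apply: (measurability (@RGenOInfty.G R)); first exact: RGenOInfty.measurableE.
move=> _ [_ [x ->] <-].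
rewrite setTI (_ : _ @^-1` _ = ~` [set w | tau w <= x]); last first.
  by apply/seteqP; split=> w; rewrite /= in_itv/= andbT real_ltNge ?num_real// => /negP.
apply: measurableC; apply: sub_sigma_algebra.
have leF t : 0 <= t <= T -> F t [set w | tau w <= Num.min x t].
  move=> /andP[t0 tT]; have [x0|x0] := ltP x 0.
    rewrite (_ : [set _ | _] = set0); first by have [] := Fs (t := t); rewrite ?t0.
    apply/seteqP; split=> // w /=; rewrite le_min => /andP[wx _].
    by have /andP[+ _] := tauT w; rewrite leNgt (le_lt_trans wx).
  apply: (Fmono (s := Num.min x t)) => //.
  - by rewrite le_min x0.
  - by rewrite ge_min lexx orbT.
  - by apply: Ftau; rewrite le_min x0 t0/= ge_min tT orbT.
split.
  have := leF T TT; congr (F T _); apply/seteqP; split => w /=; rewrite le_min.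
    by case/andP.
  by move=> ->; have /andP[] := tauT w.
move=> t tT; have := leF t tT; congr (F t _); apply/seteqP.
by split=> w /=; rewrite le_min => /andP.
Qed.

Variable g : R -> Omega -> R.
Hypotheses (ag : adapted T F g) (rg : forall w, rc_path T (g ^~ w)).
Variable u : R.
Local Notation tau w := (htime T (g ^~ w) u).

Let Fhit t : 0 <= t <= T -> F t [set w | u <= g t w].
Proof.
move=> tT; have := ag tT (measurable_itv `[u, +oo[); congr (F t _).
by apply/seteqP; split=> w /=; rewrite in_itv/= andbT.
Qed.

(** The hitting time may equal [T], where the first-order condition says nothing; capping it at [c]
    keeps it strictly below [T]. *)
Lemma stopping_time_hit c : 0 <= c < T -> stopping_time T F (fun w => Num.min (tau w) c).
Proof.
move=> /andP[c0 cT]; split=> [w|t /andP[t0 tT]].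
  apply/andP; split; first by rewrite le_min htime_ge0// ltW.
  by rewrite ge_min (ltW cT) orbT.
have [ct|tc] := leP c t.
  rewrite (_ : [set _ | _] = setT); first by apply: F_full; rewrite t0.
  by apply/seteqP; split=> w //= _; rewrite ge_min ct orbT.
rewrite (_ : [set _ | _] = [set w | u <= g t w]); first by apply: Fhit; rewrite t0.
apply/funext => w /=; rewrite ge_min [c <= t]leNgt tc orbF (htime_le (ltW T0))//.
by rewrite t0 (lt_trans tc).
Qed.

(** On this event the cap has no effect. Its measurability for the capped time allows the
    first-order condition to be localised to it. *)
Lemma stopped_algebra_hit c : 0 <= c < T ->
  stopped_algebra T F (fun w => Num.min (tau w) c) [set w | u <= g c w].
Proof.
move=> /andP[c0 cT]; split.
  by apply: (Fmono (s := c)) => //; [exact: ltW|apply: Fhit; rewrite c0 ltW].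
move=> t /andP[t0 tT]; have tT' : 0 <= t <= T by rewrite t0.
have [ct|tc] := leP c t.
  apply: F_setI => //; last by apply: (stopping_time_hit _).2 => //; rewrite c0.
  by apply: (Fmono (s := c)) => //; apply: Fhit; rewrite c0 ltW.
rewrite (_ : _ `&` _ = [set w | u <= g t w]); first exact: Fhit.
have tT2 : 0 <= t < T by rewrite t0 (lt_trans tc).
apply/seteqP; split=> w /=; rewrite ge_min [c <= t]leNgt tc orbF (htime_le (ltW T0))//.
  by case.
move=> ut; split => //; apply: (le_trans ut).
by have [ndg _] := rg w; apply: ndg; rewrite // ltW.
Qed.

Section FirstOrderCondition.
Variables (m : R -> Omega -> \bar R) (p : R -> Omega -> R) (kk : R -> R).
Hypotheses (m0 : forall t w, 0 <= t <= T -> (0 <= m t w)%E)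
  (p0 : forall t w, 0 <= t <= T -> 0 <= p t w)
  (kk0 : forall s, 0 <= kk s) (mkk : measurable_fun setT kk)
  (foc : forall tau : Omega -> R,
    stopping_time T F tau -> (forall w, tau w < T) ->
    is_cond_exp P (stopped_algebra T F tau)
      (fun w => m (tau w) w) (fun w => (p (tau w) w)%:E)).

Let reached c := [set w | u <= g c w].

Let sigmaE c w : 0 <= c < T -> reached c w -> Num.min (tau w) c = tau w.
Proof. by move=> cT uc; apply/min_idPl; rewrite (htime_le (ltW T0)). Qed.

Let m_reached c : 0 <= c < T -> measurable (reached c).
Proof.
by move=> /andP[c0 cT]; apply: (FM (t := c)); [rewrite c0 ltW|apply: Fhit; rewrite c0 ltW].
Qed.

Let m_marg c : 0 <= c < T -> measurable_fun (reached c) (fun w => (kk (tau w))%:E * m (tau w) w)%E.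
Proof.
move=> cT; have st := stopping_time_hit cT.
have cT' w : Num.min (tau w) c < T by rewrite gt_min (andP cT).2 orbT.
have [/(measurable_int P) mm _ _ _] := foc st cT'.
apply: (eq_measurable_fun (fun w => (kk (Num.min (tau w) c))%:E * m (Num.min (tau w) c) w)%E).
  by move=> w; rewrite inE => rw; rewrite sigmaE.
apply: measurable_funTS; apply: emeasurable_funM => //.
apply/measurable_EFinP; apply: measurableT_comp => //.
exact: (sub_measurable_fun (@stopped_algebra_measurable (fun w => Num.min (tau w) c)) (measurable_stopping_time st)).
Qed.

Let m_price c : 0 <= c < T -> measurable_fun (reached c) (fun w => (kk (tau w) * p (tau w) w)%:E).
Proof.
move=> cT; have st := stopping_time_hit cT.
have cT' w : Num.min (tau w) c < T by rewrite gt_min (andP cT).2 orbT.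
have [_ /(measurable_int P) mm _ _] := foc st cT'.
apply: (eq_measurable_fun (fun w => (kk (Num.min (tau w) c) * p (Num.min (tau w) c) w)%:E)).
  by move=> w; rewrite inE => rw; rewrite sigmaE.
apply: measurable_funTS; apply/measurable_EFinP; apply: measurable_funM => //; last exact/measurable_EFinP.
apply: measurableT_comp => //.
exact: (sub_measurable_fun (@stopped_algebra_measurable (fun w => Num.min (tau w) c)) (measurable_stopping_time st)).
Qed.

(** Where [u] is reached by time [c], the capped time is the hitting time. The indicator of that
    event times [kk] of the capped time is nonnegative and measurable for the stopped algebra, so it
    can be paired with the conditional expectation. *)
Lemma foc_before c : 0 <= c < T ->
  (\int[P]_(w in [set w | (u <= g c w)%R]) ((kk (tau w))%:E * m (tau w) w) =
   \int[P]_(w in [set w | (u <= g c w)%R]) (kk (tau w) * p (tau w) w)%:E)%E.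
Proof.
move=> cT; have st := stopping_time_hit cT.
pose s w := Num.min (tau w) c.
have sT w : 0 <= s w <= T by exact: st.1.
have sT' w : s w < T by rewrite gt_min (andP cT).2 orbT.
have [im ip mp mpE] := foc st sT'.
pose X w := \1_(reached c) w * kk (s w).
have X0 w : 0 <= X w by rewrite mulr_ge0.
have Ss := stopped_algebra_sigma st.
have mX : measurable_fun setT (X : g_sigma_algebraType (stopped_algebra T F s) -> R).
  apply: measurable_funM; last exact: measurableT_comp mkk (measurable_stopping_time st).
  by apply: measurable_indic; apply: sub_sigma_algebra; exact: stopped_algebra_hit.
have mX' := sub_measurable_fun (@stopped_algebra_measurable s) mX.
(* Integrability makes [m (s w) w] finite almost surely; [fine] provides a real density that is
   nonnegative everywhere. *)
pose f w := fine (m (s w) w).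
have f0 w : 0 <= f w by rewrite fine_ge0// m0.
have mf : measurable_fun setT f.
  exact: measurableT_comp (fine_measurable measurableT) (measurable_int P im).
have mp' : measurable_fun setT (fun w => p (s w) w) by exact/measurable_EFinP/(measurable_int P ip).
have p0' w : 0 <= p (s w) w by exact: p0.
have fE : ae_eq P setT (fun w => m (s w) w) (fun w => (f w)%:E).
  have := integrable_ae measurableT im; apply: filterS => w /(_ I) mw _.
  by rewrite fineK.
have E := eq_integral_sub (@stopped_algebra_measurable s) f0 p0' mf mp'.
have {}E : (\int[P]_w ((X w)%:E * (f w)%:E) = \int[P]_w ((X w)%:E * (p (s w) w)%:E))%E.
  apply: (E P (fun w => (X w)%:E)) => //; last by apply/measurable_EFinP.
  move=> A; rewrite sigma_algebra_id// => SA.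
  rewrite -mpE//; apply: ge0_ae_eq_integral => //.
  - exact: (stopped_algebra_measurable SA).
  - exact/measurable_funTS/measurable_EFinP.
  - exact/measurable_funTS/(measurable_int P).
  - by move=> w _; rewrite lee_fin.
  - by move=> w _; apply: m0; exact: sT.
  - by apply: filterS fE => w Hw _; rewrite -Hw.
transitivity (\int[P]_w ((X w)%:E * m (s w) w))%E.
  rewrite integral_mkcond; apply: eq_integral => w _; rewrite patchE /X indicE.
  have [rw|_] := boolP (w \in reached c).
    by rewrite mul1r /s sigmaE//; exact: set_mem rw.
  by rewrite mul0r mul0e.
transitivity (\int[P]_w ((X w)%:E * (f w)%:E))%E.
  apply: ge0_ae_eq_integral => //.
  - apply: emeasurable_funM; last exact: (measurable_int P).
    exact/measurable_EFinP.
  - by apply: emeasurable_funM; apply/measurable_EFinP.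
  - by move=> w _; rewrite mule_ge0// ?lee_fin// m0.
  - by move=> w _; rewrite mule_ge0// ?lee_fin.
  - by apply: filterS fE => w Hw _; rewrite Hw.
rewrite E [RHS]integral_mkcond; apply: eq_integral => w _; rewrite patchE /X indicE.
have [rw|_] := boolP (w \in reached c).
  by rewrite mul1r /s sigmaE//; exact: set_mem rw.
by rewrite mul0r mul0e.
Qed.

Let grid n := T - T / n.+1%:R.

Let grid_itv n : 0 <= grid n < T.
Proof.
rewrite subr_ge0 ltrBlDr ltrDl divr_gt0// andbT ler_pdivrMr//.
by rewrite ler_peMr ?ler1n// ltW.
Qed.

Let hit_bigcup : [set w | tau w < T] = \bigcup_n reached (grid n).
Proof.
apply/seteqP; split=> w /=; last first.
  move=> [n _] un; have := grid_itv n => /andP[_]; apply: le_lt_trans.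
  by rewrite (htime_le (ltW T0)).
move=> tT; pose n := Num.truncn (T / (T - tau w)).
exists n => //; rewrite /reached/= -(htime_le (ltW T0) u (rg w) (grid_itv n)) /grid.
rewrite lerBrDr -lerBrDl ler_pdivrMr// -ler_pdivrMl ?subr_gt0// mulrC.
by rewrite ltW//; apply: truncnS_gt.
Qed.

Lemma measurable_marginal_hit :
  measurable_fun [set w | tau w < T] (fun w => (kk (tau w))%:E * m (tau w) w)%E.
Proof.
rewrite hit_bigcup; apply/measurable_fun_bigcup => n; first exact: m_reached.
exact: m_marg.
Qed.

(** The events that [u] is reached by [grid n] increase to the event that the hitting time is below
    [T], as [grid n] increases to [T]; both sides converge along them. *)
Lemma foc_hit :
  (\int[P]_(w in [set w | (tau w < T)%R]) ((kk (tau w))%:E * m (tau w) w) =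
   \int[P]_(w in [set w | (tau w < T)%R]) (kk (tau w) * p (tau w) w)%:E)%E.
Proof.
have cmono n k : (n <= k)%N -> grid n <= grid k.
  move=> nk; rewrite lerB// ler_pM2l// lef_pV2 ?posrE//.
  by rewrite ler_nat ltnS.
have nd : nondecreasing_seq (fun n => reached (grid n)).
  move=> n k nk; apply/subsetPset => w /= un; apply: (le_trans un).
  have [ndg _] := rg w; have /andP[cn0 _] := grid_itv n; have /andP[_ /ltW ckT] := grid_itv k.
  by apply: ndg => //; exact: cmono.
have H1 : (fun n => \int[P]_(w in reached (grid n)) ((kk (tau w))%:E * m (tau w) w))%E @ \oo -->
    (\int[P]_(w in \bigcup_n reached (grid n)) ((kk (tau w))%:E * m (tau w) w))%E.
  apply: ge0_nondecreasing_set_cvg_integral => //.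
  - by move=> i; exact: m_reached.
  - by move=> i; exact: m_marg.
  - by move=> i w _; rewrite mule_ge0 ?lee_fin// m0// htime_itv// ltW.
have H2 : (fun n => \int[P]_(w in reached (grid n)) (kk (tau w) * p (tau w) w)%:E)%E @ \oo -->
    (\int[P]_(w in \bigcup_n reached (grid n)) (kk (tau w) * p (tau w) w)%:E)%E.
  apply: ge0_nondecreasing_set_cvg_integral => //.
  - by move=> i; exact: m_reached.
  - by move=> i; exact: m_price.
  - by move=> i w _; rewrite lee_fin mulr_ge0// p0// htime_itv// ltW.
rewrite hit_bigcup -(cvg_lim (@ereal_hausdorff R) H1) -(cvg_lim (@ereal_hausdorff R) H2).
by congr (limn _); apply/funext => n; exact: foc_before.
Qed.

End FirstOrderCondition.

End StoppedAlgebra.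

(* Monotonicity needs no measurability, the integral of a nonnegative function
   being a supremum over the simple functions below it. *)
Lemma ge0_le_integral_any {d} {S : measurableType d} {R : realType}
    (m : {measure set S -> \bar R}) (D : set S) (f g : S -> \bar R) :
  (forall x, D x -> 0 <= f x)%E -> (forall x, D x -> f x <= g x)%E ->
  (\int[m]_(x in D) f x <= \int[m]_(x in D) g x)%E.
Proof.
move=> f0 fg.
have g0 x : D x -> (0 <= g x)%E by move=> Dx; rewrite (le_trans (f0 _ Dx))// fg.
rewrite !ge0_integralE//; apply: le_ereal_sup => _ [h hf <-]; exists h => // x.
apply: (le_trans (hf x)); rewrite !patchE; case: ifPn => // /set_mem Dx.
exact: fg.
Qed.

Section DecayContinuous.
Context {R : realType}.
Variables (T : R) (beta : R -> R).
Hypotheses (T0 : 0 <= T) (bc : {within `[0, T], continuous beta})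
  (bpos : forall s, 0 <= s <= T -> 0 < beta s).

Lemma continuous_cdecay : continuous (cdecay T beta).
Proof.
have [m [K [m0 K0 mK]]] := cbeta_bounds T0 bc bpos.
have mb : measurable_fun setT (fun s => - cbeta T beta s).
  by apply: measurable_funN; exact: measurable_cbeta.
have bK x : `|- cbeta T beta x| <= K.
  by rewrite normrN gtr0_norm ?(cbeta_gt0 T0 bpos)//; case/andP: (mK x).
rewrite (_ : cdecay T beta =
    fun s => expR (\int[lebesgue_measure]_(x in `[0, clamp T s]) (- cbeta T beta x))).
  move=> x; apply: continuous_comp; last exact: continuous_expR.
  exact: (continuous_primitive mb bK).
by apply/funext => s; rewrite /cdecay (decay_cbeta T0 bc bpos (clamp_itv s T0)).
Qed.

Lemma decay_right_continuous t : 0 <= t < T -> decay beta 0 @ t^'+ --> decay beta 0 t.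
Proof. exact: clamp_continuous_rc continuous_cdecay t. Qed.

End DecayContinuous.

(** * The envelope of [L] and its running suprema *)

Section Envelope.
Context {d} {Omega : measurableType d} {R : realType}.
Variables (T : R) (beta : R -> R) (eta : R) (L : R -> Omega -> R).
Hypotheses (T0 : 0 <= T) (bc : {within `[0, T], continuous beta})
  (bpos : forall s, 0 <= s <= T -> 0 < beta s)
  (L0 : forall t w, 0 <= t <= T -> 0 <= L t w)
  (LB : forall w, has_ubound [set L t w | t in `[0, T]]).

#[local] Opaque decay.

(** The process [A] of the overview: division by the decay from 0 is multiplication by exp(int_0^q
    beta). *)
Definition envelope t (w : Omega) :=
  Num.max eta (sup [set L q w / decay beta 0 q | q in `[0, t]]).

Let dec_anti s t : 0 <= s -> s <= t -> t <= T -> decay beta 0 t <= decay beta 0 s.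
Proof.
move=> s0 st tT; have := integral_beta_decay T0 bc bpos s0 st tT.
have sT : 0 <= s <= T by rewrite s0 (le_trans st).
have tT' : 0 <= t <= T by rewrite (le_trans s0).
rewrite /cdecay (clamp_id sT) (clamp_id tT') => E; rewrite -subr_ge0 -E; apply: Rintegral_ge0 => x _.
by rewrite mulr_ge0// ltW// ?cdecay_gt0// cbeta_gt0.
Qed.

(** [sup] is a true supremum for bounded sets only. The bound divides by the decay at [T], the
    smallest on [[0, T]]. *)
Let scaled_ub w t : 0 <= t <= T -> has_ubound [set L q w / decay beta 0 q | q in `[0, t]].
Proof.
move=> /andP[t0 tT]; have [B HB] := LB w; exists (B / decay beta 0 T) => _ [q + <-].
rewrite /= in_itv/= => /andP[q0 qt]; have qT := le_trans qt tT.
have Lq : 0 <= L q w <= B.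
  by apply/andP; split; [apply: L0; rewrite q0|apply: HB; exists q => //; rewrite /= in_itv/= q0].
have := decay_gt0 beta 0 q; have := decay_gt0 beta 0 T; have := dec_anti q0 qT (lexx T).
move: (decay beta 0 q) (decay beta 0 T) => x y yx y0 x0; case/andP: Lq => Lq0 LqB.
by apply: ler_pM => //; [rewrite invr_ge0 ltW|rewrite lef_pV2].
Qed.

Lemma envelope_ge_eta t w : eta <= envelope t w.
Proof. by rewrite le_max lexx. Qed.

Lemma envelope_ub q t w : 0 <= q -> q <= t -> t <= T ->
  L q w / decay beta 0 q <= envelope t w.
Proof.
move=> q0 qt tT; rewrite le_max; apply/orP; right.
apply: ub_le_sup; first by apply: scaled_ub; rewrite (le_trans q0).
by exists q => //; rewrite /= in_itv/= q0.
Qed.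

Lemma envelope_gt t w x : eta <= x -> 0 <= t -> x < envelope t w ->
  exists q, [/\ 0 <= q, q <= t & x < L q w / decay beta 0 q].
Proof.
move=> ex t0; rewrite lt_max ltNge ex/= => /sup_gt[].
  by exists (L 0 w / decay beta 0 0), 0 => //=; rewrite in_itv/= lexx.
by move=> _ [q + <-] xq; rewrite /= in_itv/= => /andP[q0 qt]; exists q.
Qed.

Lemma envelope_mono s t w : 0 <= s -> s <= t -> t <= T -> envelope s w <= envelope t w.
Proof.
move=> s0 st tT; rewrite leNgt; apply/negP => lt_ts.
have [q [q0 qs]] := envelope_gt (envelope_ge_eta t w) s0 lt_ts.
by apply/negP; rewrite -leNgt envelope_ub// (le_trans qs).
Qed.

Lemma levelE t w : level beta eta L t w = decay beta 0 t * envelope t w.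
Proof. by []. Qed.

Let run_el q t w : 0 <= q -> q <= t -> t <= T ->
  L q w * decay beta q t = decay beta 0 t * (L q w / decay beta 0 q).
Proof. by move=> q0 qt tT; rewrite (decayE T0 bc)//; ring. Qed.

Let run_ub a t w : 0 <= a -> a <= t -> t <= T ->
  ubound [set L q w * decay beta q t | q in `[a, t]] (level beta eta L t w).
Proof.
move=> a0 at_ tT _ [q + <-]; rewrite /= in_itv/= => /andP[aq qt].
rewrite run_el ?(le_trans a0)// levelE ler_pM2l ?decay_gt0//.
by rewrite envelope_ub// (le_trans a0).
Qed.

Let run_mem a q t w : a <= q -> q <= t ->
  [set L q w * decay beta q t | q in `[a, t]] (L q w * decay beta q t).
Proof. by move=> aq qt; exists q => //; rewrite /= in_itv/= aq. Qed.

Lemma running_sup_ge0 a t w : 0 <= a -> a <= t -> t <= T -> 0 <= running_sup beta L a t w.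
Proof.
move=> a0 at_ tT; apply: (@le_trans _ _ (L a w * decay beta a t)).
  by rewrite mulr_ge0 ?(ltW (decay_gt0 _ _ _))// L0// a0 (le_trans at_).
apply: ub_le_sup; first by exists (level beta eta L t w); exact: run_ub.
exact: run_mem.
Qed.

Lemma running_sup_le_level a t w : 0 <= a -> a <= t -> t <= T ->
  running_sup beta L a t w <= level beta eta L t w.
Proof.
move=> a0 at_ tT; apply: ge_sup; last exact: run_ub.
by exists (L a w * decay beta a t); exact: run_mem.
Qed.

(** Before [a] no scaled value exceeds [x], and by time [t] the envelope does; so values close to
    the envelope are taken in [[a, t]]. *)
Lemma running_sup_eq_level a t w x : 0 <= a -> a <= t -> t <= T ->
  eta <= x -> (forall q, 0 <= q < a -> L q w / decay beta 0 q <= x) ->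
  x < envelope t w -> running_sup beta L a t w = level beta eta L t w.
Proof.
move=> a0 at_ tT ex before xt; apply/eqP; rewrite eq_le running_sup_le_level//=.
rewrite levelE leNgt; apply/negP => lt_run.
(* A scaled value above [z] is taken at some time [q]: exceeding [x] forces [a <= q], and exceeding
   the rescaled running supremum is then absurd. *)
pose z := Num.max x (running_sup beta L a t w / decay beta 0 t).
have zt : z < envelope t w by rewrite gt_max xt/= ltr_pdivrMr ?decay_gt0// mulrC.
have ez : eta <= z by rewrite le_max ex.
have [q [q0 qt]] := envelope_gt ez (le_trans a0 at_) zt.
rewrite gt_max => /andP[xq]; rewrite ltr_pdivrMr ?decay_gt0// [ltRHS]mulrC.
apply/negP; rewrite -leNgt -run_el//.
have aq : a <= q.
  by rewrite leNgt; apply/negP => qa; have := before q; rewrite q0 qa leNgt xq => /(_ isT).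
apply: ub_le_sup; first by exists (level beta eta L t w); exact: run_ub.
exact: run_mem.
Qed.

Lemma envelope_rc_path w : right_continuous_paths T (level beta eta L) ->
  rc_path T (envelope ^~ w).
Proof.
move=> rl; split=> [s t s0 st tT|t /andP[t0 tT]]; first exact: envelope_mono.
have rd : decay beta 0 @ t^'+ --> decay beta 0 t.
  by apply: (decay_right_continuous T0 bc bpos); rewrite t0.
have rl' : (fun s => level beta eta L s w) @ t^'+ --> level beta eta L t w.
  by apply: rl; rewrite t0.
have envE s : envelope s w = level beta eta L s w * (decay beta 0 s)^-1.
  by rewrite levelE mulrC mulKf// gt_eqF// decay_gt0.
rewrite envE (_ : envelope ^~ w = fun s => level beta eta L s w * (decay beta 0 s)^-1); last first.
  by apply/funext => s; exact: envE.
apply: cvgM => //; apply: cvgV => //.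
by rewrite gt_eqF// decay_gt0.
Qed.

(** If the envelope still equalled [u] at [t], it would be constant between the hitting time and
    [t], hence equal to [u] at a rational time in between. *)
Lemma running_sup_hit_eq_level u t w : right_continuous_paths T (level beta eta L) ->
  eta <= u -> u <= envelope T w ->
  (forall q : rat, 0 <= (ratr q : R) <= T -> envelope (ratr q) w <> u) ->
  htime T (envelope ^~ w) u < t -> t <= T ->
  running_sup beta L (htime T (envelope ^~ w) u) t w = level beta eta L t w.
Proof.
move=> rl eu uT generic tau_t tT; have rA := envelope_rc_path w rl.
have tau0 := htime_ge0 T0 (envelope ^~ w) u.
apply: (@running_sup_eq_level _ _ _ u) => //; first exact: ltW.
  move=> q /andP[q0 qtau]; apply: (@le_trans _ _ (envelope q w)).
    by apply: envelope_ub => //; rewrite (le_trans (ltW qtau))// htime_leT.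
  by apply: ltW; exact: (lt_htime T0 rA q0 qtau).
have u_tau : u <= envelope (htime T (envelope ^~ w) u) w by exact: (htime_reached T0 rA uT).
have tau_le := envelope_mono w tau0 (ltW tau_t) tT.
rewrite lt_neqAle (le_trans u_tau tau_le) andbT; apply/eqP => E.
have [q /=] := rat_in_itvoo tau_t; rewrite in_itv/= => /andP[tau_q qt].
have q0 := le_trans tau0 (ltW tau_q); have qT := le_trans (ltW qt) tT.
apply: (generic q); first by rewrite q0.
apply/le_anti/andP; split; first by rewrite E; exact: envelope_mono (ltW qt) tT.
exact: le_trans u_tau (envelope_mono w tau0 (ltW tau_q) qT).
Qed.

(** A scaled value above [u] is positive and so is not taken at [T], where [L] vanishes: [u] is
    reached strictly before [T]. *)
Lemma envelope_hit_lt u w : right_continuous_paths T (level beta eta L) ->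
  L T w = 0 -> 0 <= u -> eta <= u -> u < envelope T w ->
  htime T (envelope ^~ w) u < T.
Proof.
move=> rl LT u0 eu uT; have rA := envelope_rc_path w rl.
have [q [q0 qT uq]] := envelope_gt eu T0 uT.
have {}qT : q < T.
  rewrite lt_neqAle qT andbT; apply/eqP => qE; move: uq.
  by rewrite qE LT mul0r ltNge u0.
apply: (@le_lt_trans _ _ q) => //; rewrite (htime_le T0 u rA) ?q0//.
by rewrite (le_trans (ltW uq))// envelope_ub// ltW.
Qed.

Section Marginals.
Variables (f : R -> R -> R -> R) (U : R -> Omega -> R).
Hypotheses (A1 : condA1 T f).
Local Notation mu := (@lebesgue_measure R).

(* Differs from [marginal_utility] by the level in place of the running supremum
   of [L] from [a] on; these agree after a hitting time of the envelope. *)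
Definition level_marginal (a : R) (w : Omega) : \bar R :=
  (\int[mu]_(t in `[a, T])
    (expR (\int[mu]_(z in `[0%R, t]) d_u f z (level beta eta L z w) (U z w))
     * d_y f t (level beta eta L t w) (U t w) * theta_kernel beta t a)%:E)%E.

Hypothesis eta0 : 0 <= eta.

Lemma level_ge0 t w : 0 <= level beta eta L t w.
Proof. by rewrite levelE mulr_ge0 ?(ltW (decay_gt0 _ _ _))// (le_trans eta0)// envelope_ge_eta. Qed.

Let theta_ge0 t a : 0 <= a <= T -> 0 <= theta_kernel beta t a.
Proof. by move=> aT; rewrite mulr_ge0 ?(ltW (decay_gt0 _ _ _))// ltW// bpos. Qed.

Let prod_ge0 x t y u a : 0 <= t <= T -> 0 <= y -> 0 <= a <= T ->
  (0 <= (expR x * d_y f t y u * theta_kernel beta t a)%:E)%E.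
Proof.
move=> tT y0 aT; rewrite lee_fin; apply: mulr_ge0; last exact: theta_ge0.
by apply: mulr_ge0; [exact: expR_ge0|exact: (d_y_ge0 A1)].
Qed.

Lemma marginal_utility_ge0 a w : 0 <= a <= T ->
  (0 <= marginal_utility T f beta eta L U a w)%E.
Proof.
move=> aT; apply: integral_ge0 => t; rewrite /= in_itv/= => /andP[at_ tT].
have /andP[a0 _] := aT; have tT' : 0 <= t <= T by rewrite (le_trans a0).
by apply: prod_ge0 => //; exact: running_sup_ge0.
Qed.

Lemma level_marginal_le a w : 0 <= a <= T ->
  (level_marginal a w <= marginal_utility T f beta eta L U a w)%E.
Proof.
move=> aT; have /andP[a0 _] := aT.
apply: ge0_le_integral_any => t; rewrite /= in_itv/= => /andP[at_ tT];
  have tT' : 0 <= t <= T by rewrite (le_trans a0).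
  by apply: prod_ge0 => //; exact: level_ge0.
rewrite lee_fin; apply: ler_wpM2r; first exact: theta_ge0.
apply: ler_wpM2l; first exact: expR_ge0.
apply: (d_y_decr A1) => //; first exact: running_sup_ge0.
exact: running_sup_le_level.
Qed.

Lemma marginal_utility_le a w : 0 <= a <= T ->
  measurable_fun `[a, T] (fun t =>
    (expR (\int[mu]_(z in `[0%R, t]) d_u f z (level beta eta L z w) (U z w))
     * d_y f t (level beta eta L t w) (U t w) * theta_kernel beta t a)%:E) ->
  (forall t, a < t <= T -> running_sup beta L a t w = level beta eta L t w) ->
  (marginal_utility T f beta eta L U a w <= level_marginal a w)%E.
Proof.
move=> aT; have /andP[a0 _] := aT; rewrite /level_marginal /marginal_utility.
set h := (fun t => (_ * theta_kernel beta t a)%:E) => mh runE.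
set g := (fun t => (_ * theta_kernel beta t a)%:E).
have g0 t : `[a, T]%classic t -> (0 <= g t)%E.
  rewrite /= in_itv/= => /andP[at_ tT]; have tT' : 0 <= t <= T by rewrite (le_trans a0).
  by apply: prod_ge0 => //; exact: running_sup_ge0.
have h0 t : `[a, T]%classic t -> (0 <= h t)%E.
  rewrite /= in_itv/= => /andP[at_ tT]; have tT' : 0 <= t <= T by rewrite (le_trans a0).
  by apply: prod_ge0 => //; exact: level_ge0.
(* At [t = a] itself the running supremum may differ from the level; [h] is modified at this one
   point. *)
pose h' t := if t == a then g a else h t.
have -> : (\int[mu]_(t in `[a, T]) h t = \int[mu]_(t in `[a, T]) h' t)%E.
  apply: ge0_ae_eq_integral => //.
  - apply: measurable_fun_if.
    + exact: measurable_itv.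
    + by apply: measurable_fun_eqr; [exact: measurable_id|exact: measurable_cst].
    + exact: measurable_cst.
    + by apply: measurable_funS mh; [exact: measurable_itv|exact: subIsetl].
  - by move=> t tT; rewrite /h'; case: ifPn => _; [apply: g0; rewrite /= in_itv/= lexx; case/andP: aT|exact: h0].
  - exists [set a]; split => //; first exact: lebesgue_measure_set1.
    move=> t /= /not_implyP[_] ht; apply: contrapT => /eqP ta; apply: ht.
    by rewrite /h' (negbTE ta).
apply: ge0_le_integral_any => // t tT; rewrite /h'; case: ifPn => [/eqP -> //|ta].
move: tT; rewrite /= in_itv/= => /andP[at_ tT].
by rewrite /g /h runE// tT lt_neqAle eq_sym ta at_.
Qed.

End Marginals.

End Envelope.

(** * Benefit and cost of a plan *)

Section HitTonelli.
Context {R : realType}.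
Variables (T : R) (g : R -> R) (a0 : R) (k W : R -> R).
Hypotheses (T0 : 0 <= T) (rg : rc_path T g) (k0 : forall s, 0 <= k s)
  (mk : measurable_fun setT k) (W0 : forall t, 0 <= W t) (mW : measurable_fun setT W).
Local Notation mu := (@lebesgue_measure R).

(** For [u <= g T], the conditions [u <= g t] and [htime T g u <= t] coincide; Tonelli then
    exchanges time and level. *)
Lemma integral_hit :
  (\int[mu]_(t in `[0%R, T]) ((W t)%:E * \int[mu]_(u in `]a0, g t]) (k (htime T g u))%:E) =
   \int[mu]_(u in `]a0, g T])
     ((k (htime T g u))%:E * \int[mu]_(t in `[htime T g u, T]) (W t)%:E))%E.
Proof.
have mt := measurable_htime_path T0 rg.
have mkt : measurable_fun setT (fun u => k (htime T g u)) by exact: measurableT_comp.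
pose F (p : R * R) := (W p.1 * k (htime T g p.2) * (htime T g p.2 <= p.1)%R%:R)%:E.
have mF : measurable_fun setT F.
  apply/measurable_EFinP; apply: measurable_funM; first apply: measurable_funM.
  - exact: measurableT_comp mW measurable_fst.
  - exact: measurableT_comp mkt measurable_snd.
  - apply: measurable_le_indic; last exact: measurable_fst.
    exact: measurableT_comp mt measurable_snd.
have F0 p : (0 <= F p)%E by rewrite lee_fin !mulr_ge0.
transitivity (\int[mu]_(t in `[0%R, T]) \int[mu]_(u in `]a0, g T]) F (t, u))%E.
  apply: eq_integral => t; rewrite inE /= in_itv/= => tT.
  have /andP[t0 tT'] := tT.
  rewrite -ge0_integralZl//; last 3 first.
  - by apply: measurable_funTS; exact/measurable_EFinP.
  - by move=> u _; rewrite lee_fin.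
  - by rewrite lee_fin.
  rewrite integral_mkcond [RHS]integral_mkcond; apply: eq_integral => u _.
  rewrite !patchE /F/= !mem_setE !in_itv/=; case: (ltP a0 u) => //= _.
  have [uT|uT] := leP u (g T).
    rewrite (htime_le_level T0 rg tT uT); case: (u <= g t); first by rewrite mulr1.
    by rewrite mulr0.
  rewrite leNgt (le_lt_trans _ uT)//.
  by have [ndg _] := rg; apply: ndg.
rewrite tonelli_on//; apply: eq_integral => u; rewrite inE /= in_itv/= => /andP[_ uT].
rewrite -ge0_integralZl//; last 3 first.
- by apply: measurable_funTS; exact/measurable_EFinP.
- by move=> t _; rewrite lee_fin.
- by rewrite lee_fin.
rewrite [LHS]integral_mkcond [RHS]integral_mkcond; apply: eq_integral => t _.
rewrite !patchE /F/= !mem_setE !in_itv/=.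
have [tT|_] := leP t T; last by rewrite !andbF.
rewrite !andbT; have [tau_t|_] := leP (htime T g u) t.
  by rewrite (le_trans (htime_ge0 T0 g u) tau_t) mulr1 mulrC.
by rewrite mulr0 if_same.
Qed.

End HitTonelli.

Section Budget.
Context {d} {Omega : measurableType d} {R : realType}.
Variables (P : probability Omega R) (T : R) (F : R -> set (set Omega)).
Hypotheses (T0 : 0 < T)
  (Fs : forall t, 0 <= t <= T -> sigma_algebra setT (F t))
  (FM : forall t, 0 <= t <= T -> F t `<=` measurable)
  (Fmono : forall s t, 0 <= s -> s <= t -> t <= T -> F s `<=` F t).
Variables (f : R -> R -> R -> R) (beta : R -> R) (eta K : R).
Hypotheses (A1 : condA1 T f) (fB : borel_aggregator T f)
  (fK : forall s y u u', 0 <= s <= T -> 0 <= y -> `|f s y u - f s y u'| <= K * `|u - u'|)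
  (bc : {within `[0, T], continuous beta})
  (bpos : forall s, 0 <= s <= T -> 0 < beta s) (eta0 : 0 <= eta).
Variables (L U : R -> Omega -> R).
Hypotheses (L0 : forall t w, 0 <= t <= T -> 0 <= L t w)
  (LB : forall w, has_ubound [set L t w | t in `[0, T]])
  (LT : forall w, L T w = 0)
  (al : adapted T F (level beta eta L)) (rl : right_continuous_paths T (level beta eta L))
  (aU : adapted T F U) (rU : right_continuous_paths T U).
Local Notation mu := (@lebesgue_measure R).
Local Notation lv := (level beta eta L).
Local Notation b := (cbeta T beta).
Local Notation dec := (cdecay T beta).

Let T0' : 0 <= T. Proof. exact: ltW. Qed.

Definition felicity_discount t w :=
  expR (\int[mu]_(z in `[0, clamp T t]) d_u f z (lv z w) (U z w)).

Definition felicity_weight t w :=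
  felicity_discount t w * d_y f (clamp T t) (lv (clamp T t) w) (U (clamp T t) w).

#[local] Opaque decay.

Let lv0 t w : 0 <= lv t w. Proof. exact: level_ge0. Qed.

Lemma measurable_level : measurable_fun setT (fun p : R * Omega => lv (clamp T p.1) p.2).
Proof.
apply: (measurable_right_continuous (X := lv) T0' _ rl).
by move=> s sT; exact: (adapted_measurable FM al).
Qed.

Lemma measurable_utility : measurable_fun setT (fun p : R * Omega => U (clamp T p.1) p.2).
Proof.
apply: (measurable_right_continuous (X := U) T0' _ rU).
by move=> s sT; exact: (adapted_measurable FM aU).
Qed.

Let mclamp : measurable_fun setT (fun p : R * Omega => clamp T p.1).
Proof. exact: measurableT_comp (measurable_clamp T) measurable_fst. Qed.

Let cT (p : R * Omega) : 0 <= clamp T p.1 <= T. Proof. exact: clamp_itv. Qed.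

Lemma measurable_d_u_path : measurable_fun setT (fun p : R * Omega =>
  d_u f (clamp T p.1) (lv (clamp T p.1) p.2) (U (clamp T p.1) p.2)).
Proof.
apply: (measurable_d_u A1 mclamp measurable_level measurable_utility cT _ fB).
by move=> p; exact: lv0.
Qed.

Lemma d_u_path_bound s w : 0 <= s <= T -> `|d_u f s (lv s w) (U s w)| <= K.
Proof. by move=> sT; apply: (d_u_bound A1) => // u u'; exact: fK. Qed.

Lemma measurable_felicity_discount :
  measurable_fun setT (fun p : R * Omega => felicity_discount p.1 p.2).
Proof.
apply: measurableT_comp => //.
exact: (@measurable_primitive_param _ Omega R T
  (fun z w => d_u f z (lv z w) (U z w)) K T0' measurable_d_u_path d_u_path_bound).
Qed.

Lemma measurable_felicity_weight :
  measurable_fun setT (fun p : R * Omega => felicity_weight p.1 p.2).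
Proof.
apply: measurable_funM; first exact: measurable_felicity_discount.
apply: (measurable_d_y A1 mclamp measurable_level measurable_utility cT _ fB).
by move=> p; exact: lv0.
Qed.

Lemma felicity_weight_ge0 t w : 0 <= felicity_weight t w.
Proof. by rewrite mulr_ge0 ?expR_ge0// (d_y_ge0 A1) ?clamp_itv. Qed.

Let W t w := felicity_weight t w * dec t.

Let W0 t w : 0 <= W t w.
Proof. by rewrite mulr_ge0 ?felicity_weight_ge0// ltW// cdecay_gt0. Qed.

Let mW : measurable_fun setT (fun p : R * Omega => W p.1 p.2).
Proof.
apply: measurable_funM; first exact: measurable_felicity_weight.
exact: measurableT_comp (measurable_cdecay T0' bc bpos) measurable_fst.
Qed.

Let mWw w : measurable_fun setT (W ^~ w).
Proof. exact: measurableT_comp mW (pair2_measurable w). Qed.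

Let bd_ge0 a : 0 <= b a / dec a.
Proof. by rewrite divr_ge0// ltW// ?cdecay_gt0// (cbeta_gt0 T0' bpos). Qed.

Let level_marginal_integrand a t w : 0 <= a -> a <= t -> t <= T ->
  expR (\int[mu]_(z in `[0%R, t]) d_u f z (lv z w) (U z w)) *
    d_y f t (lv t w) (U t w) * theta_kernel beta t a = b a / dec a * W t w.
Proof.
move=> a0 at_ tT; rewrite (theta_kernelE T0' bc bpos)//.
rewrite /W /felicity_weight /felicity_discount clamp_id ?tT ?(le_trans a0)//.
move: (expR _) (d_y _ _ _ _) (b a) (dec t) (dec a) => *; ring.
Qed.

Lemma level_marginalE a w : 0 <= a <= T ->
  (level_marginal T beta eta L f U a w =
   (b a / dec a)%:E * \int[mu]_(t in `[a, T]) (W t w)%:E)%E.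
Proof.
move=> /andP[a0 aT].
have mWa : measurable_fun `[a, T] (fun t => (W t w)%:E).
  by apply: measurable_funTS; apply/measurable_EFinP; exact: mWw.
transitivity (\int[mu]_(t in `[a, T]) ((b a / dec a)%:E * (W t w)%:E))%E.
  apply: eq_integral => t; rewrite inE/= in_itv/= => /andP[at_ tT].
  by rewrite level_marginal_integrand.
apply: ge0_integralZl => //; last by rewrite lee_fin; exact: bd_ge0.
by move=> t _; rewrite lee_fin; exact: W0.
Qed.

Variables (M : R) (psi : R -> Omega -> R).
Hypotheses (M0 : 0 <= M) (psi0 : forall t w, 0 <= psi t w)
  (mpsi : measurable_fun setT (fun p : R * Omega => psi (clamp T p.1) p.2))
  (foc : forall tau : Omega -> R, stopping_time T F tau -> (forall w, tau w < T) ->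
    is_cond_exp P (stopped_algebra T F tau)
      (fun w => marginal_utility T f beta eta L U (tau w) w)
      (fun w => (M * psi (tau w) w)%:E)).

Section TimeChangedPlan.
Variables (g : R -> Omega -> R) (a0 : R) (k : R -> R).
Hypotheses (ag : adapted T F g) (rg : forall w, rc_path T (g ^~ w))
  (k0 : forall s, 0 <= k s) (mk : measurable_fun setT k).
Local Notation tau w u := (htime T (g ^~ w) u).

Let tauT w u : 0 <= tau w u <= T. Proof. exact: htime_itv. Qed.

Let mtau : measurable_fun setT (fun p : Omega * R => tau p.1 p.2).
Proof.
apply: (measurableT_comp (f := fun p : R * Omega => htime T (g ^~ p.2) p.1)
  _ (@measurable_swap _ _ Omega R)).
by apply: measurable_htime => // t tT; exact: (adapted_measurable FM ag).
Qed.

Let mkt : measurable_fun setT (fun p : Omega * R => k (tau p.1 p.2)).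
Proof. exact: measurableT_comp. Qed.

Let mgT : measurable_fun setT (fun p : Omega * R => ((p.2 <= g T p.1)%R%:R : R)).
Proof.
apply: measurable_le_indic; first exact: measurable_snd.
apply: measurableT_comp measurable_fst; apply: (adapted_measurable FM ag).
by rewrite T0' lexx.
Qed.

Let benefit (p : Omega * R) : \bar R :=
  (((p.2 <= g T p.1)%R%:R * k (tau p.1 p.2))%:E *
   level_marginal T beta eta L f U (tau p.1 p.2) p.1)%E.

Let price (p : Omega * R) : \bar R :=
  ((p.2 <= g T p.1)%R%:R * (k (tau p.1 p.2) * psi (tau p.1 p.2) p.1))%:E.

Let lm_ge0 a w : 0 <= a <= T -> (0 <= level_marginal T beta eta L f U a w)%E.
Proof.
move=> aT; rewrite level_marginalE// mule_ge0 ?lee_fin ?bd_ge0//.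
by apply: integral_ge0 => t _; rewrite lee_fin.
Qed.

Let benefit_ge0 p : (0 <= benefit p)%E.
Proof. by rewrite mule_ge0 ?lee_fin ?mulr_ge0// lm_ge0. Qed.

Let price_ge0 p : (0 <= price p)%E.
Proof. by rewrite lee_fin !mulr_ge0. Qed.

Let mpsit : measurable_fun setT (fun p : Omega * R => psi (tau p.1 p.2) p.1).
Proof.
have mq : measurable_fun setT (fun p : Omega * R => (tau p.1 p.2, p.1)).
  by apply: measurable_fun_pair => //; exact: measurable_fst.
rewrite (_ : (fun p => _) = (fun q : R * Omega => psi (clamp T q.1) q.2)
    \o (fun p : Omega * R => (tau p.1 p.2, p.1))).
  exact: measurableT_comp mpsi mq.
by apply/funext => p /=; rewrite clamp_id.
Qed.

Let mprice : measurable_fun setT price.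
Proof.
by apply/measurable_EFinP; apply: measurable_funM => //; apply: measurable_funM.
Qed.

Let mlm : measurable_fun setT
  (fun p : Omega * R => level_marginal T beta eta L f U (tau p.1 p.2) p.1).
Proof.
(* The random lower limit is turned into an indicator, so that measurability in the parameters
   follows from Tonelli. *)
pose G (q : (Omega * R) * R) := ((tau q.1.1 q.1.2 <= q.2)%R%:R * W q.2 q.1.1)%:E.
have mG : measurable_fun setT G.
  apply/measurable_EFinP; apply: measurable_funM.
    apply: measurable_le_indic; last exact: measurable_snd.
    exact: measurableT_comp mtau measurable_fst.
  have mq : measurable_fun setT (fun q : (Omega * R) * R => (q.2, q.1.1)).
    apply: measurable_fun_pair; first exact: measurable_snd.
    exact: measurableT_comp measurable_fst measurable_fst.
  exact: measurableT_comp mW mq.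
have G0 q : (0 <= G q)%E by rewrite lee_fin mulr_ge0.
have := @measurable_integral_on _ _ _ _ R mu `[0, T]%classic G (measurable_itv _) mG G0.
move=> mI; rewrite (_ : (fun p => _) = (fun p : Omega * R =>
    ((b (tau p.1 p.2) / dec (tau p.1 p.2))%:E * \int[mu]_(t in `[0%R, T]) G (p, t))%E)).
  apply: emeasurable_funM => //; apply/measurable_EFinP; apply: measurable_funM.
    exact: measurableT_comp (measurable_cbeta T0' bc) mtau.
  apply: measurable_inv_gt0; first by move=> p; exact: cdecay_gt0.
  exact: measurableT_comp (measurable_cdecay T0' bc bpos) mtau.
apply/funext => p; rewrite level_marginalE//; congr (_ * _)%E.
rewrite [LHS]integral_mkcond [RHS]integral_mkcond; apply: eq_integral => t _.
rewrite !patchE /G/= !mem_setE !in_itv/=.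
have [tT|_] := leP t T; last by rewrite !andbF.
rewrite !andbT; have [tau_t|_] := leP (tau p.1 p.2) t.
  by rewrite (le_trans (htime_ge0 T0' _ _) tau_t) mul1r.
by rewrite mul0r if_same.
Qed.

Let mbenefit : measurable_fun setT benefit.
Proof.
by apply: emeasurable_funM => //; apply/measurable_EFinP; exact: measurable_funM.
Qed.

Let mI (h : Omega * R -> \bar R) : measurable_fun setT h -> (forall p, 0 <= h p)%E ->
  measurable_fun setT (fun u => \int[P]_w h (w, u))%E.
Proof.
move=> mh h0; apply: (@measurable_integral_on _ _ _ _ R P setT
  (fun q : R * Omega => h (q.2, q.1))) => //.
exact: measurableT_comp mh (@measurable_swap _ _ R Omega).
Qed.

Lemma expected_benefitE :
  (\int[P]_w \int[mu]_(t in `[0%R, T]) ((W t w)%:E *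
     \int[mu]_(u in `]a0, g t w]) (satisfaction_density T beta k (tau w u))%:E) =
   \int[mu]_(u in `]a0, +oo[) \int[P]_w benefit (w, u))%E.
Proof.
transitivity (\int[P]_w \int[mu]_(u in `]a0, +oo[) benefit (w, u))%E; last first.
  exact: (tonelli_on P mu measurableT (measurable_itv `]a0, +oo[) mbenefit benefit_ge0).
apply: eq_integral => w _.
rewrite (integral_hit a0 T0' (rg w) (satisfaction_density_ge0 T0' bpos k0)
  (measurable_satisfaction_density T0' bc bpos mk) (W0^~ w) (mWw w)).
rewrite [LHS]integral_mkcond [RHS]integral_mkcond; apply: eq_integral => u _.
rewrite !patchE /benefit/= !mem_setE !in_itv/= andbT.
case: (a0 < u) => //=; case: (u <= g T w) => /=; last by rewrite mul0r mul0e.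
by rewrite mul1r level_marginalE// muleA.
Qed.

Lemma expected_priceE :
  (\int[P]_w \int[mu]_(u in `]a0, g T w]) (k (tau w u) * psi (tau w u) w)%:E =
   \int[mu]_(u in `]a0, +oo[) \int[P]_w price (w, u))%E.
Proof.
transitivity (\int[P]_w \int[mu]_(u in `]a0, +oo[) price (w, u))%E; last first.
  exact: (tonelli_on P mu measurableT (measurable_itv `]a0, +oo[) mprice price_ge0).
apply: eq_integral => w _.
rewrite [LHS]integral_mkcond [RHS]integral_mkcond; apply: eq_integral => u _.
rewrite !patchE /price/= !mem_setE !in_itv/= andbT.
by case: (a0 < u) => //=; case: (u <= g T w); rewrite ?mul1r ?mul0r.
Qed.

Let hit_le w u : tau w u < T -> u <= g T w.
Proof.
move=> tT; have t0 := htime_ge0 T0' (g ^~ w) u.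
have : u <= g (tau w u) w by rewrite -(htime_le T0' u (rg w)) ?t0.
by move=> /le_trans; apply; have [ndg _] := rg w; apply: ndg => //; exact: ltW.
Qed.

(** A level whose hitting time is [T] brings no benefit: its marginal is an integral over the single
    point [T]. *)
Let benefit_hit u : (\int[P]_w benefit (w, u) =
  \int[P]_(w in [set w | (tau w u < T)%R])
     ((k (tau w u))%:E * level_marginal T beta eta L f U (tau w u) w))%E.
Proof.
rewrite [RHS]integral_mkcond; apply: eq_integral => w _.
rewrite patchE /benefit/=; case: ifPn => [/set_mem/= tT|/negP tN].
  by rewrite hit_le// mul1r.
have -> : tau w u = T.
  apply/le_anti; rewrite htime_leT//= leNgt; apply/negP => tT.
  by apply: tN; exact: mem_set.
rewrite level_marginalE ?T0' ?lexx// (integral_Sset1 T) ?mule0//.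
by move=> t /=; rewrite in_itv/= => ?; apply/esym/le_anti.
Qed.

Let m0 t w : 0 <= t <= T -> (0 <= marginal_utility T f beta eta L U t w)%E.
Proof. exact: marginal_utility_ge0. Qed.

Let Mpsi0 t w : 0 <= t <= T -> 0 <= M * psi t w.
Proof. by move=> _; exact: mulr_ge0. Qed.

Let foc_u u := foc_hit T0 Fs FM Fmono ag rg u m0 Mpsi0 k0 mk foc.

(** Two losses occur: the level marginal is at most the marginal utility, and consumption at time
    [T] has a price but no benefit. *)
Let benefit_le u : (\int[P]_w benefit (w, u) <= M%:E * \int[P]_w price (w, u))%E.
Proof.
rewrite benefit_hit.
apply: (@le_trans _ _ (\int[P]_(w in [set w | (tau w u < T)%R])
    ((k (tau w u))%:E * marginal_utility T f beta eta L U (tau w u) w))%E).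
  apply: ge0_le_integral_any => w _; first by rewrite mule_ge0 ?lee_fin// lm_ge0.
  apply: lee_wpmul2l; first by rewrite lee_fin.
  exact: level_marginal_le.
rewrite foc_u -ge0_integralZl//; last exact: measurableT_comp mprice (pair2_measurable u).
rewrite [leLHS]integral_mkcond; apply: ge0_le_integral_any => w _; rewrite patchE.
  by case: ifP => // _; rewrite lee_fin mulr_ge0// mulr_ge0.
case: ifPn => [/set_mem/= /hit_le uT|_]; last by rewrite mule_ge0 ?lee_fin// !mulr_ge0.
by rewrite /price/= uT mul1r lee_fin mulrCA.
Qed.

Lemma expected_benefit_le :
  (\int[P]_w \int[mu]_(t in `[0%R, T]) ((W t w)%:E *
     \int[mu]_(u in `]a0, g t w]) (satisfaction_density T beta k (tau w u))%:E) <=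
   M%:E * \int[P]_w \int[mu]_(u in `]a0, g T w]) (k (tau w u) * psi (tau w u) w)%:E)%E.
Proof.
rewrite expected_benefitE expected_priceE -ge0_integralZl//; last 2 first.
- by apply: measurable_funTS; exact: mI.
- by move=> u _; apply: integral_ge0.
by apply: ge0_le_integral_any => u _; [exact: integral_ge0|exact: benefit_le].
Qed.

Section ExactBenefit.
Variable E : set (Omega * R).
Hypotheses (mE : measurable E) (E0 : forall w, mu [set u | E (w, u)] = 0%E)
  (exact_marginal : forall w u, a0 < u -> u <= g T w -> ~ E (w, u) ->
    tau w u < T /\
    (marginal_utility T f beta eta L U (tau w u) w <=
     level_marginal T beta eta L f U (tau w u) w)%E).

Let mEx w : measurable [set u | E (w, u)].
Proof.
have := @pair1_measurable _ _ Omega R w measurableT E mE.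
by rewrite setTI.
Qed.

Let mEy u : measurable [set w | E (w, u)].
Proof.
have := @pair2_measurable _ _ Omega R u measurableT E mE.
by rewrite setTI.
Qed.

(** The sections of [E] at fixed [w] are null. Tonelli carries this over to the sections at almost
    every level, which is where the first-order condition is used. *)
Let section_null : {ae mu, forall u, P [set w | E (w, u)] = 0%E}.
Proof.
pose h (p : Omega * R) := (\1_E p)%:E : \bar R.
have mh : measurable_fun setT h by apply/measurable_EFinP; exact: measurable_indic.
have h0 p : (0 <= h p)%E by rewrite lee_fin.
have I1 w : (\int[mu]_u h (w, u) = 0)%E.
  rewrite -(E0 w) -[in RHS](setIT [set u | E (w, u)]) -integral_indic//.
  exact: mEx.
have I2 u : (\int[P]_w h (w, u) = P [set w | E (w, u)])%E.
  transitivity (\int[P]_w (\1_[set w | E (w, u)] w)%:E)%E; first by [].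
  by rewrite integral_indic ?setIT//; exact: mEy.
have := tonelli_on P mu measurableT measurableT mh h0.
under eq_integral do rewrite I1.
rewrite integral0 => /esym/eqP; under eq_integral do rewrite I2.
move=> /eqP E00.
have mP : measurable_fun setT (fun u => P [set w | E (w, u)]).
  under eq_fun do rewrite -I2.
  apply: (@measurable_integral_on _ _ _ _ R P setT (fun q : R * Omega => h (q.2, q.1))) => //.
  exact: measurableT_comp mh (@measurable_swap _ _ R Omega).
have /(ae_eq_integral_abs mu measurableT mP) : (\int[mu]_u `|P [set w | E (w, u)]| = 0)%E.
  by rewrite -[RHS]E00; apply: eq_integral => u _; rewrite gee0_abs.
by apply: filterS => u; exact.
Qed.

Let benefit_ge u : a0 < u -> P [set w | E (w, u)] = 0%E ->
  (M%:E * \int[P]_w price (w, u) <= \int[P]_w benefit (w, u))%E.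
Proof.
move=> a0u Eu0; have mtu := measurableT_comp mtau (pair2_measurable u).
have mD : measurable [set w | tau w u < T] by exact: measurable_set_lt.
have mpu := measurableT_comp mprice (pair2_measurable u).
have mkp : measurable_fun setT (fun w => (k (tau w u) * (M * psi (tau w u) w))%:E).
  apply/measurable_EFinP; apply: measurable_funM.
    exact: measurableT_comp mkt (pair2_measurable u).
  by apply: measurable_funM => //; exact: measurableT_comp mpsit (pair2_measurable u).
have aeE Q : (forall w, ~ E (w, u) -> Q w) -> {ae P, forall w, Q w}.
  move=> EQ; exists [set w | E (w, u)]; split => //.
  by move=> w /= nQ; apply: contrapT => nE; apply: nQ; exact: EQ.
rewrite -ge0_integralZl//; apply: (@le_trans _ _ (\int[P]_(w in [set w | (tau w u < T)%R])
    (k (tau w u) * (M * psi (tau w u) w))%:E)%E).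
  rewrite [leRHS]integral_mkcond; apply: ae_ge0_le_integral => //.
  - by move=> w _; rewrite mule_ge0.
  - by apply: emeasurable_funM.
  - by move=> w _; rewrite patchE; case: ifP => // _; rewrite lee_fin !mulr_ge0.
  - apply/(measurable_restrictT _ _).1 => //; exact: measurable_funTS.
  - apply: aeE => w nE _; rewrite patchE /price/=.
    have [uT|_] := boolP (u <= g T w); last first.
      rewrite mul0r mule0; case: ifP => // _; by rewrite lee_fin !mulr_ge0.
    have [tT _] := exact_marginal a0u uT nE.
    by rewrite mem_set// mul1r -EFinM mulrCA.
rewrite benefit_hit; apply: (@le_trans _ _ (\int[P]_(w in [set w | (tau w u < T)%R])
    ((k (tau w u))%:E * marginal_utility T f beta eta L U (tau w u) w))%E).
  by rewrite (foc_u u).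
apply: ae_ge0_le_integral.
- exact: mD.
- by move=> w _; rewrite mule_ge0 ?lee_fin ?m0.
- exact: (measurable_marginal_hit (p := fun t w => M * psi t w) T0 Fs FM Fmono ag rg mk foc).
- by move=> w _; rewrite mule_ge0 ?lee_fin ?lm_ge0.
- apply: measurable_funTS; apply: emeasurable_funM.
    by apply/measurable_EFinP; exact: measurableT_comp mkt (pair2_measurable u).
  exact: measurableT_comp mlm (pair2_measurable u).
- apply: aeE => w nE tT; apply: lee_wpmul2l; first by rewrite lee_fin.
  by have [] := exact_marginal a0u (hit_le tT) nE.
Qed.

Lemma expected_benefit_ge :
  (M%:E * \int[P]_w \int[mu]_(u in `]a0, g T w]) (k (tau w u) * psi (tau w u) w)%:E <=
   \int[P]_w \int[mu]_(t in `[0%R, T]) ((W t w)%:E *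
     \int[mu]_(u in `]a0, g t w]) (satisfaction_density T beta k (tau w u))%:E))%E.
Proof.
rewrite expected_benefitE expected_priceE -ge0_integralZl//; last 2 first.
- by apply: measurable_funTS; exact: mI.
- by move=> u _; apply: integral_ge0.
apply: ae_ge0_le_integral => //.
- by move=> u _; rewrite mule_ge0//; apply: integral_ge0.
- by apply: measurable_funTS; apply: emeasurable_funM => //; exact: mI.
- by move=> u _; apply: integral_ge0.
- by apply: measurable_funTS; exact: mI.
- have [N [mN N0 sub]] := section_null; exists N; split => // u /= nQ.
  apply: sub => /= Eu; apply: nQ; rewrite in_itv/= andbT => a0u.
  exact: benefit_ge.
Qed.

End ExactBenefit.

End TimeChangedPlan.

Section LevelPlanBenefit.
Variable k : R -> R.
Hypotheses (k0 : forall s, 0 <= k s) (mk : measurable_fun setT k).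
Local Notation env := (envelope beta eta L).
Local Notation sig w u := (htime T (env ^~ w) u).

Lemma envelope_adapted : adapted T F env.
Proof.
move=> t tT; apply/(measurable_wrtP _ (Fs tT)).
have /(measurable_wrtP _ (Fs tT)) mlt := al tT.
rewrite (_ : env t = fun w => (decay beta 0 t)^-1 * lv t w).
  exact: measurable_funM.
by apply/funext => w; rewrite levelE mulKf// gt_eqF// decay_gt0.
Qed.

Let renv w : rc_path T (env ^~ w).
Proof. exact: envelope_rc_path. Qed.

Let menv t : 0 <= t <= T -> measurable_fun setT (env t).
Proof. by move=> tT; exact: (adapted_measurable FM envelope_adapted tT). Qed.

(* If [u] is neither the terminal value nor a value taken at a rational time,
   the envelope exceeds [u] immediately after reaching it. *)
Let exceptional : set (Omega * R) :=
  [set p | env T p.1 = p.2] `|`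
  \bigcup_(q : rat) [set p | 0 <= (ratr q : R) <= T /\ env (ratr q) p.1 = p.2].

Let measurable_exceptional : measurable exceptional.
Proof.
have H t : 0 <= t <= T -> measurable [set p : Omega * R | env t p.1 = p.2].
  move=> tT.
  have m1 : measurable_fun setT (fun p : Omega * R => env t p.1).
    exact: measurableT_comp (menv tT) measurable_fst.
  have := @measurable_fun_eqr _ (Omega * R)%type R setT _ _ m1 measurable_snd measurableT [set true] I.
  by rewrite setTI; congr measurable; apply/seteqP; split => p /= /eqP.
apply: measurableU; first by apply: H; rewrite T0' lexx.
apply: bigcupT_measurable_rat => q; have [qT|qN] := boolP (0 <= (ratr q : R) <= T).
  rewrite (_ : [set _ | _] = [set p : Omega * R | env (ratr q) p.1 = p.2]); first exact: H.
  by apply/seteqP; split=> p /= => [[]|].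
by rewrite (_ : [set _ | _] = set0)//; apply/seteqP; split=> p //= [].
Qed.

(** Each path excludes countably many levels, indexed by the rationals and one more symbol for time
    [T]. *)
Let exceptional_null w : mu [set u | exceptional (w, u)] = 0%E.
Proof.
apply: countable_lebesgue_measure0.
pose value (o : option rat) := if o is Some q then env (ratr q) w else env T w.
apply: (@sub_countable _ _ _ (\bigcup_(o : option rat) [set value o])).
  apply: subset_card_le => u [/= uE|[q _ [_ /= uE]]]; first by exists None.
  by exists (Some q).
by apply: bigcup_countable; [exact: countableP|move=> o _; exact: countable1].
Qed.

Lemma expected_level_benefit_ge :
  (M%:E * \int[P]_w \int[mu]_(u in `]eta, env T w]) (k (sig w u) * psi (sig w u) w)%:E <=
   \int[P]_w \int[mu]_(t in `[0%R, T]) ((W t w)%:E *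
     \int[mu]_(u in `]eta, env t w]) (satisfaction_density T beta k (sig w u))%:E))%E.
Proof.
apply: (expected_benefit_ge envelope_adapted renv k0 mk
  measurable_exceptional exceptional_null) => w u eu uT nE.
have u_lt : u < env T w.
  by rewrite lt_neqAle uT andbT; apply/eqP => uE; apply: nE; left.
have sT : sig w u < T by apply: envelope_hit_lt => //; [exact: le_trans eta0 (ltW eu)|exact: ltW].
split => //; have s0 := htime_ge0 T0' (env ^~ w) u.
apply: marginal_utility_le => //; first by rewrite s0 ltW.
- apply: (eq_measurable_fun (fun t => (b (sig w u) / dec (sig w u) * W t w)%:E)).
    move=> t; rewrite inE/= in_itv/= => /andP[st tT].
    by rewrite level_marginal_integrand.
  by apply: measurable_funTS; apply/measurable_EFinP; exact: measurable_funM.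
- move=> t /andP[st tT]; apply: running_sup_hit_eq_level => //; first exact: ltW.
  by move=> q qT qE; apply: nE; right; exists q.
Qed.

End LevelPlanBenefit.


End Budget.

(** * Discounting, and the cost under the two measures *)

Section Discount.
Context {d} {Omega : measurableType d} {R : realType}.
Variables (T : R) (F : R -> set (set Omega)) (r : R -> Omega -> R) (Kr : R).
Hypotheses (T0 : 0 < T)
  (Fs : forall t, 0 <= t <= T -> sigma_algebra setT (F t))
  (rP : progressive T F r) (rK : forall t w, 0 <= t <= T -> `|r t w| <= Kr).
Local Notation mu := (@lebesgue_measure R).

Let TT : 0 <= T <= T. Proof. by rewrite ltW/=. Qed.

Lemma measurable_progressive (X : R -> Omega -> R) t : progressive T F X -> 0 <= t <= T ->
  measurable_fun setT (fun p : R * g_sigma_algebraType (F t) => X (clamp t p.1) p.2).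
Proof.
move=> Xp tT; have /andP[t0 _] := tT.
apply: (measurable_comp (F := `[0, t] `*` setT)
  (f := fun p : R * g_sigma_algebraType (F t) => X p.1 p.2)
  (g := fun p : R * g_sigma_algebraType (F t) => (clamp t p.1, p.2))).
- by apply: measurableX => //; exact: measurable_itv.
- by move=> _ [p _ <-]; split => //=; rewrite in_itv/= clamp_itv.
- exact: Xp.
- apply: measurable_fun_pair; last exact: measurable_snd.
  exact: measurableT_comp (measurable_clamp t) measurable_fst.
Qed.

Lemma measurable_discount_at t : 0 <= t <= T -> measurable_fun setT
  (fun p : R * g_sigma_algebraType (F t) => discount r (clamp t p.1) p.2).
Proof.
move=> tT; have /andP[t0 tT'] := tT; apply: measurableT_comp => //.
apply: measurable_funN.
have rK' s w : 0 <= s <= t -> `|r s w| <= Kr.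
  by move=> /andP[s0 st]; apply: rK; rewrite s0 (le_trans st).
exact: (@measurable_primitive_param _ (g_sigma_algebraType (F t)) R t r Kr t0
  (measurable_progressive rP tT) rK').
Qed.

Lemma discount_adapted : adapted T F (discount r).
Proof.
move=> t tT; apply/(measurable_wrtP _ (Fs tT)); have /andP[t0 _] := tT.
have tt : clamp t t = t by rewrite clamp_id// t0 lexx.
have := measurableT_comp (measurable_discount_at tT)
  (@pair1_measurable _ _ R (g_sigma_algebraType (F t)) t).
by rewrite /comp /= tt.
Qed.

Let mr w : measurable_fun setT (fun s => r (clamp T s) w).
Proof. exact: measurableT_comp (measurable_progressive rP TT)
  (@pair2_measurable _ _ R (g_sigma_algebraType (F T)) w). Qed.

Let rK' w s : `|r (clamp T s) w| <= Kr.
Proof. by apply: rK; rewrite clamp_itv// ltW. Qed.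

Let discountE t w : 0 <= t <= T ->
  discount r t w = expR (- \int[mu]_(s in `[0, t]) r (clamp T s) w).
Proof.
move=> /andP[t0 tT]; congr (expR (- _)); apply: eq_Rintegral => s.
by rewrite inE/= in_itv/= => /andP[s0 st]; rewrite clamp_id// s0 (le_trans st).
Qed.

Lemma discount_right_continuous : right_continuous_paths T (discount r).
Proof.
move=> w t tT; apply: (clamp_continuous_rc (T := T)) => //.
rewrite (_ : (fun t => _) = fun t => expR (- \int[mu]_(s in `[0, clamp T t]) r (clamp T s) w)).
  move=> x; apply: continuous_comp; last exact: continuous_expR.
  by apply: continuousN; exact: (continuous_primitive (mr w) (rK' w) (ltW T0)).
by apply/funext => x; rewrite discountE// clamp_itv// ltW.
Qed.

Lemma discount_bound t w : 0 <= t <= T -> 0 <= discount r t w <= expR (Kr * T).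
Proof.
move=> tT; rewrite expR_ge0 discountE// ler_expR.
apply: (le_trans (ler_norm _)); rewrite normrN.
exact: (Rintegral_bound (mr w) (rK' w) tT).
Qed.

End Discount.

Section Cost.
Context {d} {Omega : measurableType d} {R : realType}.
Variables (P : probability Omega R) (T : R) (F : R -> set (set Omega)).
Hypotheses (T0 : 0 < T)
  (Fs : forall t, 0 <= t <= T -> sigma_algebra setT (F t))
  (FM : forall t, 0 <= t <= T -> F t `<=` measurable)
  (Fmono : forall s t, 0 <= s -> s <= t -> t <= T -> F s `<=` F t).
Variables (r : R -> Omega -> R) (Kr : R).
Hypotheses (rP : progressive T F r) (rK : forall t w, 0 <= t <= T -> `|r t w| <= Kr).
Variables (Pstar : probability (g_sigma_algebraType (F T)) R) (Z : R -> Omega -> R).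
Hypothesis ZP : density_process P Pstar Z.
Variables (g : R -> Omega -> R) (a0 : R) (k : R -> R) (Kk : R).
Hypotheses (ag : adapted T F g) (rg : forall w, rc_path T (g ^~ w))
  (k0 : forall s, 0 <= k s) (kK : forall s, k s <= Kk)
  (mk : measurable_fun setT k)
  (rk : forall t, 0 <= t < T -> k @ t^'+ --> k t).
Local Notation mu := (@lebesgue_measure R).
Local Notation tau w u := (htime T (g ^~ w) u).

Let TT : 0 <= T <= T. Proof. by rewrite ltW/=. Qed.
Let FTM := FM TT.
Let aZ : adapted T F Z. Proof. by have [] := ZP. Qed.
Let rZ : right_continuous_paths T Z. Proof. by have [_ []] := ZP. Qed.
Let Z0 t w : 0 <= Z t w. Proof. by have [_ _ + _] := ZP; exact. Qed.
Let ZPE t A : 0 <= t <= T -> F t A -> (Pstar A = \int[P]_(w in A) (Z t w)%:E)%E.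
Proof. by have [_ _ _] := ZP; exact. Qed.

Let Zmart t A : 0 <= t <= T -> F t A ->
  (\int[P]_(w in A) (Z T w)%:E = \int[P]_(w in A) (Z t w)%:E)%E.
Proof.
move=> tT FA; transitivity (Pstar A); last exact: ZPE.
have /andP[t0 tT'] := tT; apply/esym/(ZPE TT).
exact: Fmono FA.
Qed.

Let mZ t : 0 <= t <= T -> measurable_fun setT (Z t).
Proof. by move=> tT; exact: (adapted_measurable FM aZ tT). Qed.

Let F_full : F T setT.
Proof. by have [F0 FC _] := Fs TT; rewrite -[setT]setD0; exact: FC. Qed.

Let iZ : P.-integrable setT (fun w => (Z T w)%:E).
Proof.
apply/integrableP; split; first by apply/measurable_EFinP; exact: mZ.
under eq_integral do rewrite gee0_abs ?lee_fin//.
by rewrite -ZPE// probability_setT ltry.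
Qed.

(** The discount factor is bounded on [[0, T]]; clamping extends the bound to all times, as
    [optional_sampling] requires. *)
Let h t w := discount r (clamp T t) w * k t.

Let tau_itv w u : 0 <= tau w u <= T. Proof. by apply: htime_itv; exact: ltW. Qed.

Let h_tau w u : h (tau w u) w = discount r (tau w u) w * k (tau w u).
Proof. by rewrite /h clamp_id. Qed.

Let ah : adapted T F h.
Proof.
move=> t tT; apply/(measurable_wrtP _ (Fs tT)); apply: measurable_funM => //.
have /(measurable_wrtP _ (Fs tT)) := discount_adapted Fs rP rK tT.
by rewrite /= clamp_id.
Qed.

Let rh : right_continuous_paths T h.
Proof.
move=> w t tT; apply: cvgM; last exact: rk.
have /andP[t0 tT'] := tT; rewrite clamp_id ?t0 ?ltW//.
apply: (cvg_trans _ (discount_right_continuous T0 rP rK (w := w) tT)).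
apply: near_eq_cvg; near=> s; rewrite clamp_id//.
have ts : t < s by near: s; exact: nbhs_right_gt.
have sT : s < T by near: s; exact: nbhs_right_lt.
by rewrite (le_trans t0 (ltW ts)) ltW.
Unshelve. all: by end_near. Qed.

Let h_bound t w : 0 <= h t w <= expR (Kr * T) * Kk.
Proof.
have /andP[d0 dK] := discount_bound T0 rP rK w (clamp_itv t (ltW T0)).
by rewrite mulr_ge0//= ler_pM.
Qed.

Let mtau : measurable_fun setT (fun p : Omega * R => tau p.1 p.2).
Proof.
apply: (measurableT_comp (f := fun p : R * Omega => htime T (g ^~ p.2) p.1)
  _ (@measurable_swap _ _ Omega R)).
by apply: measurable_htime => // [|t tT]; [exact: ltW|exact: (adapted_measurable FM ag)].
Qed.

Let mtauF : measurable_fun setT (fun p : g_sigma_algebraType (F T) * R => tau p.1 p.2).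
Proof.
apply: (measurableT_comp (f := fun p : R * g_sigma_algebraType (F T) => htime T (g ^~ p.2) p.1)
  _ (@measurable_swap _ _ (g_sigma_algebraType (F T)) R)).
apply: measurable_htime => // [|t /andP[t0 tT]]; first exact: ltW.
exact: (adapted_measurable_at Fmono ag t0 tT (lexx T)).
Qed.

Let phi (p : Omega * R) := (p.2 <= g T p.1)%R%:R * h (tau p.1 p.2) p.1.

Let phi0 p : 0 <= phi p.
Proof. by rewrite mulr_ge0//; have /andP[] := h_bound (tau p.1 p.2) p.1. Qed.

(** [Pstar] is defined on [F T] only, so its integrands have to be measurable for that
    sigma-algebra. *)
Let mphiF : measurable_fun setT (phi : g_sigma_algebraType (F T) * R -> R).
Proof.
apply: measurable_funM.
  apply: measurable_le_indic; first exact: measurable_snd.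
  by apply: measurableT_comp measurable_fst; apply/(measurable_wrtP _ (Fs TT)); exact: ag.
apply: measurable_funM; last exact: measurableT_comp mk mtauF.
have mq : measurable_fun setT (fun p : g_sigma_algebraType (F T) * R => (tau p.1 p.2, p.1)).
  by apply: measurable_fun_pair => //; exact: measurable_fst.
exact: measurableT_comp (measurable_discount_at rP rK TT) mq.
Qed.

Let mphi : measurable_fun setT phi.
Proof.
have mid : measurable_fun setT (id : Omega -> g_sigma_algebraType (F T)).
  by move=> _ A mA; rewrite setTI; apply: FTM; rewrite -(sigma_algebra_id (Fs TT)); exact: mA.
have mi : measurable_fun setT (fun p : Omega * R => ((p.1 : g_sigma_algebraType (F T)), p.2)).
  apply: (@measurable_fun_pair _ _ _ (Omega * R)%type (g_sigma_algebraType (F T)) R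
    (fun p => p.1) (fun p => p.2)); last exact: measurable_snd.
  exact: measurableT_comp mid measurable_fst.
exact: measurableT_comp mphiF mi.
Qed.

Let mpsi : measurable_fun setT (fun p : Omega * R => Z (tau p.1 p.2) p.1).
Proof.
have mq : measurable_fun setT (fun p : Omega * R => (tau p.1 p.2, p.1)).
  by apply: measurable_fun_pair => //; exact: measurable_fst.
rewrite (_ : (fun p => _) = (fun q : R * Omega => Z (clamp T q.1) q.2)
    \o (fun p : Omega * R => (tau p.1 p.2, p.1))).
  by apply: measurableT_comp mq; exact: (measurable_right_continuous (X := Z) (ltW T0) mZ rZ).
by apply/funext => p /=; rewrite clamp_id.
Qed.

Lemma expected_cost :
  (\int[Pstar]_w \int[mu]_(u in `]a0, g T w])
     (discount r (tau w u) w * k (tau w u))%:E =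
   \int[P]_w \int[mu]_(u in `]a0, g T w])
     (k (tau w u) * (discount r (tau w u) w * Z (tau w u) w))%:E)%E.
Proof.
pose X (w : g_sigma_algebraType (F T)) := (\int[mu]_(u in `]a0, +oo[) (phi (w, u))%:E)%E.
have mX : measurable_fun setT X.
  apply: (@measurable_integral_on _ _ _ _ R mu `]a0, +oo[%classic
    (fun p : g_sigma_algebraType (F T) * R => (phi p)%:E)).
  - exact: measurable_itv.
  - by apply/measurable_EFinP.
  - by move=> p; rewrite lee_fin.
have X0 w : (0 <= X w)%E by apply: integral_ge0 => u _; rewrite lee_fin.
transitivity (\int[Pstar]_w X w)%E.
  apply: eq_integral => w _; rewrite /X [LHS]integral_mkcond [RHS]integral_mkcond.
  apply: eq_integral => u _; rewrite !patchE /phi/= !mem_setE !in_itv/= andbT.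
  case: (a0 < u) => //=; case: (u <= g T w); last by rewrite mul0r.
  by rewrite mul1r h_tau.
rewrite (integral_sub_density (P := P) FTM (Z0 T) (mZ TT) _ mX X0); last first.
  by move=> A; rewrite (sigma_algebra_id (Fs TT)); exact: ZPE.
transitivity (\int[P]_w \int[mu]_(u in `]a0, +oo[) (phi (w, u) * Z T w)%:E)%E.
  apply: eq_integral => w _; rewrite muleC -ge0_integralZl//; last 3 first.
  - apply: measurable_funTS; apply/measurable_EFinP.
    exact: measurableT_comp mphi (pair1_measurable w).
  - by move=> u _; rewrite lee_fin.
  - by rewrite lee_fin.
  by apply: eq_integral => u _; rewrite EFinM muleC.
have mphiZ : measurable_fun setT (fun p => (phi p * Z T p.1)%:E).
  apply/measurable_EFinP; apply: measurable_funM => //.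
  exact: measurableT_comp (mZ TT) measurable_fst.
have phiZ0 p : (0 <= (phi p * Z T p.1)%:E)%E by rewrite lee_fin mulr_ge0.
have mphiZt : measurable_fun setT (fun p => (phi p * Z (tau p.1 p.2) p.1)%:E).
  by apply/measurable_EFinP; exact: measurable_funM.
have phiZt0 p : (0 <= (phi p * Z (tau p.1 p.2) p.1)%:E)%E by rewrite lee_fin mulr_ge0.
rewrite (tonelli_on P mu measurableT (measurable_itv `]a0, +oo[) mphiZ phiZ0).
(* With the level outermost, optional sampling at each fixed [u] replaces [Z T] by [Z] at the
   hitting time of [u]. *)
transitivity (\int[mu]_(u in `]a0, +oo[) \int[P]_w (phi (w, u) * Z (tau w u) w)%:E)%E.
  apply: eq_integral => u _.
  rewrite (optional_sampling T0 Fs FM Fmono aZ Z0 Zmart ag rg u rZ iZ ah rh h_bound).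
  by apply: eq_integral => w _; rewrite /stopped /phi/= mulrA.
rewrite -(tonelli_on P mu measurableT (measurable_itv `]a0, +oo[) mphiZt phiZt0).
apply: eq_integral => w _; rewrite [LHS]integral_mkcond [RHS]integral_mkcond.
apply: eq_integral => u _; rewrite !patchE /phi/= !mem_setE !in_itv/= andbT.
case: (a0 < u) => //=; case: (u <= g T w); last by rewrite !mul0r.
by rewrite mul1r h_tau mulrA [k _ * _]mulrC.
Qed.

End Cost.

Section TimeChangedSatisfaction.
Context {d} {Omega : measurableType d} {R : realType}.
Variables (T : R) (beta : R -> R) (eta : R).
Hypotheses (T0 : 0 <= T) (bc : {within `[0, T], continuous beta})
  (bpos : forall s, 0 <= s <= T -> 0 < beta s).
Variables (C : R -> Omega -> R) (w : Omega) (g : R -> R) (a0 : R) (k : R -> R) (K : R).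
Hypothesis tc : time_changed T g a0 k K (C ^~ w).
Local Notation mu := (@lebesgue_measure R).
Local Notation dec := (cdecay T beta).
Local Notation sd := (satisfaction_density T beta k).

Let sd_bound : exists K', forall s, sd s <= K'.
Proof.
have [m [Kb [m0 Kb0 mK]]] := cbeta_bounds T0 bc bpos.
have mb : measurable_fun setT (fun s => - cbeta T beta s).
  by apply: measurable_funN; exact: measurable_cbeta.
have bK x : `|- cbeta T beta x| <= Kb.
  by rewrite normrN gtr0_norm ?(cbeta_gt0 T0 bpos)//; case/andP: (mK x).
have K0 : 0 <= K := le_trans (tc_ge0 tc 0) (tc_le tc 0).
exists (K * (Kb * expR (Kb * T))) => s.
have dec_inv : (dec s)^-1 <= expR (Kb * T).
  rewrite /cdecay (decay_cbeta T0 bc bpos (clamp_itv s T0)) -expRN ler_expR.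
  have := Rintegral_bound mb bK (clamp_itv s T0).
  by apply: le_trans; rewrite -normrN ler_norm.
have b0 := cbeta_gt0 T0 bpos s; have d0 := cdecay_gt0 T beta s.
have /andP[_ bKb] := mK s.
apply: ler_pM; [exact: (tc_ge0 tc)| |exact: (tc_le tc)|].
  by rewrite divr_ge0// ltW.
by apply: ler_pM => //; [exact: ltW|rewrite invr_ge0 ltW].
Qed.

(** The density is bounded, hence the level integral finite, and the formula for the satisfaction
    holds in extended reals without [fine]. *)
Lemma satisfaction_gain t : 0 <= t <= T ->
  ((satisfaction T beta eta C t w - eta * decay beta 0 t)%:E =
   (dec t)%:E * \int[mu]_(u in `]a0, g t]) (sd (htime T g u))%:E)%E.
Proof.
move=> tT; have [K' sdK] := sd_bound.
have sd0 := satisfaction_density_ge0 T0 bpos (tc_ge0 tc).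
have msd := measurable_satisfaction_density T0 bc bpos (tc_meas tc).
have fin : (\int[mu]_(u in `]a0, g t]) (sd (htime T g u))%:E)%E \is a fin_num.
  apply: integrable_fin_num => //.
  apply: (bounded_integrable_itv (K := K') (a := fun u => sd (htime T g u))).
    exact: measurableT_comp msd (measurable_htime_path T0 (tc_rc tc)).
  by move=> u; rewrite ger0_norm.
rewrite /satisfaction addrC addKr /dC_measure.
by rewrite (time_changed_satisfaction T0 bc bpos tc tT) EFinM fineK.
Qed.

Lemma plan_cost (h : R -> R) : measurable_fun setT (fun s => h (clamp T s)) ->
  (forall s, 0 <= h s) ->
  (\int[dC_measure T C w]_(t in `[0%R, T]) (h t)%:E =
   \int[mu]_(u in `]a0, g T]) (k (htime T g u) * h (htime T g u))%:E)%E.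
Proof.
move=> mh h0; have TT : 0 <= T <= T by rewrite T0 lexx.
rewrite (time_changed_integral T0 tc TT); last 2 first.
- apply: (eq_measurable_fun (fun s => (h (clamp T s))%:E)).
    by move=> s; rewrite inE/= in_itv/= => sT; rewrite clamp_id.
  by apply: measurable_funTS; exact/measurable_EFinP.
- by move=> s _; rewrite lee_fin.
by apply: eq_integral => u _; rewrite -EFinM mulrC.
Qed.

End TimeChangedSatisfaction.

(** * Recursive utilities *)

Section PathMeasure.
Context {d} {Omega : measurableType d} {R : realType}.
Variables (P : probability Omega R) (T : R).

(** The product measure is named so that it can be declared finite and become a factor of a further
    product in [utility_average]. *)
Definition path_measure : set (measurableTypeR R * Omega)%type -> \bar R :=
  (lebesgue_upto T \x P)%E.

HB.instance Definition _ := Measure.on path_measure.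

Let path_measure_fin : fin_num_fun path_measure.
Proof.
apply: lty_fin_num_fun.
suff : ((lebesgue_upto T \x P) (setT `*` setT) < +oo)%E by rewrite setXTT.
rewrite product_measure1E// [X in (_ * X)%E]probability_setT mule1.
exact: (fin_num_fun_lty (fin_num_measure (lebesgue_upto T : {finite_measure set _ -> \bar R}))).
Qed.

HB.instance Definition _ := Measure_isFinite.Build _ _ _ path_measure path_measure_fin.

End PathMeasure.

Section RecursiveUtility.
Context {d} {Omega : measurableType d} {R : realType}.
Variables (P : probability Omega R) (T : R) (F : R -> set (set Omega)).
Hypotheses (T0 : 0 < T)
  (Fs : forall t, 0 <= t <= T -> sigma_algebra setT (F t))
  (FM : forall t, 0 <= t <= T -> F t `<=` measurable).
Variables (f : R -> R -> R -> R) (K K3 : R).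
Hypotheses (A1 : condA1 T f) (fB : borel_aggregator T f)
  (fK : forall s y u u', 0 <= s <= T -> 0 <= y -> `|f s y u - f s y u'| <= K * `|u - u'|)
  (f0 : forall s, 0 <= s <= T -> `|f s 0 0| <= K3).
Variables (Y U : R -> Omega -> R).
Hypotheses (mY : measurable_fun setT (fun p : R * Omega => Y (clamp T p.1) p.2))
  (Y0 : forall t w, 0 <= t <= T -> 0 <= Y t w)
  (YU : recursive_utility P T F f Y U).
Local Notation mu := (@lebesgue_measure R).
Local Notation lamT := (lebesgue_upto T).
Local Notation nu := (lebesgue_upto T \x P)%E.

Let T0' : 0 <= T. Proof. exact: ltW. Qed.
Let TT : 0 <= T <= T. Proof. by rewrite T0' lexx. Qed.
Let cT s : 0 <= clamp T s <= T. Proof. exact: clamp_itv. Qed.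

Let aU : adapted T F U. Proof. by have [] := YU. Qed.
Let rU : right_continuous_paths T U. Proof. by have [_ []] := YU. Qed.

Let mU : measurable_fun setT (fun p : R * Omega => U (clamp T p.1) p.2).
Proof.
apply: (measurable_right_continuous (X := U) T0' _ rU).
by move=> s sT; exact: (adapted_measurable FM aU).
Qed.

Let K0 : 0 <= K.
Proof.
have := fK 1 0 (s := 0) (y := 0); rewrite lexx T0' subr0 normr1 mulr1 => /(_ isT isT).
exact: le_trans.
Qed.

Let K30 : 0 <= K3. Proof. by apply: le_trans (f0 TT). Qed.

(* Time is clamped to make this a function on the whole of [R * Omega]. *)
Definition felicity (p : R * Omega) : R :=
  f (clamp T p.1) (Y (clamp T p.1) p.2) (U (clamp T p.1) p.2).

Lemma measurable_felicity : measurable_fun setT felicity.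
Proof.
have mc : measurable_fun setT (fun p : R * Omega => clamp T p.1).
  exact: measurableT_comp (measurable_clamp T) measurable_fst.
by apply: (measurable_aggregator mc mY mU (fun p => cT p.1) _ fB) => p; exact: Y0.
Qed.

Let finite_nu (c : R) : nu.-integrable setT (fun=> c%:E).
Proof.
apply/(@integrable12ltyP _ _ _ _ _ lamT P); first exact: measurable_cst.
under eq_integral do rewrite integral_cst//= probability_setT mule1.
rewrite integral_cst//= lte_mul_pinfty//.
exact: (fin_num_fun_lty (fin_num_measure (lamT : {finite_measure set _ -> \bar R}))).
Qed.

Lemma utility_sq_integrable :
  nu.-integrable setT (fun p => (U (clamp T p.1) p.2 ^+ 2)%:E).
Proof.
have [_ _ supU _ _] := YU.
apply/(@integrable12ltyP _ _ _ _ _ lamT P); first by apply/measurable_EFinP; exact: measurable_funX.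
apply: (@le_lt_trans _ _ (\int[lamT]_s
    \int[P]_w ereal_sup [set ((U t w) ^+ 2)%:E | t in `[0%R, T]])%E).
  apply: ge0_le_integral_any => s _; first exact: integral_ge0.
  apply: ge0_le_integral_any => w _ //=.
  rewrite ger0_norm ?sqr_ge0//; apply: ereal_sup_ubound.
  by exists (clamp T s) => //; rewrite /= in_itv/=; exact: cT.
have S0 : (0 <= \int[P]_w ereal_sup [set ((U t w) ^+ 2)%:E | t in `[0%R, T]])%E.
  apply: integral_ge0 => w _; apply: (@le_trans _ _ ((U 0 w) ^+ 2)%:E).
    by rewrite lee_fin sqr_ge0.
  by apply: ereal_sup_ubound; exists 0 => //; rewrite /= in_itv/= lexx.
rewrite -(@fineK _ (\int[P]_w _)%E) ?ge0_fin_numE// integral_cst//=.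
rewrite lte_mul_pinfty ?lee_fin ?fine_ge0//.
exact: (fin_num_fun_lty (fin_num_measure (lamT : {finite_measure set _ -> \bar R}))).
Qed.

Lemma utility_integrable : nu.-integrable setT (fun p => (U (clamp T p.1) p.2)%:E).
Proof.
have := integrableD measurableT (finite_nu 1) utility_sq_integrable.
apply: le_integrable => //; first exact/measurable_EFinP.
move=> p _ /=; rewrite lee_fin [leRHS]ger0_norm ?addr_ge0 ?sqr_ge0//.
by rewrite -real_normK ?num_real//; move: `|_| => x; nra.
Qed.

(** The bound is one-sided: [f] increases in [y], so it dominates its value at [y = 0], which the
    Lipschitz condition controls by the utility. No moment of [Y] is at hand for an upper bound. *)
Let felicity_lb p : - (K3 + K * `|U (clamp T p.1) p.2|) <= felicity p.
Proof.
have sT := cT p.1; rewrite /felicity.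
set u := U _ _; set y := Y _ _; set s := clamp T p.1.
have y0 : 0 <= y by exact: Y0.
have f0y : f s 0 u <= f s y u.
  move: y0; rewrite le_eqVlt => /predU1P[<-//|y0].
  by have [_ _ H] := A1 sT; apply: ltW; exact: H.
have := fK u 0 sT (lexx 0); have := f0 sT; rewrite subr0 -/s.
rewrite !ler_norml => /andP[H1 _] /andP[H2 _].
apply: le_trans f0y; rewrite opprD; lra.
Qed.

Let bound_integrable : nu.-integrable setT
  (fun p => (K3 + K * `|U (clamp T p.1) p.2|)%:E).
Proof.
under eq_fun do rewrite EFinD EFinM.
apply: integrableD => //; apply: integrableZl => //.
exact: (integrable_abse utility_integrable).
Qed.

Let path_integrable : {ae P, forall w,
  lamT.-integrable setT (fun s => (felicity (s, w))%:E)}.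
Proof.
have [_ _ _ + _] := YU; apply: filterS => w iw.
apply/integrable_lebesgue_upto.
  by apply/measurable_EFinP; exact: measurableT_comp measurable_felicity (pair2_measurable w).
apply: eq_integrable iw => //= s; rewrite inE/= in_itv/= => sT.
by rewrite /felicity/= clamp_id.
Qed.

Let aggregate s w := \int[mu]_(t in `[s, T]) f t (Y t w) (U t w).

(** The lower limit of the time integral becomes an indicator, so that all times share one product
    space. *)
Let after s (p : R * Omega) : R := (s <= clamp T p.1)%R%:R * felicity p.

Let measurable_after s : measurable_fun setT (after s).
Proof.
apply: measurable_funM; last exact: measurable_felicity.
apply: measurable_le_indic; first exact: measurable_cst.
exact: measurableT_comp (measurable_clamp T) measurable_fst.
Qed.

Let aggregateE s : 0 <= s <= T -> {ae P, forall w,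
  lamT.-integrable setT (fun t => (after s (t, w))%:E) /\
  (aggregate s w)%:E = (\int[lamT]_t (after s (t, w))%:E)%E}.
Proof.
move=> sT; have /andP[s0 sT'] := sT; apply: filterS path_integrable => w iw.
have ma : measurable_fun setT (fun t => (after s (t, w))%:E).
  by apply/measurable_EFinP; exact: measurableT_comp (measurable_after s) (pair2_measurable w).
have ia : lamT.-integrable setT (fun t => (after s (t, w))%:E).
  apply: le_integrable iw => // t _ /=; rewrite lee_fin /after/= normrM.
  by case: (s <= _); rewrite ?normr1 ?mul1r// normr0 mul0r.
split=> //; rewrite -(fineK (integrable_fin_num measurableT ia)).
rewrite integral_lebesgue_upto//; congr (fine _)%:E.
rewrite [LHS]integral_mkcond [RHS]integral_mkcond; apply: eq_integral => t _.
rewrite !patchE /after/felicity/= !mem_setE !in_itv/=.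
have [tT|_] := leP t T; last by rewrite !andbF.
rewrite !andbT; have [t0|t0] := leP 0 t; last by rewrite leNgt (lt_le_trans t0 s0).
by rewrite clamp_id ?t0//; case: (s <= t); rewrite ?mul1r// mul0r.
Qed.

(** The time integral of the felicity from 0 is integrable, being what [U 0] conditions. A function
    [x] above [- psi] satisfies |x| <= x + 2 psi, and [psi] is integrable because [U] is. *)
Lemma felicity_integrable : nu.-integrable setT (fun p => (felicity p)%:E).
Proof.
have mf : measurable_fun setT (fun p => (felicity p)%:E).
  by apply/measurable_EFinP; exact: measurable_felicity.
apply/(@integrable21ltyP _ _ _ _ _ lamT P _ mf).
have [_ _ _ _ /(_ 0)] := YU; rewrite lexx T0' => /(_ isT)[/= iX _ _ _].
pose psi p := K3 + K * `|U (clamp T p.1) p.2|.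
have mpsi : measurable_fun setT (fun p => (psi p)%:E) by exact: (measurable_int nu).
have psi0 p : (0 <= (psi p)%:E)%E by rewrite lee_fin addr_ge0// mulr_ge0.
have IP0 w : (0 <= \int[lamT]_s (psi (s, w))%:E)%E by apply: integral_ge0 => s _; exact: psi0.
have mI (h : R * Omega -> \bar R) : measurable_fun setT h -> (forall p, 0 <= h p)%E ->
    measurable_fun setT (fun w => \int[lamT]_s h (s, w))%E.
  move=> mh h0; apply: (@measurable_integral_on _ _ _ _ R lamT setT
    (fun q : Omega * R => h (q.2, q.1))) => //.
  exact: measurableT_comp mh (@measurable_swap _ _ Omega R).
have mIP : measurable_fun setT (fun w => (\int[lamT]_s (psi (s, w))%:E)%E).
  exact: (mI (fun p => (psi p)%:E)).
apply: (@le_lt_trans _ _ (\int[P]_w (`|(aggregate 0 w)%:E| +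
    (\int[lamT]_s (psi (s, w))%:E + \int[lamT]_s (psi (s, w))%:E)))%E).
  apply: ae_ge0_le_integral => //.
  - by move=> w _; exact: integral_ge0.
  - by apply: (mI (fun p => `|(felicity p)%:E|%E)) => //; exact: measurableT_comp.
  - by move=> w _; apply: adde_ge0; [exact: abse_ge0|exact: adde_ge0].
  - apply: emeasurable_funD; last exact: emeasurable_funD.
    by apply: measurableT_comp => //; exact: (measurable_int P).
  have Hpsi := ae_integrable2 bound_integrable.
  have H0 : (0 : R) <= 0 <= T by apply/andP.
  near=> w; move=> _.
  have ipsi : lamT.-integrable setT (fun s => (psi (s, w))%:E) by near: w.
  have iw : lamT.-integrable setT (fun s => (felicity (s, w))%:E) by near: w.
  have [ia Ea] : lamT.-integrable setT (fun t => (after 0 (t, w))%:E) /\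
    (aggregate 0 w)%:E = (\int[lamT]_t (after 0 (t, w))%:E)%E by near: w; exact: aggregateE.
  have mfw : measurable_fun setT (fun s => (felicity (s, w))%:E) by exact: (measurable_int lamT).
  apply: (@le_trans _ _ (\int[lamT]_s ((felicity (s, w))%:E + ((psi (s, w))%:E + (psi (s, w))%:E)))%E).
    apply: ge0_le_integral_any => s _; first by rewrite lee_fin.
    rewrite -!EFinD lee_fin ler_norml.
    have := felicity_lb (s, w); rewrite -/(psi (s, w)).
    have : 0 <= psi (s, w) by rewrite -lee_fin.
    move: (psi _) (felicity _) => x y x0 xy; apply/andP; split; lra.
  rewrite integralD//; last exact: integrableD.
  rewrite integralD//; apply: leeD => //.
  suff -> : (\int[lamT]_s (felicity (s, w))%:E = (aggregate 0 w)%:E)%E by exact: lee_abs.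
  rewrite Ea !integral_lebesgue_upto//; last exact: (measurable_int lamT).
  apply: eq_integral => s; rewrite inE/= in_itv/= => _.
  by rewrite /after/=; have /andP[-> _] := cT s; rewrite mul1r.
rewrite ge0_integralD//; last 3 first.
- by apply: measurableT_comp => //; exact: (measurable_int P).
- by move=> w _; exact: adde_ge0.
- exact: emeasurable_funD.
have [_ iXlt] := integrableP _ _ _ iX.
rewrite lte_add_pinfty//.
rewrite ge0_integralD//.
have [_] := integrableP _ _ _ bound_integrable.
rewrite (_ : \int[nu]_p _ = \int[nu]_p (psi p)%:E)%E; last first.
  by apply: eq_integral => p _; rewrite gee0_abs// psi0.
rewrite -(integral21_prod_meas1 bound_integrable) => ?.
by rewrite lte_add_pinfty.
Unshelve. all: by end_near. Qed.

(** The bounded [F s]-measurable factor [q] passes through the conditional expectation that defines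
    [U s]. *)
Lemma utility_pairing s (q : Omega -> R) (c : R) : 0 <= s <= T ->
  measurable_fun setT (q : g_sigma_algebraType (F s) -> R) -> (forall w, `|q w| <= c) ->
  (\int[P]_w (q w * U s w)%:E =
   \int[nu]_p (q p.2 * ((s <= clamp T p.1)%R%:R * felicity p))%:E)%E.
Proof.
move=> sT mq qc; have mq' : measurable_fun setT q := sub_measurable_fun (FM sT) mq.
have [_ _ _ _ /(_ s sT)[iX iU _ XU]] := YU.
rewrite -(integral_bounded_factor (FM sT) (Fs sT) iX iU XU mq qc).
have mqa : measurable_fun setT (fun p : R * Omega => q p.2 * after s p).
  by apply: measurable_funM => //; exact: measurableT_comp mq' measurable_snd.
have iqa : nu.-integrable setT (fun p => (q p.2 * after s p)%:E).
  have := integrableZl measurableT c felicity_integrable.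
  apply: le_integrable => //; first exact/measurable_EFinP.
  move=> p _ /=; rewrite lee_fin /after !normrM ler_pM//.
    by apply: (le_trans (qc _)); exact: ler_norm.
  by case: (s <= _); rewrite ?normr1 ?mul1r// normr0 mul0r.
rewrite -(integral21_prod_meas1 iqa).
apply: ae_eq_integral => //.
- apply/measurable_EFinP; apply: measurable_funM => //.
  exact/measurable_EFinP/(measurable_int P).
- exact: measurable_fubini_G iqa.
- apply: filterS (aggregateE sT) => w [ia Ea] _ /=.
  by rewrite EFinM -/(aggregate s w) Ea -integralZl.
Qed.

(** [U s] stands for the felicity accumulated after [s]. By Fubini over two times and the sample
    point, the felicity at [t] collects the weights [al s] of all [s <= t]. *)
Lemma utility_average (al : R -> Omega -> R) (c : R) :
  measurable_fun setT (fun p : R * Omega => al (clamp T p.1) p.2) ->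
  (forall s w, 0 <= s <= T -> `|al s w| <= c) ->
  (forall s, 0 <= s <= T -> measurable_fun setT (al s : g_sigma_algebraType (F s) -> R)) ->
  (\int[nu]_p (al (clamp T p.1) p.2 * U (clamp T p.1) p.2)%:E =
   \int[nu]_p ((\int[mu]_(s in `[0, clamp T p.1]) al s p.2) * felicity p)%:E)%E.
Proof.
move=> mal alc alF.
have i1 : nu.-integrable setT
    (fun p => (al (clamp T p.1) p.2 * U (clamp T p.1) p.2)%:E).
  have := integrableZl measurableT c utility_integrable.
  apply: le_integrable => //; first by apply/measurable_EFinP; exact: measurable_funM.
  move=> p _ /=; rewrite lee_fin !normrM ler_wpM2r//.
  by apply: (le_trans (alc _ _ (cT _))); exact: ler_norm.
pose H (x : R * (R * Omega)) : \bar R :=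
  (al (clamp T x.1) x.2.2 * after (clamp T x.1) x.2)%:E.
have mH : measurable_fun setT H.
  apply/measurable_EFinP; apply: measurable_funM.
    have mx : measurable_fun setT (fun x : R * (R * Omega) => (x.1, x.2.2)).
      apply: measurable_fun_pair; first exact: measurable_fst.
      exact: measurableT_comp measurable_snd measurable_snd.
    exact: measurableT_comp mal mx.
  apply: measurable_funM; last exact: measurableT_comp measurable_felicity measurable_snd.
  apply: measurable_le_indic.
    exact: measurableT_comp (measurable_clamp T) measurable_fst.
  apply: measurableT_comp (measurable_clamp T) _.
  exact: measurableT_comp measurable_fst measurable_snd.
have Hle s p : (`|H (s, p)| <= `|c%:E * (felicity p)%:E|)%E.
  rewrite /H/after/= lee_fin !normrM ler_pM//.
    by apply: (le_trans (alc _ _ (cT _))); exact: ler_norm.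
  by case: (clamp T s <= clamp T p.1); rewrite ?normr1 ?mul1r// normr0 mul0r.
have Hfin : (\int[lamT]_s \int[nu]_p `|H (s, p)| < +oo)%E.
  have /integrableP[_ fin] := integrableZl measurableT c felicity_integrable.
  apply: (@le_lt_trans _ _ (\int[lamT]_s \int[nu]_p `|c%:E * (felicity p)%:E|)%E).
    apply: ge0_le_integral_any => s _; first exact: integral_ge0.
    by apply: ge0_le_integral_any => p _; [exact: abse_ge0|exact: Hle].
  have I0 : (0 <= \int[nu]_p `|c%:E * (felicity p)%:E|)%E.
    by apply: integral_ge0 => p _; exact: abse_ge0.
  rewrite -(@fineK _ (\int[nu]_p _)%E) ?ge0_fin_numE// integral_cst//=.
  rewrite lte_mul_pinfty ?lee_fin ?fine_ge0//.
  exact: (fin_num_fun_lty (fin_num_measure (lamT : {finite_measure set _ -> \bar R}))).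
have iH := (@integrable12ltyP _ _ _ _ _ lamT (path_measure P T) H mH).2 Hfin.
rewrite -(integral12_prod_meas1 i1).
transitivity (\int[lamT]_s \int[nu]_p H (s, p))%E.
  apply: eq_integral => s _ /=; rewrite /fubini_F /=.
  by rewrite (utility_pairing (cT s) (alF _ (cT s)) (fun w => alc _ w (cT s))).
rewrite (Fubini iH); apply: eq_integral => -[t w] _ /=.
have mals : measurable_fun setT (fun s => al (clamp T s) w).
  exact: measurableT_comp mal (@pair2_measurable _ _ R Omega w).
have alsc s : `|al (clamp T s) w| <= c by exact: alc.
rewrite integral_lebesgue_upto; last first.
  exact: measurableT_comp mH (@pair2_measurable _ _ R (R * Omega)%type (t, w)).
have /andP[t0 tT] := cT t.
have -> : \int[mu]_(s in `[0, clamp T t]) al s w = \int[mu]_(s in `[0, clamp T t]) al (clamp T s) w.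
  apply: eq_Rintegral => s; rewrite inE/= in_itv/= => /andP[s0 st].
  by rewrite clamp_id// s0 (le_trans st).
have ial : mu.-integrable `[0, clamp T t] (fun s => (al (clamp T s) w)%:E).
  exact: (bounded_integrable_itv mals alsc).
rewrite EFinM [X in (X * _)%E]fineK; last exact: integrable_fin_num ial.
rewrite -integralZr//.
rewrite [LHS]integral_mkcond [RHS]integral_mkcond; apply: eq_integral => s _.
rewrite !patchE /H /after/= !mem_setE !in_itv/=.
have [s0|//] := leP 0 s; have [sT|Ts] := leP s T => /=; last first.
  by rewrite leNgt (le_lt_trans tT Ts).
rewrite clamp_id ?s0//.
by case: (s <= _); rewrite ?mul1r// mul0r mulr0.
Qed.

Lemma expected_utility : (\int[P]_w (U 0 w)%:E = \int[nu]_p (felicity p)%:E)%E.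
Proof.
have T00 : (0 : R) <= 0 <= T by apply/andP.
transitivity (\int[P]_w (1 * U 0 w)%:E)%E.
  by apply: eq_integral => w _; rewrite mul1r.
rewrite (utility_pairing (q := fun=> 1) (c := 1) T00)//; last by move=> w; rewrite normr1.
by apply: eq_integral => p _; have /andP[-> _] := cT p.1; rewrite !mul1r.
Qed.

End RecursiveUtility.

(** * Comparison of utilities by concavity *)

Section Comparison.
Context {d} {Omega : measurableType d} {R : realType}.
Variables (P : probability Omega R) (T : R) (F : R -> set (set Omega)).
Hypotheses (T0 : 0 < T)
  (Fs : forall t, 0 <= t <= T -> sigma_algebra setT (F t))
  (FM : forall t, 0 <= t <= T -> F t `<=` measurable)
  (Fmono : forall s t, 0 <= s -> s <= t -> t <= T -> F s `<=` F t).
Variables (f : R -> R -> R -> R) (beta : R -> R) (eta K K3 : R).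
Hypotheses (A1 : condA1 T f) (fB : borel_aggregator T f)
  (fK : forall s y u u', 0 <= s <= T -> 0 <= y -> `|f s y u - f s y u'| <= K * `|u - u'|)
  (f0 : forall s, 0 <= s <= T -> `|f s 0 0| <= K3)
  (eta0 : 0 <= eta).
Variables (L U : R -> Omega -> R).
Local Notation lv := (level beta eta L).
Hypotheses (al : adapted T F lv) (rl : right_continuous_paths T lv)
  (YU : recursive_utility P T F f lv U).
Local Notation mu := (@lebesgue_measure R).
Local Notation nu := (lebesgue_upto T \x P)%E.
Local Notation Gam := (felicity_discount T f beta eta L U).
Local Notation fw := (felicity_weight T f beta eta L U).

#[local] Opaque decay.

Let T0' : 0 <= T. Proof. exact: ltW. Qed.
Let cT s : 0 <= clamp T s <= T. Proof. exact: clamp_itv. Qed.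
Let lv0 t w : 0 <= lv t w. Proof. exact: level_ge0. Qed.
Let aU : adapted T F U. Proof. by have [] := YU. Qed.
Let rU : right_continuous_paths T U. Proof. by have [_ []] := YU. Qed.
Let mlv := measurable_level T0 FM al rl.
Let mU := measurable_utility T0 FM aU rU.

Let a s w := d_u f s (lv s w) (U s w).

Let aK s w : 0 <= s <= T -> `|a s w| <= K.
Proof. exact: d_u_path_bound. Qed.

Let ma : measurable_fun setT (fun p : R * Omega => a (clamp T p.1) p.2).
Proof. exact: (measurable_d_u_path T0 FM A1 fB eta0 al rl aU rU). Qed.

Let maw w : measurable_fun setT (fun s => a (clamp T s) w).
Proof. exact: measurableT_comp ma (@pair2_measurable _ _ R Omega w). Qed.

Let aKw w s : `|a (clamp T s) w| <= K. Proof. exact: aK. Qed.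

Let GamE t w : Gam t w = expR (\int[mu]_(s in `[0, clamp T t]) a (clamp T s) w).
Proof.
have /andP[_ tT] := cT t.
have E : \int[mu]_(s in `[0, clamp T t]) a s w = \int[mu]_(s in `[0, clamp T t]) a (clamp T s) w.
  apply: eq_Rintegral => s; rewrite inE/= in_itv/= => /andP[s0 st].
  by rewrite clamp_id// s0 (le_trans st).
change (expR (\int[mu]_(s in `[0, clamp T t]) a s w) =
  expR (\int[mu]_(s in `[0, clamp T t]) a (clamp T s) w)).
by rewrite E.
Qed.

Let Gam0 t w : 0 < Gam t w. Proof. exact: expR_gt0. Qed.

Let GamK t w : Gam t w <= expR (K * T).
Proof.
rewrite GamE ler_expR; apply: (le_trans (ler_norm _)).
exact: (Rintegral_bound (maw w) (aKw w) (cT t)).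
Qed.

(** Progressive measurability of [a], inherited from right-continuous adapted processes. It makes
    [Gam s], an integral over [[0, s]], measurable for [F s]. *)
Let ma_at s : 0 <= s <= T -> measurable_fun setT
  (fun p : R * g_sigma_algebraType (F s) => a (clamp s p.1) p.2).
Proof.
move=> /andP[s0 sT].
have mX (X : R -> Omega -> R) : adapted T F X -> right_continuous_paths T X ->
    measurable_fun setT (fun p : R * g_sigma_algebraType (F s) => X (clamp s p.1) p.2).
  move=> aX rX; apply: (@measurable_right_continuous _ _ (g_sigma_algebraType (F s)) s X s0).
    by move=> z /andP[z0 zs]; exact: (adapted_measurable_at Fmono aX z0 zs sT).
  by move=> w z /andP[z0 zs]; apply: rX; rewrite z0 (lt_le_trans zs).
have mc : measurable_fun setT (fun p : R * g_sigma_algebraType (F s) => clamp s p.1).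
  exact: measurableT_comp (measurable_clamp s) measurable_fst.
apply: (measurable_d_u A1 mc (mX _ al rl) (mX _ aU rU) _ _ fB) => p; last exact: lv0.
by have /andP[-> /le_trans->] := clamp_itv p.1 s0.
Qed.

Let alpha s w := Gam s w * a s w.

Let alpha_adapted s : 0 <= s <= T ->
  measurable_fun setT (alpha s : g_sigma_algebraType (F s) -> R).
Proof.
move=> sT; have /andP[s0 sT'] := sT.
have ss : clamp s s = s by rewrite clamp_id// s0 lexx.
have aKs z w : 0 <= z <= s -> `|a z w| <= K.
  by move=> /andP[z0 zs]; apply: aK; rewrite z0 (le_trans zs).
have m1 := measurableT_comp (ma_at sT) (@pair1_measurable _ _ R (g_sigma_algebraType (F s)) s).
have m2 := measurableT_comp
  (@measurable_primitive_param _ (g_sigma_algebraType (F s)) R s a K s0 (ma_at sT) aKs)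
  (@pair1_measurable _ _ R (g_sigma_algebraType (F s)) s).
move: m1 m2; rewrite /comp/= ss => m1 m2.
apply: measurable_funM; last exact: m1.
apply: measurableT_comp => //; rewrite clamp_id//.
Qed.

Let alpha_bound s w : 0 <= s <= T -> `|alpha s w| <= expR (K * T) * K.
Proof.
by move=> sT; rewrite normrM ler_pM// ?aK// (gtr0_norm (Gam0 _ _)).
Qed.

Let mGam : measurable_fun setT (fun p : R * Omega => Gam p.1 p.2).
Proof. exact: (measurable_felicity_discount T0 FM A1 fB fK eta0 al rl aU rU). Qed.

Let Gam_clamp s w : Gam (clamp T s) w = Gam s w.
Proof. by rewrite !GamE clamp_id. Qed.

Let malpha : measurable_fun setT (fun p : R * Omega => alpha (clamp T p.1) p.2).
Proof.
apply: measurable_funM; last exact: ma.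
by under eq_fun do rewrite Gam_clamp.
Qed.

Let integral_alpha t w : \int[mu]_(s in `[0, clamp T t]) alpha s w = Gam t w - 1.
Proof.
rewrite GamE -(integral_exp_primitive T0' (maw w) (aKw w) (cT t)).
apply: eq_Rintegral => s; rewrite inE/= in_itv/= => /andP[s0 st].
have sT : 0 <= s <= T by rewrite s0 (le_trans st)//; have /andP[] := cT t.
by rewrite /alpha GamE clamp_id// mulrC.
Qed.

Local Notation I g := (\int[nu]_p g p).
Local Notation integrable g := (nu.-integrable setT (EFin \o g)).

Let bounded_mul (g h : R * Omega -> R) c : integrable g -> measurable_fun setT h ->
  (forall p, `|h p| <= c) -> integrable (fun p => h p * g p).
Proof.
move=> ig mh hc; have /measurable_EFinP mg := measurable_int nu ig.
have := integrableZl measurableT c ig; apply: le_integrable => //.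
  by apply/measurable_EFinP; exact: measurable_funM.
move=> p _ /=; rewrite lee_fin !normrM ler_wpM2r//.
by apply: (le_trans (hc _)); exact: ler_norm.
Qed.

(** [utility_average] with weight [alpha = Gam * a], whose primitive is [Gam - 1]: this trades the
    terms in the utility for felicities. *)
Let average (Y V : R -> Omega -> R) :
  measurable_fun setT (fun p : R * Omega => Y (clamp T p.1) p.2) ->
  (forall t w, 0 <= t <= T -> 0 <= Y t w) -> recursive_utility P T F f Y V ->
  [/\ integrable (felicity T f Y V),
      integrable (fun p => Gam p.1 p.2 * felicity T f Y V p),
      integrable (fun p => alpha (clamp T p.1) p.2 * V (clamp T p.1) p.2) &
      I (fun p => alpha (clamp T p.1) p.2 * V (clamp T p.1) p.2) =
      I (fun p => Gam p.1 p.2 * felicity T f Y V p) - I (felicity T f Y V)].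
Proof.
move=> mY Y0 YV.
have iPhi := felicity_integrable T0 FM A1 fB fK f0 mY Y0 YV.
have iG : integrable (fun p => Gam p.1 p.2 * felicity T f Y V p).
  apply: (bounded_mul (c := expR (K * T)) iPhi mGam) => p.
  by rewrite (gtr0_norm (Gam0 _ _)).
split=> //.
  apply: (bounded_mul (c := expR (K * T) * K) (utility_integrable T0 FM YV) malpha) => p.
  exact: alpha_bound.
rewrite -RintegralB//; congr fine.
rewrite (utility_average T0 Fs FM A1 fB fK f0 mY Y0 YV malpha alpha_bound alpha_adapted).
apply: eq_integral => p _; congr EFin.
by rewrite integral_alpha mulrBl mul1r.
Qed.

Let fw0 t w : 0 <= fw t w. Proof. exact: felicity_weight_ge0. Qed.

Let mfw : measurable_fun setT (fun p : R * Omega => fw p.1 p.2).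
Proof. exact: (measurable_felicity_weight T0 FM A1 fB fK eta0 al rl aU rU). Qed.

Let nu_cst (c : R) : integrable (fun=> c).
Proof.
by apply: (finite_measure_integrable_cst (path_measure P T)).
Qed.

(** The gradient inequality from the level to 0, at fixed utility, bounds [d_y f] times the level by
    f(Y, U) - f(0, U), which is integrable; [Gam] is bounded by [expR (K * T)]. *)
Lemma weighted_level_integrable : integrable (fun p => fw p.1 p.2 * lv (clamp T p.1) p.2).
Proof.
have iPhi := felicity_integrable T0 FM A1 fB fK f0 mlv (fun t w _ => lv0 t w) YU.
have iU := utility_integrable T0 FM YU.
have ibd : integrable (fun p => `|felicity T f lv U p| + (K3 + K * `|U (clamp T p.1) p.2|)).
  rewrite /comp; under eq_fun do rewrite !EFinD EFinM.
  apply: integrableD => //; first exact: (integrable_abse iPhi).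
  apply: integrableD => //; first exact: nu_cst.
  by apply: integrableZl => //; exact: (integrable_abse iU).
have := integrableZl measurableT (expR (K * T)) ibd.
apply: le_integrable => //.
  by apply/measurable_EFinP; exact: measurable_funM.
move=> [t w] _ /=; rewrite lee_fin [leLHS]ger0_norm; last exact: mulr_ge0 (fw0 _ _) (lv0 _ _).
rewrite /felicity_weight -mulrA normrM (ger0_norm (expR_ge0 _)).
have dy0 : 0 <= d_y f (clamp T t) (lv (clamp T t) w) (U (clamp T t) w).
  by apply: (d_y_ge0 A1).
apply: ler_pM; [exact: expR_ge0|exact: mulr_ge0 dy0 (lv0 _ _)|exact: GamK|].
apply: le_trans (ler_norm _); rewrite /felicity/=.
have := gradient_ineq A1 (U (clamp T t) w) (U (clamp T t) w) (cT t)
  (lv0 (clamp T t) w) (lexx 0).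
rewrite subrr mulr0 addr0 sub0r mulrN.
have := fK (U (clamp T t) w) 0 (cT t) (lexx 0); have := f0 (cT t).
rewrite subr0; move: (f _ _ _) (f _ 0 _) (f _ 0 0) (K * _) => x y z k.
move: (d_y _ _ _ _ * _) => q.
rewrite !ler_norml => /andP[H1 H2] /andP[H3 H4] H5.
by have := ler_norm x; lra.
Qed.

(* Linearizing the aggregator at the candidate, the first-order terms in the
   utility are absorbed by the discount factor, whose primitive is explicit. *)
Lemma utility_comparison (Y V : R -> Omega -> R) :
  measurable_fun setT (fun p : R * Omega => Y (clamp T p.1) p.2) ->
  (forall t w, 0 <= t <= T -> 0 <= Y t w) -> recursive_utility P T F f Y V ->
  (\int[nu]_p (fw p.1 p.2 * Y (clamp T p.1) p.2)%:E <=
   \int[nu]_p (fw p.1 p.2 * lv (clamp T p.1) p.2)%:E)%E ->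
  (\int[P]_w (V 0 w)%:E <= \int[P]_w (U 0 w)%:E)%E.
Proof.
move=> mY Y0 YV le_w.
have iwl := weighted_level_integrable.
(* The weighted satisfaction of the competitor is finite only thanks to the inequality [le_w]. *)
have iwY : integrable (fun p => fw p.1 p.2 * Y (clamp T p.1) p.2).
  apply/integrableP; split; first by apply/measurable_EFinP; exact: measurable_funM.
  rewrite (_ : \int[nu]_p _ = \int[nu]_p (fw p.1 p.2 * Y (clamp T p.1) p.2)%:E)%E.
    by apply: (le_lt_trans le_w); rewrite ltey_eq (integrable_fin_num measurableT iwl).
  apply: eq_integral => p _ /=; rewrite ger0_norm//.
  by apply: mulr_ge0; [exact: fw0|exact: Y0].
have [iPhi iG iA EA] := average mlv (fun t w _ => lv0 t w) YU.
have [iPhi' iG' iA' EA'] := average mY Y0 YV.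
rewrite (expected_utility T0 Fs FM A1 fB fK f0 mY Y0 YV).
rewrite (expected_utility T0 Fs FM A1 fB fK f0 mlv (fun t w _ => lv0 t w) YU).
have w_le : I (fun p => fw p.1 p.2 * Y (clamp T p.1) p.2) <=
    I (fun p => fw p.1 p.2 * lv (clamp T p.1) p.2).
  by apply: fine_le => //; exact: integrable_fin_num.
(* The gradient inequality multiplied by [Gam] and integrated. *)
have : I (fun p => Gam p.1 p.2 * felicity T f Y V p - Gam p.1 p.2 * felicity T f lv U p) <=
    I (fun p => (fw p.1 p.2 * Y (clamp T p.1) p.2 - fw p.1 p.2 * lv (clamp T p.1) p.2) +
      (alpha (clamp T p.1) p.2 * V (clamp T p.1) p.2 -
       alpha (clamp T p.1) p.2 * U (clamp T p.1) p.2)).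
  apply: le_Rintegral => //.
  - by rewrite /comp; under eq_fun do rewrite EFinB; exact: integrableB.
  - rewrite /comp; under eq_fun do rewrite EFinD !EFinB.
    by apply: integrableD => //; exact: integrableB.
  - move=> [t w] _ /=; rewrite /alpha Gam_clamp /felicity_weight /felicity/=.
    have := gradient_ineq A1 (U (clamp T t) w) (V (clamp T t) w) (cT t)
      (lv0 (clamp T t) w) (Y0 _ w (cT t)).
    rewrite -/(a (clamp T t) w); have := Gam0 t w.
    move: (f (clamp T t) (lv (clamp T t) w) (U (clamp T t) w))
      (f (clamp T t) (Y (clamp T t) w) (V (clamp T t) w))
      (d_y f (clamp T t) (lv (clamp T t) w) (U (clamp T t) w)).
    move: (Gam t w) (a (clamp T t) w) (lv (clamp T t) w) (Y (clamp T t) w)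
      (U (clamp T t) w) (V (clamp T t) w).
    move=> G aa l yy u v y x dy G0 H.
    rewrite -mulrBr; apply: (le_trans (ler_wpM2l (ltW G0) H)).
    by rewrite le_eqVlt; apply/orP; left; apply/eqP; ring.
rewrite [X in X <= _ -> _]RintegralB// RintegralD//; last 2 first.
- by rewrite /comp; under eq_fun do rewrite EFinB; exact: integrableB.
- by rewrite /comp; under eq_fun do rewrite EFinB; exact: integrableB.
(* After this substitution the felicities weighted by [Gam] occur on both sides and cancel, leaving
   the unweighted ones, that is the expected utilities. *)
rewrite !RintegralB// EA EA' => lin.
rewrite -[leLHS](fineK (integrable_fin_num measurableT iPhi')).
rewrite -[leRHS](fineK (integrable_fin_num measurableT iPhi)) lee_fin.
rewrite -/(I (felicity T f Y V)) -/(I (felicity T f lv U)).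
move: w_le lin.
move: (I (felicity T f Y V)) (I (felicity T f lv U)).
move: (I (fun p => fw p.1 p.2 * Y (clamp T p.1) p.2))
  (I (fun p => fw p.1 p.2 * lv (clamp T p.1) p.2)).
move: (I (fun p => Gam p.1 p.2 * felicity T f Y V p))
  (I (fun p => Gam p.1 p.2 * felicity T f lv U p)).
by move=> *; lra.
Qed.

End Comparison.

(** Up to time [t] a hitting time depends on the path over [[0, t]] only; [htime t] displays this,
    for use in adaptedness. *)
Lemma htime_min {R : realType} (T t : R) (g : R -> R) u : rc_path T g -> 0 <= t <= T ->
  Num.min (htime T g u) t = htime t g u.
Proof.
move=> rg /andP[t0 tT]; have T0 := le_trans t0 tT.
have rgt : rc_path t g.
  have [nd rc] := rg; split=> [x y x0 xy yt|x /andP[x0 xt]].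
    by apply: nd => //; exact: le_trans tT.
  by apply: rc; rewrite x0 (lt_le_trans xt).
have H s : 0 <= s -> s < t -> (htime t g u <= s) = (htime T g u <= s).
  move=> s0 st; rewrite (htime_le t0 u rgt) ?s0// (htime_le T0 u rg)//.
  by rewrite s0 (lt_le_trans st).
apply/le_anti/andP; split; rewrite leNgt; apply/negP.
- rewrite lt_min => /andP[lt1 lt2]; move: lt1.
  by rewrite ltNge -H ?htime_ge0// lexx.
- move=> lt1; have mt : Num.min (htime T g u) t < t := lt_le_trans lt1 (htime_leT t0 _ _).
  have /min_idPl E : htime T g u <= t by move: mt; rewrite gt_min ltxx orbF => /ltW.
  move: lt1; rewrite E ltNge H ?lexx// ?htime_ge0//.
  by move: mt; rewrite E.
Qed.

Section DecayOverBeta.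
Context {R : realType}.
Variables (T : R) (beta : R -> R).
Hypotheses (T0 : 0 < T) (bc : {within `[0, T], continuous beta})
  (bpos : forall s, 0 <= s <= T -> 0 < beta s).

Let T0' : 0 <= T. Proof. exact: ltW. Qed.

Definition decay_over_beta s := cdecay T beta s / cbeta T beta s.

Lemma decay_over_beta_ge0 s : 0 <= decay_over_beta s.
Proof. by rewrite divr_ge0// ltW// ?cdecay_gt0// (cbeta_gt0 T0' bpos). Qed.

Lemma measurable_decay_over_beta : measurable_fun setT decay_over_beta.
Proof.
apply: measurable_funM; first exact: measurable_cdecay.
apply: measurable_inv_gt0; last exact: measurable_cbeta.
exact: cbeta_gt0.
Qed.

Lemma decay_over_beta_right_continuous t : 0 <= t < T ->
  decay_over_beta @ t^'+ --> decay_over_beta t.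
Proof.
move=> tT; have /andP[t0 tT'] := tT.
have cb : beta @ t^'+ --> beta t.
  have [ci c0 _] := (continuous_within_itvP beta T0).1 bc.
  move: t0; rewrite le_eqVlt => /predU1P[<-//|t0].
  by apply: cvg_at_right_filter; apply: ci; rewrite in_itv/= t0.
have cbE : cbeta T beta @ t^'+ --> cbeta T beta t.
  rewrite [in X in _ --> X]/cbeta clamp_id ?t0 ?ltW//.
  apply: (cvg_trans _ cb); apply: near_eq_cvg; near=> s.
  have ts : t < s by near: s; exact: nbhs_right_gt.
  have sT : s < T by near: s; exact: nbhs_right_lt.
  by rewrite /cbeta clamp_id// (le_trans t0 (ltW ts)) ltW.
have cd : cdecay T beta @ t^'+ --> cdecay T beta t.
  by apply: cvg_at_right_filter; exact: (continuous_cdecay T0' bc bpos).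
apply: cvgM; first exact: cd.
by apply: cvgV => //; rewrite gt_eqF// (cbeta_gt0 T0' bpos).
Unshelve. all: by end_near. Qed.

End DecayOverBeta.

(** * Random plans given by a time change *)

Section TimeChangedPlans.
Context {d} {Omega : measurableType d} {R : realType}.
Variables (P : probability Omega R) (T : R) (F : R -> set (set Omega)).
Hypotheses (T0 : 0 < T)
  (Fs : forall t, 0 <= t <= T -> sigma_algebra setT (F t))
  (FM : forall t, 0 <= t <= T -> F t `<=` measurable)
  (Fmono : forall s t, 0 <= s -> s <= t -> t <= T -> F s `<=` F t).
Variables (beta : R -> R) (eta : R).
Hypotheses (bc : {within `[0, T], continuous beta})
  (bpos : forall s, 0 <= s <= T -> 0 < beta s) (eta0 : 0 <= eta).
Variables (C g : R -> Omega -> R) (a0 : R) (k : R -> R).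
Hypotheses (ag : adapted T F g)
  (tc : forall w, exists K, time_changed T (g ^~ w) a0 k K (C ^~ w)).
Local Notation mu := (@lebesgue_measure R).
Local Notation dec := (cdecay T beta).

Let T0' : 0 <= T. Proof. exact: ltW. Qed.
Let cT s : 0 <= clamp T s <= T. Proof. exact: clamp_itv. Qed.

Let rg w : rc_path T (g ^~ w). Proof. by have [K []] := tc w. Qed.

Hypotheses (k0 : forall s, 0 <= k s) (mk : measurable_fun setT k).

(** Levels [u <= g t] are reached by time [t], so their hitting times agree with those for the
    horizon [t], which are measurable for [F t]. *)
Lemma time_changed_adapted : adapted T F C.
Proof.
move=> t tT; apply/(measurable_wrtP _ (Fs tT)); have /andP[t0 tT'] := tT.
pose G := g_sigma_algebraType (F t).
have gs s : 0 <= s <= t -> measurable_fun setT (g s : G -> R).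
  by move=> /andP[s0 st]; exact: (adapted_measurable_at Fmono ag s0 st tT').
have rgt w : rc_path t (g ^~ w).
  have [nd rc] := rg w; split=> [x y x0 xy yt|x /andP[x0 xt]].
    by apply: nd => //; exact: le_trans tT'.
  by apply: rc; rewrite x0 (lt_le_trans xt).
have mh : measurable_fun setT (fun p : G * R => htime t (g ^~ p.1) p.2).
  apply: (measurableT_comp (f := fun p : R * G => htime t (g ^~ p.2) p.1)
    _ (@measurable_swap _ _ G R)).
  exact: (@measurable_htime _ t t0 _ G g rgt gs).
pose X (p : G * R) : \bar R := ((p.2 <= g t p.1)%R%:R * k (htime t (g ^~ p.1) p.2))%:E.
have mX : measurable_fun setT X.
  apply/measurable_EFinP; apply: measurable_funM; last exact: measurableT_comp mk mh.
  apply: measurable_le_indic; first exact: measurable_snd.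
  by apply: measurableT_comp measurable_fst; apply: gs; rewrite t0 lexx.
have X0 p : (0 <= X p)%E by rewrite lee_fin mulr_ge0.
have mI := @measurable_integral_on _ _ _ _ R mu `]a0, +oo[%classic X (measurable_itv _) mX X0.
rewrite (_ : C t = fun w => fine (\int[mu]_(u in `]a0, +oo[) X (w, u))%E).
  exact: measurableT_comp (fine_measurable measurableT) mI.
apply/funext => w; have [K tcw] := tc w.
apply: EFin_inj; rewrite (tc_eq tcw tT).
have E : (\int[mu]_(u in `]a0, g t w]) (k (htime T (g ^~ w) u))%:E =
    \int[mu]_(u in `]a0, +oo[) X (w, u))%E.
  rewrite [LHS]integral_mkcond [RHS]integral_mkcond; apply: eq_integral => u _.
  rewrite !patchE /X/= !mem_setE !in_itv/= andbT; case: (a0 < u) => //=.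
  have [ut|_] := leP u (g t w); last by rewrite mul0r.
  rewrite mul1r -(htime_min u (rg w) tT) min_l//.
  rewrite (htime_le_level T0' (rg w) tT)//.
  by apply: (le_trans ut); have [nd _] := rg w; apply: nd.
by rewrite -E fineK// -(tc_eq tcw tT).
Qed.

Lemma time_changed_plan : plan T F C.
Proof.
have rC w : rc_path T (C ^~ w) by have [K tcw] := tc w; exact: time_changed_rc_path tcw.
split.
- exact: time_changed_adapted.
- by move=> w t tT; have [_ rc] := rC w; exact: rc.
- by move=> w s t s0 st tT; have [nd _] := rC w; exact: nd.
- by move=> w t tT; have [K tcw] := tc w; have := time_changed_ge0 tcw tT.
Qed.

Let mtau : measurable_fun setT (fun p : Omega * R => htime T (g ^~ p.1) p.2).
Proof.
apply: (measurableT_comp (f := fun p : R * Omega => htime T (g ^~ p.2) p.1)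
  _ (@measurable_swap _ _ Omega R)).
by apply: measurable_htime => // t tT; exact: (adapted_measurable FM ag).
Qed.

Local Notation sd := (satisfaction_density T beta k).

Let sd0 s : 0 <= sd s. Proof. exact: satisfaction_density_ge0. Qed.

Lemma satisfaction_ge0 t w : 0 <= t <= T -> 0 <= satisfaction T beta eta C t w.
Proof.
move=> tT; have [K tcw] := tc w.
rewrite -[leRHS](subrK (eta * decay beta 0 t)) addr_ge0//; last first.
  by rewrite mulr_ge0// ltW// decay_gt0.
rewrite -lee_fin (satisfaction_gain eta T0' bc bpos tcw tT) mule_ge0//.
  by rewrite lee_fin ltW// cdecay_gt0.
by apply: integral_ge0 => u _; rewrite lee_fin.
Qed.

Let gain_ge0 p : 0 <= satisfaction T beta eta C (clamp T p.1) p.2 - eta * dec p.1 :> R.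
Proof.
have [K tcw] := tc p.2; rewrite -lee_fin (satisfaction_gain eta T0' bc bpos tcw (cT p.1)).
rewrite mule_ge0//; first by rewrite lee_fin ltW// cdecay_gt0.
by apply: integral_ge0 => u _; rewrite lee_fin.
Qed.

Hypothesis mg : measurable_fun setT (fun p : R * Omega => g (clamp T p.1) p.2).

Let mgain : measurable_fun setT
  (fun p : R * Omega => satisfaction T beta eta C (clamp T p.1) p.2 - eta * dec p.1).
Proof.
pose X (q : (R * Omega) * R) : \bar R :=
  ((q.2 <= g (clamp T q.1.1) q.1.2)%R%:R * sd (htime T (g ^~ q.1.2) q.2))%:E.
have mX : measurable_fun setT X.
  apply/measurable_EFinP; apply: measurable_funM.
    apply: measurable_le_indic; first exact: measurable_snd.
    exact: measurableT_comp mg measurable_fst.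
  have mq : measurable_fun setT (fun q : (R * Omega) * R => (q.1.2, q.2)).
    apply: measurable_fun_pair; last exact: measurable_snd.
    exact: measurableT_comp measurable_snd measurable_fst.
  apply: (measurableT_comp (measurable_satisfaction_density T0' bc bpos mk)).
  exact: measurableT_comp mtau mq.
have X0 q : (0 <= X q)%E by rewrite lee_fin mulr_ge0.
have mI := @measurable_integral_on _ _ _ _ R mu `]a0, +oo[%classic X (measurable_itv _) mX X0.
rewrite (_ : (fun p => _) = fun p : R * Omega =>
    fine ((dec p.1)%:E * \int[mu]_(u in `]a0, +oo[) X (p, u))%E).
  apply: measurableT_comp (fine_measurable measurableT) _.
  apply: emeasurable_funM => //; apply/measurable_EFinP.
  exact: measurableT_comp (measurable_cdecay T0' bc bpos) measurable_fst.
apply/funext => -[t w]; have [K tcw] := tc w.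
apply: EFin_inj; rewrite (satisfaction_gain eta T0' bc bpos tcw (cT t)).
have E : (\int[mu]_(u in `]a0, g (clamp T t) w]) (sd (htime T (g ^~ w) u))%:E =
    \int[mu]_(u in `]a0, +oo[) X ((t, w), u))%E.
  rewrite [LHS]integral_mkcond [RHS]integral_mkcond; apply: eq_integral => u _.
  rewrite !patchE /X/= !mem_setE !in_itv/= andbT; case: (a0 < u) => //=.
  by case: (u <= g (clamp T t) w); rewrite ?mul1r// mul0r.
have dd : dec (clamp T t) = dec t by rewrite /cdecay clamp_id.
have fin : ((dec t)%:E * \int[mu]_(u in `]a0, g (clamp T t) w])
    (sd (htime T (g ^~ w) u))%:E)%E \is a fin_num.
  by rewrite -[dec t]dd -(satisfaction_gain eta T0' bc bpos tcw (cT t)).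
by rewrite dd -E (fineK fin).
Qed.

Lemma measurable_satisfaction : measurable_fun setT
  (fun p : R * Omega => satisfaction T beta eta C (clamp T p.1) p.2).
Proof.
rewrite (_ : (fun p => _) = fun p : R * Omega =>
  (satisfaction T beta eta C (clamp T p.1) p.2 - eta * dec p.1) + eta * dec p.1).
  apply: measurable_funD => //; apply: measurable_funM => //.
  exact: measurableT_comp (measurable_cdecay T0' bc bpos) measurable_fst.
by apply/funext => p; rewrite subrK.
Qed.

Variable W : R -> Omega -> R.
Hypotheses (W0 : forall t w, 0 <= W t w)
  (mW : measurable_fun setT (fun p : R * Omega => W p.1 p.2)).

(** The term in [eta] does not depend on the plan, so that only the last term has to be compared
    between two plans. *)
Lemma weighted_satisfaction :
  (\int[lebesgue_upto T \x P]_p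
     (W p.1 p.2 * satisfaction T beta eta C (clamp T p.1) p.2)%:E =
   \int[lebesgue_upto T \x P]_p (W p.1 p.2 * (eta * dec p.1))%:E +
   \int[P]_w \int[mu]_(t in `[0%R, T]) ((W t w * dec t)%:E *
     \int[mu]_(u in `]a0, g t w]) (sd (htime T (g ^~ w) u))%:E))%E.
Proof.
have mdec : measurable_fun setT (fun p : R * Omega => eta * dec p.1).
  apply: measurable_funM => //.
  exact: measurableT_comp (measurable_cdecay T0' bc bpos) measurable_fst.
have dec0 s : 0 <= dec s by rewrite ltW// cdecay_gt0.
pose h (p : R * Omega) : \bar R :=
  (W p.1 p.2 * (satisfaction T beta eta C (clamp T p.1) p.2 - eta * dec p.1))%:E.
have mh : measurable_fun setT h by apply/measurable_EFinP; exact: measurable_funM.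
have h0 p : (0 <= h p)%E by rewrite lee_fin mulr_ge0.
transitivity (\int[lebesgue_upto T \x P]_p (W p.1 p.2 * (eta * dec p.1))%:E +
   \int[lebesgue_upto T \x P]_p h p)%E.
  rewrite -ge0_integralD//.
  - by apply: eq_integral => p _; rewrite -EFinD -mulrDr addrC subrK.
  - by move=> p _; rewrite lee_fin !mulr_ge0.
  - by apply/measurable_EFinP; exact: measurable_funM.
congr (_ + _)%E.
have -> : (\int[lebesgue_upto T \x P]_p h p =
    \int[P]_w \int[lebesgue_upto T]_t h (t, w))%E by exact: fubini_tonelli2.
apply: eq_integral => w _.
rewrite integral_lebesgue_upto; last first.
  exact: measurableT_comp mh (@pair2_measurable _ _ R Omega w).
apply: eq_integral => t; rewrite inE/= in_itv/= => tT; have [K tcw] := tc w.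
rewrite /h/= EFinM EFinM -muleA; congr (_ * _)%E.
rewrite -(satisfaction_gain eta T0' bc bpos tcw tT) /cdecay clamp_id//.
Qed.

Variables (r : R -> Omega -> R) (Kr : R).
Hypotheses (rP : progressive T F r) (rK : forall t w, 0 <= t <= T -> `|r t w| <= Kr).
Variables (Pstar : probability (g_sigma_algebraType (F T)) R) (Z : R -> Omega -> R).
Hypothesis ZP : density_process P Pstar Z.
Variable Kk : R.
Hypotheses (kK : forall s, k s <= Kk) (rk : forall t, 0 <= t < T -> k @ t^'+ --> k t).

Lemma state_price_right_continuous :
  right_continuous_paths T (fun t w => discount r t w * Z t w).
Proof.
move=> w t tT; have [_ [rZ _] _ _] := ZP.
by apply: cvgM; [exact: (discount_right_continuous T0 rP rK (w := w) tT)|exact: rZ].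
Qed.

Lemma measurable_state_price : measurable_fun setT
  (fun p : R * Omega => discount r (clamp T p.1) p.2 * Z (clamp T p.1) p.2).
Proof.
apply: (measurable_right_continuous (X := fun t w => discount r t w * Z t w) T0'
  _ state_price_right_continuous) => s sT.
have [aZ _ _ _] := ZP; apply: measurable_funM; last exact: (adapted_measurable FM aZ sT).
exact: (adapted_measurable FM (discount_adapted Fs rP rK) sT).
Qed.

Lemma plan_expected_cost :
  (\int[Pstar]_w \int[dC_measure T C w]_(t in `[0%R, T]) (discount r t w)%:E =
   \int[P]_w \int[dC_measure T C w]_(t in `[0%R, T]) (discount r t w * Z t w)%:E)%E.
Proof.
have TT : 0 <= T <= T by rewrite T0' lexx.
have [_ _ Z0 _] := ZP.
transitivity (\int[Pstar]_w \int[mu]_(u in `]a0, g T w])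
    (discount r (htime T (g ^~ w) u) w * k (htime T (g ^~ w) u))%:E)%E.
  apply: eq_integral => w _; have [K tcw] := tc w.
  rewrite (plan_cost T0' tcw (h := discount r ^~ w)).
  - by apply: eq_integral => u _; rewrite mulrC.
  - exact: measurableT_comp (measurable_discount_at rP rK TT)
      (@pair2_measurable _ _ R (g_sigma_algebraType (F T)) w).
  - by move=> s; exact: expR_ge0.
rewrite (expected_cost T0 Fs FM Fmono rP rK ZP a0 ag rg k0 kK mk rk).
apply: eq_integral => w _; have [K tcw] := tc w.
rewrite (plan_cost T0' tcw (h := fun t => discount r t w * Z t w))//.
- exact: measurableT_comp measurable_state_price (@pair2_measurable _ _ R Omega w).
- by move=> s; rewrite mulr_ge0// expR_ge0.
Qed.

End TimeChangedPlans.

(** * Optimality of the candidate plan *)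

Lemma recursive_utility_ext {d} {Omega : measurableType d} {R : realType}
    (P : probability Omega R) (T : R) F f (Y Y' U : R -> Omega -> R) :
  (forall t w, 0 <= t <= T -> Y t w = Y' t w) ->
  recursive_utility P T F f Y U -> recursive_utility P T F f Y' U.
Proof.
move=> YY' [aU cU sU iU eU]; split => //.
- apply: filterS iU => w; apply: eq_integrable => //= s.
  by rewrite inE/= in_itv/= => sT; rewrite YY'.
- move=> t tT; have := eU t tT; congr (is_cond_exp _ _ _ _); apply/funext => w.
  congr EFin; apply: eq_Rintegral => s; rewrite inE/= in_itv/= => /andP[ts sT].
  by rewrite YY'// sT andbT; have /andP[t0 _] := tT; exact: le_trans ts.
Qed.

(** [X - Y] is almost everywhere nonnegative with integral at most 0, hence vanishes almost
    everywhere. *)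
Lemma ae_le_of_integral_le {d} {Omega : measurableType d} {R : realType}
    (P : {measure set Omega -> \bar R}) (X Y : Omega -> R) :
  P.-integrable setT (EFin \o X) -> P.-integrable setT (EFin \o Y) ->
  {ae P, forall w, Y w <= X w} ->
  (\int[P]_w (X w)%:E <= \int[P]_w (Y w)%:E)%E -> {ae P, forall w, X w <= Y w}.
Proof.
move=> iX iY YX leI.
have iD : P.-integrable setT (fun w => (X w - Y w)%:E).
  by under eq_fun do rewrite EFinB; exact: integrableB.
have mD := measurable_int P iD.
have E : (\int[P]_w `|(X w - Y w)%:E| = \int[P]_w (X w - Y w)%:E)%E.
  apply: ae_eq_integral => //; first exact: measurableT_comp.
  by apply: filterS YX => w YXw _; rewrite gee0_abs// lee_fin subr_ge0.
have : (\int[P]_w `|(X w - Y w)%:E| = 0)%E.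
  apply/le_anti/andP; split; last by apply: integral_ge0 => w _; exact: abse_ge0.
  by rewrite E integralB_EFin// sube_le0.
move=> /(ae_eq_integral_abs P measurableT mD).
by apply: filterS => w /(_ I) [] /subr0_eq ->.
Qed.

Theorem theorem4p3 (R : realType) (d : measure_display)
  (Omega : measurableType d) (P0 : probability Omega R)
  (T : R) (T_gt0 : 0 < T)
  (B : R -> Omega -> R) (B_brownian : brownian_motion P0 T B)
  (vartheta : {sigma_finite_measure set R -> \bar R})
  (vartheta_levy :
     (\int[vartheta]_(x in ~` [set 0%R]) (Num.min 1 (x ^+ 2))%:E < +oo)%E)
  (v : Omega -> {measure set (R * R) -> \bar R})
  (v_poisson : poisson_random_measure P0 T vartheta v)
  (F : R -> set (set Omega)) (F_generated : F = generated_filtration P0 B v)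
  (r : R -> Omega -> R) (r_progressive : progressive T F r)
  (r_bounded : exists K : R, forall t w, 0 <= t <= T -> `|r t w| <= K)
  (Pstar : probability (g_sigma_algebraType (F T)) R)
  (Pstar_equivalent : equivalent_measure P0 Pstar)
  (Z : R -> Omega -> R) (Z_density : density_process P0 Pstar Z)
  (psi : R -> Omega -> R)
  (psi_def : psi = fun t w => discount r t w * Z t w)
  (beta : R -> R) (beta_continuous : {within `[0, T], continuous beta})
  (beta_gt0 : forall s, 0 <= s <= T -> 0 < beta s)
  (eta : R) (eta_ge0 : 0 <= eta)
  (f : R -> R -> R -> R) (f_borel : borel_aggregator T f)
  (alpha : R) (A1 : condA1 T f) (A2 : condA2 T f) (A3 : condA3 T f alpha)
  (A4 : condA4 P0 Pstar alpha)
  (M : R) (M_gt0 : 0 < M)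
  (L U : R -> Omega -> R)
  (L_solution :
     unique_forward_backward_solution P0 T F f beta eta M psi L U)
  (C : R -> Omega -> R) (C_def : C = plan_of_level T beta eta (level beta eta L))
  (w : \bar R)
  (w_def : w = (\int[P0]_omega
                  \int[dC_measure T C omega]_(t in `[0%R, T])
                    (psi t omega)%:E)%E) :
  optimal_plan P0 f beta eta Pstar r w C.
Proof.
have T0' : 0 <= T by exact: ltW.
have T00 : (0 : R) <= 0 <= T by apply/andP.
have TT : 0 <= T <= T by apply/andP.
have Fs t : 0 <= t <= T -> sigma_algebra setT (F t).
  by move=> _; rewrite F_generated; exact: generated_filtration_sigma.
have FM t : 0 <= t <= T -> F t `<=` measurable.
  move=> tT; rewrite F_generated.
  exact: (generated_filtration_measurable B_brownian v_poisson tT).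
have Fmono s t : 0 <= s -> s <= t -> t <= T -> F s `<=` F t.
  by move=> s0 st tT; rewrite F_generated; exact: (generated_filtration_mono s0 st tT).
have F0 A : F 0 A -> P0 A = 0%E \/ P0 (~` A) = 0%E.
  rewrite F_generated.
  exact: (generated_filtration0_trivial T0' B_brownian v_poisson).
have [Kr rK] := r_bounded; have [K fK] := A2; have [_ [K3 fK3]] := A3.
have f0 s (sT : 0 <= s <= T) : `|f s 0 0| <= K3 * (1 + 0 `^ alpha) := fK3 s 0 sT (lexx 0).
have [[aL L0 LT LB al rl YU foc] _] := L_solution.
have [aU [rU _] _ _ _] := YU.
have bc := beta_continuous; have bpos := beta_gt0.
have ae := envelope_adapted Fs al.
have re om : rc_path T (envelope beta eta L ^~ om) by exact: envelope_rc_path.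
pose k := decay_over_beta T beta.
have k0 : forall s, 0 <= k s by move=> s; exact: decay_over_beta_ge0.
have mk : measurable_fun setT k by exact: measurable_decay_over_beta.
have rk t : 0 <= t < T -> k @ t^'+ --> k t by exact: decay_over_beta_right_continuous.
have [Kk kK] : exists Kk, forall s, k s <= Kk.
  have [m [Kb [m0 Kb0 mb]]] := cbeta_bounds T0' bc bpos; exists (1 * m^-1) => s.
  have /andP[mbs _] := mb s.
  apply: ler_pM; [exact/ltW/cdecay_gt0|by rewrite invr_ge0 ltW// (cbeta_gt0 T0' bpos)| |].
    exact: (cdecay_le1 T0' bpos).
  by rewrite lef_pV2 ?posrE// (cbeta_gt0 T0' bpos).
have tcC om : exists Kc, time_changed T (envelope beta eta L ^~ om) eta k Kc (C ^~ om).
  apply: (level_plan_time_changed T0' bc bpos (re om) eta_ge0 (envelope_ge_eta _ _ _ _ _)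
    (Y := level beta eta L ^~ om)) => // t tT.
  by rewrite C_def.
have satC t om : 0 <= t <= T -> level beta eta L t om = satisfaction T beta eta C t om.
  move=> tT; have [Kc tc] := tcC om.
  (* The density [dec / b] of the plan is inverse to the factor [b / dec] of the kernel, so the gain
     in satisfaction is [dec t] times the length of []eta, A t]]. *)
  have sdE s : satisfaction_density T beta k s = 1.
    rewrite /satisfaction_density /k /decay_over_beta.
    have b0 := cbeta_gt0 T0' bpos s; have d0 := cdecay_gt0 T beta s.
    by field; rewrite !gt_eqF.
  have := satisfaction_gain eta T0' bc bpos tc tT.
  rewrite (_ : (\int[_]_(u in _) _ = (envelope beta eta L t om - eta)%:E)%E); last first.
    under eq_integral do rewrite sdE.
    rewrite integral_cst//= mul1e lebesgue_measure_itv/= lte_fin.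
    have := envelope_ge_eta beta eta L t om; rewrite le_eqVlt => /predU1P[<-|->].
      by rewrite ltxx subrr.
    by rewrite EFinB.
  have /andP[t0 tT'] := tT.
  rewrite /cdecay clamp_id// levelE => -[] /(canRL (subrK _)) ->.
  by rewrite mulrBr [eta * _]mulrC subrK.
have YU' : recursive_utility P0 T F f (satisfaction T beta eta C) U.
  exact: recursive_utility_ext satC YU.
have costC := plan_expected_cost T_gt0 Fs FM Fmono ae tcC k0 mk r_progressive rK
  Z_density kK rk.
(* The candidate spends its initial capital exactly. *)
have wE : w = (\int[Pstar]_om \int[dC_measure T C om]_(t in `[0%R, T]) (discount r t om)%:E)%E.
  by rewrite costC w_def psi_def.
have planC := time_changed_plan T_gt0 Fs Fmono ae tcC k0 mk.
split; first by split => //; rewrite wE.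
exists U; split => // C' U' [planC' costC'] YU2.
have [aC' rC' ndC' C'0] := planC'.
pose one := (fun=> 1) : R -> R.
have one0 : forall s, 0 <= one s by [].
have mone : measurable_fun setT one by exact: measurable_cst.
have rC om : rc_path T (C' ^~ om).
  by split=> [s t s0 st tT|t tT]; [exact: ndC'|exact: rC'].
have tcC' om : exists Kc, time_changed T (C' ^~ om) 0 one Kc (C' ^~ om).
  by exists 1; apply: time_changed_self => //; exact: C'0.
have rone (t : R) : 0 <= t < T -> one @ t^'+ --> one t by move=> _; exact: cvg_cst.
have costC'E := plan_expected_cost T_gt0 Fs FM Fmono aC' tcC' one0 mone r_progressive rK
  Z_density (fun=> lexx 1) rone.
have Z0 t om : 0 <= Z t om by have [_ _ + _] := Z_density; exact.
have psi0 t om : 0 <= psi t om by rewrite psi_def mulr_ge0// expR_ge0.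
have mpsi : measurable_fun setT (fun p : R * Omega => psi (clamp T p.1) p.2).
  by rewrite psi_def; exact: (measurable_state_price T_gt0 Fs FM r_progressive rK Z_density).
pose W := felicity_weight T f beta eta L U.
have W0 t om : 0 <= W t om by exact: felicity_weight_ge0.
have mW : measurable_fun setT (fun p : R * Omega => W p.1 p.2).
  exact: (measurable_felicity_weight T_gt0 FM A1 f_borel fK eta_ge0 al rl aU rU).
have mpsio om : measurable_fun setT (fun s => psi (clamp T s) om).
  exact: measurableT_comp mpsi (@pair2_measurable _ _ R Omega om).
have benefit' := expected_benefit_le T_gt0 Fs FM Fmono A1 f_borel fK bc bpos eta_ge0
  L0 LB al rl aU rU (ltW M_gt0) psi0 mpsi foc 0 aC' rC one0 mone.
have benefit := expected_level_benefit_ge T_gt0 Fs FM Fmono A1 f_borel fK bc bpos eta_ge0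
  L0 LB LT al rl aU rU (ltW M_gt0) psi0 mpsi foc k0 mk.
have priceC' : (\int[P0]_om \int[lebesgue_measure]_(u in `]0%R, C' T om])
    (one (htime T (C' ^~ om) u) * psi (htime T (C' ^~ om) u) om)%:E =
    \int[P0]_om \int[dC_measure T C' om]_(t in `[0%R, T]) (psi t om)%:E)%E.
  apply: eq_integral => om _; have [Kc tc] := tcC' om.
  by rewrite (plan_cost T0' tc (h := psi ^~ om)).
have priceC : (\int[P0]_om \int[lebesgue_measure]_(u in `]eta, envelope beta eta L T om])
    (k (htime T (envelope beta eta L ^~ om) u) *
     psi (htime T (envelope beta eta L ^~ om) u) om)%:E = w)%E.
  rewrite w_def; apply: eq_integral => om _; have [Kc tc] := tcC om.
  by rewrite (plan_cost T0' tc (h := psi ^~ om)).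
have mg (g : R -> Omega -> R) : adapted T F g -> (forall om, rc_path T (g ^~ om)) ->
    measurable_fun setT (fun p : R * Omega => g (clamp T p.1) p.2).
  move=> ag rg; apply: (measurable_right_continuous (X := g) T0').
    by move=> s sT; exact: (adapted_measurable FM ag sT).
  by move=> om t tT; have [_ rc] := rg om; exact: rc.
have weighted : (\int[lebesgue_upto T \x P0]_p
      (W p.1 p.2 * satisfaction T beta eta C' (clamp T p.1) p.2)%:E <=
    \int[lebesgue_upto T \x P0]_p
      (W p.1 p.2 * level beta eta L (clamp T p.1) p.2)%:E)%E.
  rewrite (weighted_satisfaction P0 T_gt0 FM bc bpos eta_ge0 aC' tcC' one0 mone
    (mg _ aC' rC) W0 mW).
  have -> : (\int[lebesgue_upto T \x P0]_p
      (W p.1 p.2 * level beta eta L (clamp T p.1) p.2)%:E =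
    \int[lebesgue_upto T \x P0]_p
      (W p.1 p.2 * satisfaction T beta eta C (clamp T p.1) p.2)%:E)%E.
    by apply: eq_integral => p _; rewrite satC// clamp_itv.
  rewrite (weighted_satisfaction P0 T_gt0 FM bc bpos eta_ge0 ae tcC k0 mk
    (mg _ ae re) W0 mW).
  (* The benefit of [C'] is at most [M] times its cost, hence at most [M * w], which is at most the
     benefit of [C]. *)
  apply: leeD2l; apply: (le_trans benefit'); apply: le_trans benefit.
  rewrite priceC' priceC; apply: lee_wpmul2l; first by rewrite lee_fin ltW.
  by apply: le_trans costC'; rewrite costC'E psi_def.
have le_expected := utility_comparison T_gt0 Fs FM Fmono A1 f_borel fK f0 eta_ge0 al rl YU
  (measurable_satisfaction T_gt0 FM eta bc bpos aC' tcC' one0 mone (mg _ aC' rC))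
  (fun t om => satisfaction_ge0 T_gt0 bc bpos eta_ge0 tcC' one0 om) YU2 weighted.
have [_ _ _ _ /(_ 0 T00)[_ iU _ _]] := YU.
have [aU' _ _ _ /(_ 0 T00)[_ iU' _ _]] := YU2.
(* [A] belongs to [F 0], so it is null or almost sure. In the second case [U 0 <= U' 0] almost
   surely, and the reverse inequality of expectations forces equality. *)
pose A := [set om | U 0 om < U' 0 om].
have FA : F 0 A.
  have /(measurable_wrtP _ (Fs _ T00)) m1 := aU 0 T00.
  have /(measurable_wrtP _ (Fs _ T00)) m2 := aU' 0 T00.
  have := measurable_set_lt m1 m2.
  by rewrite /measurable/= (sigma_algebra_id (Fs _ T00)).
have mA : measurable A := FM 0 T00 A FA.
have [PA|PA] := F0 A FA.
  exists A; split => // om /= /negP; rewrite -ltNge; exact.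
apply: (ae_le_of_integral_le iU' iU) => //.
exists (~` A); split => //; first exact: measurableC.
by move=> om /= nle lt; apply: nle; exact: ltW.
Qed.
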